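(* Let $n\ge 1$, let $f$ be a transcendental entire function on $\mathbb{C}^n$, and let $a,b\in\mathbb{C}\setminus\{0\}$ be such that $a\neq b$. Suppose that (i) for every $i=1,2,\ldots,n$: $\partial_{z_i}(f)=a\Rightarrow f=a$; (ii) for every $i=1,2,\ldots,n$: $f=b\Leftrightarrow \partial_{z_i}(f)=b$. Then $f(z)=c\,e^{z_1+z_2+\cdots+z_n}$, where $c\in\mathbb{C}$ is a non-zero constant.
   Context: Write $z=(z_1,\ldots,z_n)\in\mathbb{C}^n$ and $\partial_{z_i}(f)=\partial f/\partial z_i$. An entire function on $\mathbb{C}^n$ is a function holomorphic on all of $\mathbb{C}^n$; it is transcendental if it is not a polynomial. For functions $f,g$ and $a\in\mathbb{C}$, the notation $f=a\Rightarrow g=a$ means that $g(z)=a$ at every point $z$ with $f(z)=a$; the notation $f=a\Leftrightarrow g=a$ means that both $f=a\Rightarrow g=a$ and $g=a\Rightarrow f=a$ hold. *)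

(* Defs.v *)
From HB Require Import structures.
From mathcomp Require Import all_boot all_order all_algebra.
From mathcomp Require Import complex.
From mathcomp Require Import all_classical all_reals all_analysis.
(* not imported: its notations clash with those of MathComp-Analysis *)
From mathcomp.multinomials Require mpoly.

Set Implicit Arguments.
Unset Strict Implicit.
Unset Printing Implicit Defensive.

Import Order.TTheory GRing.Theory Num.Theory.
Import numFieldNormedType.Exports.

Local Open Scope ring_scope.
Local Open Scope complex_scope.

(* C^n is the type 'rV[R[i]^o]_n of row vectors, with its normed module structure
   over the field R[i]; hence all derivatives below are complex derivatives. *)

(* Holomorphic on all of C^n: complex Frechet differentiable at every point. *)
Definition entire (R : realType) (n : nat) (f : 'rV[R[i]^o]_n -> R[i]^o) : Prop :=
  forall z : 'rV[R[i]^o]_n, differentiable f z.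

Definition is_polynomial (R : realType) (n : nat)
    (f : 'rV[R[i]^o]_n -> R[i]^o) : Prop :=
  exists p : mpoly.mpoly n R[i],
    forall z : 'rV[R[i]^o]_n, f z = mpoly.meval (fun j : 'I_n => z ord0 j) p.

Definition transcendental_entire (R : realType) (n : nat)
    (f : 'rV[R[i]^o]_n -> R[i]^o) : Prop :=
  entire f /\ ~ is_polynomial f.

Definition partial (R : realType) (n : nat) (j : 'I_n)
    (f : 'rV[R[i]^o]_n -> R[i]^o) (z : 'rV[R[i]^o]_n) : R[i]^o :=
  'D_(delta_mx ord0 j) f z.

(* f = a => g = a, and f = a <=> g = a, pointwise *)
Definition value_imp (T : Type) (C : Type) (f g : T -> C) (a : C) : Prop :=
  forall z : T, f z = a -> g z = a.

Definition value_iff (T : Type) (C : Type) (f g : T -> C) (a : C) : Prop :=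
  value_imp f g a /\ value_imp g f a.

(* e^(x + iy) = e^x (cos y + i sin y) *)
Definition cexp (R : realType) (w : R[i]) : R[i] :=
  (expR (complex.Re w))%:C *
  (cos (complex.Im w) +i* sin (complex.Im w)).

(* Main.v *)
(* On a line parallel to a coordinate axis the restriction of f is an entire function
   g of one variable with g' = a => g = a and g = b <=> g' = b, and it suffices to show
   that such a g is constant or satisfies g' = g.

   Put F = g - b, so that F = 0 => F' = b and F' = a => F = a - b. If |F'| >= |b| + 1 held
   at points p_n with F(p_n) -> 0, then rescalings F(p_n + rho_n z) / rho_n with
   rho_n = |F(p_n)| would have an entire limit G of exponential type whose derivative
   omits a and equals b at the zeros of G; explicitly G' = a + e^(linear), which is
   impossible. So F' is bounded where F is small, and Hopf's lemma applied to the
   harmonic function ln|F| gives |g'| <= K (1 + |g|) everywhere. The translates of g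
   then form a locally bounded family, and compactness shows that the entire function
   Theta = g''(g - g') / ((g' - a)(g - b)) is bounded, hence constant. If Theta = 0 then
   g' = g. Otherwise Q = (g' - b) / (g - b) has no zeros and exponential growth, so
   Q = e^(al z + be); for al = 0 one gets g' = g from a point where g' = a, and for
   al <> 0 eliminating g yields an impossible polynomial identity in Q.

   No integration theory is used: Goursat's bisection is carried out on Riemann sums,
   contour integrals over circles are averages over roots of unity of order 2^n, and
   limits of families are taken pointwise along a free ultrafilter on nat. *)
Require Import Defs.
From HB Require Import structures.
From mathcomp Require Import all_boot all_order all_algebra.
From mathcomp Require Import complex.
From mathcomp Require Import all_classical all_reals all_analysis.
From mathcomp Require Import ring lra zify.

Import Order.TTheory GRing.Theory Num.Theory.
Import numFieldNormedType.Exports.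

Local Open Scope ring_scope.
Local Open Scope complex_scope.
Local Open Scope classical_set_scope.

Set Implicit Arguments.
Unset Strict Implicit.
Unset Printing Implicit Defensive.

(** * Modulus and limits *)

Section Modulus.
Context {R : realType}.
Local Notation C := R[i].
Implicit Types (z w : C) (x y e : R).

(** The two values do different work under limits. [F = 0 => F' = b] passes unchanged to a rescaled
    limit, whereas [F' = a => F = a - b] becomes [rho G = a - b] with [rho] tending to 0, so that by
    Hurwitz's theorem the limit derivative either omits [a] or is identically [a]. Theta has no
    poles because [g - g'] vanishes wherever [g' = a] or [g = b]: at the former points [g''] loses
    just one order against [g' - a], and at the latter [g - b] has a simple zero because [b] is not
    0. Two obstacles stand against bounding Theta by compactness. Translates are locally bounded
    only along points where [g] stays bounded, so large [|g|] needs a separate estimate of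
    [g'' / (g' - a)]; and when translates converge to the constant [b], the limit of the denominator
    vanishes identically, so that a bound on the logarithmic derivative of [g - b] has to replace
    it. In several variables the lines are tied together at a point where [f = b]: all partial
    derivatives there equal [b], hence no coordinate line through it is constant. *)

Definition cm (z : C) : R := complex.Re `|z|.

Lemma normcm z : `|z| = (cm z)%:C. Proof. by rewrite /cm RRe_real // normr_real. Qed.

Lemma cm_ge0 z : 0 <= cm z. Proof. by have := normr_ge0 z; rewrite normcm ler0c. Qed.

Lemma cm0 : cm 0 = 0. Proof. by rewrite /cm normr0. Qed.
Lemma cm1 : cm 1 = 1. Proof. by rewrite /cm normr1. Qed.
Lemma cmN z : cm (- z) = cm z. Proof. by rewrite /cm normrN. Qed.
Lemma cm_sym z w : cm (z - w) = cm (w - z). Proof. by rewrite -cmN opprB. Qed.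

Lemma cm_eq0 z : (cm z == 0) = (z == 0).
Proof. by rewrite -[RHS]normr_eq0 normcm eq_complex /= eqxx andbT. Qed.

Lemma cm_gt0 z : (0 < cm z) = (z != 0).
Proof. by rewrite lt_def cm_ge0 andbT cm_eq0. Qed.

Lemma cmM z w : cm (z * w) = cm z * cm w.
Proof. by apply: complexI; rewrite rmorphM /= -!normcm normrM. Qed.

Lemma cmV z : cm z^-1 = (cm z)^-1.
Proof. by apply: complexI; rewrite fmorphV /= -!normcm normfV. Qed.

Lemma cmX z n : cm (z ^+ n) = cm z ^+ n.
Proof. by elim: n => [|n IH]; rewrite ?expr0 ?cm1// !exprS cmM IH. Qed.

Lemma cmD z w : cm (z + w) <= cm z + cm w.
Proof. by have := ler_normD z w; rewrite !normcm -rmorphD lecR. Qed.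

Lemma cmB z w : cm (z - w) <= cm z + cm w.
Proof. by rewrite -(cmN w) cmD. Qed.

Lemma cm_dist z w v : cm (z - v) <= cm (z - w) + cm (w - v).
Proof. by rewrite (le_trans _ (cmD _ _))// addrA subrK. Qed.

Lemma cm_le_dist z w : cm z <= cm w + cm (z - w).
Proof. by have := cmD w (z - w); rewrite addrC subrK. Qed.

Lemma cmR x : cm x%:C = `|x|.
Proof. by rewrite /cm normc_def /= expr0n addr0 sqrtr_sqr. Qed.

Lemma cmi : cm 'i = 1.
Proof. by rewrite /cm normc_def /= expr0n /= add0r expr1n sqrtr1. Qed.

Lemma cm_sqr z : cm z ^+ 2 = complex.Re z ^+ 2 + complex.Im z ^+ 2.
Proof. by rewrite /cm normc_def /= sqr_sqrtr // addr_ge0 // sqr_ge0. Qed.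

Lemma cm_Re z : `|complex.Re z| <= cm z.
Proof.
rewrite -(@ler_pXn2r _ 2) ?nnegrE ?cm_ge0 //.
by rewrite cm_sqr real_normK ?num_real// lerDl sqr_ge0.
Qed.

Lemma cm_Im z : `|complex.Im z| <= cm z.
Proof.
rewrite -(@ler_pXn2r _ 2) ?nnegrE ?cm_ge0 //.
by rewrite cm_sqr real_normK ?num_real// lerDr sqr_ge0.
Qed.

Lemma Re_le_cm z : complex.Re z <= cm z.
Proof. exact: le_trans (ler_norm _) (cm_Re z). Qed.

Lemma cm_ReIm z : cm z <= `|complex.Re z| + `|complex.Im z|.
Proof.
rewrite {1}(complexE z) (le_trans (cmD _ _))// cmM cmi mul1r !cmR //.
Qed.

Lemma cm_sum (I : Type) (r : seq I) (P : pred I) (F : I -> C) :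
  cm (\sum_(i <- r | P i) F i) <= \sum_(i <- r | P i) cm (F i).
Proof.
elim/big_rec2: _ => [|i x z _ h]; first by rewrite cm0.
by rewrite (le_trans (cmD _ _))// lerD2l.
Qed.

Lemma ReD z w : complex.Re (z + w) = complex.Re z + complex.Re w.
Proof. by case: z; case: w. Qed.
Lemma ReN z : complex.Re (- z) = - complex.Re z.
Proof. by case: z. Qed.
Lemma ReRM x z : complex.Re (x%:C * z) = x * complex.Re z.
Proof. by case: z => a b /=; rewrite mul0r subr0. Qed.
Lemma ImRM x z : complex.Im (x%:C * z) = x * complex.Im z.
Proof. by case: z => a b /=; rewrite mul0r addr0. Qed.
Lemma ImD z w : complex.Im (z + w) = complex.Im z + complex.Im w.
Proof. by case: z; case: w. Qed.
Lemma ImN z : complex.Im (- z) = - complex.Im z.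
Proof. by case: z. Qed.

Lemma rotate z : exists e : C, cm e = 1 /\ e * z = (cm z)%:C.
Proof.
have [->|z0] := eqVneq z 0; first by exists 1; rewrite cm1 cm0 mulr0.
have cz : (cm z)%:C != 0 by rewrite eq_complex /= cm_eq0 (negbTE z0).
exists ((cm z)%:C / z); split; last by rewrite divfK.
by rewrite cmM cmV cmR ger0_norm ?cm_ge0// divff // cm_eq0.
Qed.

End Modulus.

Section Tends.
Context {R : realType}.
Local Notation C := R[i].
Implicit Types (z w l : C).

Definition tends (T : Type) (F : pfilter_on T) (u : T -> C) (l : C) :=
  forall e : R, 0 < e -> F [set t | cm (u t - l) <= e].

(** Despite the name, [z] itself is not removed: these are the full neighbourhoods of [z]. A limit
    along them fixes the value at [z], and composing limits in [tends_comp] needs no avoidance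
    condition. *)
Definition punct_set (z : C) : set_system C :=
  [set A | exists2 d : R, 0 < d & forall w, cm (w - z) < d -> A w].

Lemma punct_filter z : ProperFilter (punct_set z).
Proof.
split=> [[d d0 /(_ z)]|]; first by rewrite subrr cm0 => /(_ d0).
split=> [|A B [d d0 dA] [d' d'0 dB]|A B AB [d d0 dA]].
- by exists 1.
- exists (Num.min d d'); first by rewrite lt_min d0.
  by move=> w; rewrite lt_min => /andP[wd wd']; split; [exact: dA|exact: dB].
- by exists d => // w /dA /AB.
Qed.

Definition punct z : pfilter_on C := PFilterPack (punct_set z) (punct_filter z).

Section Algebra.
Context {T : Type} {F : pfilter_on T}.
Implicit Types u v : T -> C.

Lemma tends_cst l : tends F (fun=> l) l.
Proof. by move=> e e0; apply: filterE => t /=; rewrite subrr cm0 ltW. Qed.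

Lemma tends_ext u v l : F [set t | u t = v t] -> tends F u l -> tends F v l.
Proof.
by move=> uv ul e e0; move: (ul e e0) uv; apply: filterS2 => t /= h <-.
Qed.

Lemma tends_eqf u v l : tends F u l -> (forall t, u t = v t) -> tends F v l.
Proof. by move=> ul uv; apply: (tends_ext _ ul); apply: filterE. Qed.

Lemma tendsD u v l m : tends F u l -> tends F v m ->
  tends F (fun t => u t + v t) (l + m).
Proof.
move=> ul vm e e0; have e2 : 0 < e / 2 by rewrite divr_gt0.
move: (ul _ e2) (vm _ e2); apply: filterS2 => t /= h1 h2.
have -> : u t + v t - (l + m) = (u t - l) + (v t - m) by ring.
by rewrite (le_trans (cmD _ _))//; lra.
Qed.

Lemma tendsN u l : tends F u l -> tends F (fun t => - u t) (- l).
Proof.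
move=> ul e e0; move: (ul _ e0); apply: filterS => t /=.
by rewrite -opprD cmN.
Qed.

Lemma tendsB u v l m : tends F u l -> tends F v m ->
  tends F (fun t => u t - v t) (l - m).
Proof. by move=> ul /tendsN vm; apply: tendsD. Qed.

Lemma tends_bounded u l : tends F u l -> F [set t | cm (u t) <= cm l + 1].
Proof.
move=> /(_ 1 ltr01); apply: filterS => t /= h.
by rewrite (le_trans (cm_le_dist _ l))// lerD2l.
Qed.

Lemma tends0_bounded u v M : tends F u 0 -> F [set t | cm (v t) <= M] ->
  tends F (fun t => u t * v t) 0.
Proof.
move=> u0 vM e e0; have M1 : 0 < `|M| + 1 by rewrite ltr_wpDl.
have eM : 0 < e / (`|M| + 1) by rewrite divr_gt0.
move: (u0 _ eM) vM; apply: filterS2 => t /=; rewrite !subr0 cmM => h1 h2.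
rewrite -[leRHS](divfK (lt0r_neq0 M1)) ler_pM ?cm_ge0//.
by rewrite (le_trans h2)// (le_trans (ler_norm _))// lerDl.
Qed.

Lemma tends_sub0 u l : tends F u l <-> tends F (fun t => u t - l) 0.
Proof.
by split=> h e e0; move: (h e e0); apply: filterS => t /=; rewrite subr0.
Qed.

Lemma tendsM u v l m : tends F u l -> tends F v m ->
  tends F (fun t => u t * v t) (l * m).
Proof.
move=> ul vm; apply/tends_sub0.
have h1 : tends F (fun t => (u t - l) * v t) 0.
  by apply: tends0_bounded (tends_bounded vm); exact: (tends_sub0 _ _).1.
have h2 : tends F (fun t => (v t - m) * l) 0.
  apply: (@tends0_bounded _ _ (cm l)); first exact: (tends_sub0 _ _).1.
  by apply: filterE => t /=.
have := tendsD h1 h2; rewrite addr0; apply: tends_ext.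
by apply: filterE => t /=; ring.
Qed.

Lemma tends_away u l : tends F u l -> l != 0 ->
  F [set t | cm l / 2 <= cm (u t)].
Proof.
rewrite -cm_gt0 => ul l0; have l2 : 0 < cm l / 2 by rewrite divr_gt0.
move: (ul _ l2); apply: filterS => t /=; rewrite cm_sym => h.
by have := cm_le_dist l (u t); lra.
Qed.

Lemma tendsV u l : tends F u l -> l != 0 -> tends F (fun t => (u t)^-1) l^-1.
Proof.
move=> ul l0; have ua := tends_away ul l0.
have cl : 0 < cm l by rewrite cm_gt0.
apply/tends_sub0.
have h : tends F (fun t => (u t - l) * (- ((u t)^-1 * l^-1))) 0.
  apply: (@tends0_bounded _ _ ((cm l / 2)^-1 * (cm l)^-1)); first exact: (tends_sub0 _ _).1.
  move: ua; apply: filterS => t /= h.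
  rewrite cmN cmM !cmV ler_wpM2r ?invr_ge0 ?cm_ge0//.
  by rewrite lef_pV2 ?posrE ?divr_gt0//; apply: lt_le_trans h; rewrite divr_gt0.
apply: tends_ext h; move: ua; apply: filterS => t /= h.
have ut : u t != 0 by rewrite -cm_gt0; apply: lt_le_trans h; rewrite divr_gt0.
by field; rewrite l0 ut.
Qed.

Lemma tends_div u v l m : tends F u l -> tends F v m -> m != 0 ->
  tends F (fun t => u t / v t) (l / m).
Proof. by move=> ul vm m0; apply: tendsM => //; apply: tendsV. Qed.

Lemma tends_cm u l : tends F u l -> tends F (fun t => (cm (u t))%:C) (cm l)%:C.
Proof.
move=> ul e e0; move: (ul e e0); apply: filterS => t /= h.
have := cm_le_dist (u t) l; have := cm_le_dist l (u t).
rewrite (cm_sym l) -rmorphB cmR ler_norml => h1 h2; apply/andP; split; lra.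
Qed.

Lemma tends_squeeze u (b : T -> R) : F [set t | cm (u t) <= b t] ->
  tends F (fun t => (b t)%:C) 0 -> tends F u 0.
Proof.
move=> ub b0 e e0; move: (b0 e e0) ub; apply: filterS2 => t /=.
rewrite !subr0 cmR => h1 h2; apply: le_trans h2 _.
exact: le_trans (ler_norm _) h1.
Qed.

End Algebra.

Lemma tends_unique (T : Type) (F : pfilter_on T) (u : T -> C) l m :
  tends F u l -> tends F u m -> l = m.
Proof.
move=> ul um; apply/eqP; rewrite -subr_eq0 -cm_eq0 eq_le cm_ge0 andbT.
apply/ler_addgt0Pl => e e0; rewrite addr0; have e2 : 0 < e / 2 by rewrite divr_gt0.
have [t /= [h1 h2]] := filter_ex (filterI (ul _ e2) (um _ e2)).
by have := cm_dist l (u t) m; rewrite (cm_sym l (u t)); lra.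
Qed.

Lemma tends_Re_le (T : Type) (F : pfilter_on T) (u : T -> C) l (M : R) :
  tends F u l -> F [set t | complex.Re (u t) <= M] -> complex.Re l <= M.
Proof.
move=> ul uM; apply/ler_addgt0Pl => e e0.
have [t /= [h1 h2]] := filter_ex (filterI (ul _ e0) uM).
have := Re_le_cm (l - u t); rewrite cm_sym ReD ReN; lra.
Qed.

Lemma tends_cm_le (T : Type) (F : pfilter_on T) (u : T -> C) l (M : R) :
  tends F u l -> F [set t | cm (u t) <= M] -> cm l <= M.
Proof. by move=> /tends_cm ul uM; apply: tends_Re_le ul uM. Qed.

Lemma tends_cm_ge (T : Type) (F : pfilter_on T) (u : T -> C) l (M : R) :
  tends F u l -> F [set t | M <= cm (u t)] -> M <= cm l.
Proof.
move=> /tends_cm /tendsN ul uM; rewrite -lerN2.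
apply: tends_Re_le ul _; move: uM; apply: filterS => t /=; lra.
Qed.

Lemma tends_comp (T : Type) (F : pfilter_on T) (u : T -> C) (f : C -> C) l m :
  tends F u l -> tends (punct l) f m -> tends F (fun t => f (u t)) m.
Proof.
move=> ul fm e e0; have [d d0 h] := fm e e0.
have d2 : 0 < d / 2 by rewrite divr_gt0.
move: (ul _ d2); apply: filterS => t /= ht; apply: h.
by apply: le_lt_trans ht _; lra.
Qed.

Lemma tends_id z : tends (punct z) id z.
Proof. by move=> e e0; exists e => // w /ltW. Qed.

Definition cont (f : C -> C) z := tends (punct z) f (f z).

End Tends.

(** * Complex derivatives *)

Section Differentiation.
Context {R : realType}.
Local Notation C := R[i].
Implicit Types (z w l : C) (f g : C -> C).

(** Caratheodory's form of the derivative, with a slope [phi] continuous at [z]. Product and chain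
    rule become identities between slopes; [difP] gives back the epsilon form. *)
Definition dif f z l := exists phi : C -> C,
  [/\ tends (punct z) phi l, phi z = l & forall w, f w = f z + phi w * (w - z)].

Lemma tends_fill f z l : (forall e : R, 0 < e -> exists2 d : R, 0 < d &
    forall w, w != z -> cm (w - z) < d -> cm (f w - l) <= e) ->
  tends (punct z) (fun w => if w == z then l else f w) l.
Proof.
move=> h e e0; have [d d0 hd] := h e e0; exists d => // w wd /=.
by case: eqP => [_|/eqP wz]; [rewrite subrr cm0 ltW|exact: hd].
Qed.

Lemma difP f z l : dif f z l <-> (forall e : R, 0 < e -> exists2 d : R, 0 < d &
    forall w, cm (w - z) < d -> cm (f w - f z - l * (w - z)) <= e * cm (w - z)).
Proof.
split=> [[phi [h1 h2 h3]] e e0|h].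
  have [d d0 hd] := h1 e e0; exists d => // w wd.
  have -> : f w - f z - l * (w - z) = (phi w - l) * (w - z).
    by rewrite (h3 w); ring.
  rewrite cmM ler_wpM2r ?cm_ge0//; exact: hd.
exists (fun w => if w == z then l else (f w - f z) / (w - z)); split.
- apply: tends_fill => e e0; have [d d0 hd] := h e e0; exists d => // w wz wd.
  have wz0 : w - z != 0 by rewrite subr_eq0.
  have -> : (f w - f z) / (w - z) - l = (f w - f z - l * (w - z)) / (w - z).
    by field.
  by rewrite cmM cmV ler_pdivrMr ?cm_gt0// hd.
- by rewrite eqxx.
- move=> w; case: eqP => [->|/eqP wz]; first by rewrite subrr mulr0 addr0.
  by rewrite divfK ?subr_eq0// addrC subrK.
Qed.

Lemma dif_cont f z l : dif f z l -> cont f z.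
Proof.
move=> [phi [h1 h2 h3]]; rewrite /cont.
have := tendsD (tends_cst (F := punct z) (f z))
  (tendsM h1 (tendsB (tends_id z) (tends_cst (F := punct z) z))).
by rewrite subrr mulr0 addr0 => h; apply: (tends_eqf h) => w; rewrite -h3.
Qed.

Lemma dif_cst a z : dif (fun=> a) z 0.
Proof. by exists (fun=> 0); split => // [|w]; [exact: tends_cst|rewrite mul0r addr0]. Qed.

Lemma dif_id z : dif id z 1.
Proof. by exists (fun=> 1); split => // [|w]; [exact: tends_cst|rewrite mul1r addrC subrK]. Qed.

Lemma dif_ext f g z l : (forall w, f w = g w) -> dif f z l -> dif g z l.
Proof. by move=> fg [p [h1 h2 h3]]; exists p; split => // w; rewrite -!fg. Qed.

Lemma dif_local f g z l : punct z [set w | f w = g w] -> dif f z l -> dif g z l.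
Proof.
move=> [d d0 fg] /difP h; apply/difP => e e0; have [d' d'0 hd] := h e e0.
exists (Num.min d d'); first by rewrite lt_min d0.
move=> w; rewrite lt_min => /andP[wd wd'].
by rewrite -(fg w wd) -(fg z) ?subrr ?cm0//; exact: hd.
Qed.

Lemma dif_eq f z l m : dif f z l -> l = m -> dif f z m.
Proof. by move=> h <-. Qed.

Lemma difD f g z l m : dif f z l -> dif g z m -> dif (fun w => f w + g w) z (l + m).
Proof.
move=> [p [h1 h2 h3]] [q [k1 k2 k3]]; exists (fun w => p w + q w); split.
- exact: tendsD.
- by rewrite h2 k2.
- by move=> w; rewrite (h3 w) (k3 w); ring.
Qed.

Lemma difM f g z l m : dif f z l -> dif g z m ->
  dif (fun w => f w * g w) z (l * g z + f z * m).
Proof.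
move=> df dg; have cg := dif_cont dg.
move: df dg => [p [h1 h2 h3]] [q [k1 k2 k3]].
exists (fun w => p w * g w + f z * q w); split.
- apply: tendsD; [exact: tendsM|apply: tendsM => //; exact: tends_cst].
- by rewrite h2 k2.
- by move=> w; rewrite (h3 w) (k3 w); ring.
Qed.

Lemma difN f z l : dif f z l -> dif (fun w => - f w) z (- l).
Proof.
move=> [p [h1 h2 h3]]; exists (fun w => - p w); split.
- exact: tendsN.
- by rewrite h2.
- by move=> w; rewrite (h3 w); ring.
Qed.

Lemma difB f g z l m : dif f z l -> dif g z m -> dif (fun w => f w - g w) z (l - m).
Proof. by move=> df /difN dg; apply: difD. Qed.

Lemma dif_scale a f z l : dif f z l -> dif (fun w => a * f w) z (a * l).
Proof. by move=> h; apply: dif_eq (difM (dif_cst a z) h) _; ring. Qed.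

Lemma dif_comp f g z l m : dif g z m -> dif f (g z) l ->
  dif (fun w => f (g w)) z (l * m).
Proof.
move=> dg df; have cg := dif_cont dg.
move: df dg => [p [h1 h2 h3]] [q [k1 k2 k3]].
exists (fun w => p (g w) * q w); split.
- by apply: tendsM => //; apply: tends_comp cg h1.
- by rewrite h2 k2.
- by move=> w; rewrite (h3 (g w)); rewrite (_ : g w - g z = q w * (w - z)); [ring|rewrite (k3 w); ring].
Qed.

Lemma difV f z l : dif f z l -> f z != 0 ->
  dif (fun w => (f w)^-1) z (- l / f z ^+ 2).
Proof.
move=> df fz; have cf := dif_cont df.
have fn0 : punct z [set w | f w != 0].
  have := tends_away cf fz; apply: filterS => w /= h.
  by rewrite -cm_gt0; apply: lt_le_trans h; rewrite divr_gt0 // cm_gt0.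
move: df => [p [h1 h2 h3]].
(* The factorisation through the slope must hold at every [w], also at zeros of [f], where the
   inverse takes the default value 0; the first branch is the slope that this value dictates. *)
pose q w := if f w == 0 then - (f z)^-1 / (w - z) else - p w / (f w * f z).
have q1 : tends (punct z) q (- l / f z ^+ 2).
  have : tends (punct z) (fun w => - p w / (f w * f z)) (- l / f z ^+ 2).
    apply: tends_div; [exact: tendsN| |by rewrite expf_neq0].
    by rewrite expr2; apply: tendsM => //; exact: tends_cst.
  move=> h'; apply: (tends_ext _ h'); move: fn0; apply: filterS => w /= fw.
  by rewrite /q (negbTE fw).
exists q; split => //.
- by rewrite /q (negbTE fz) h2 expr2.
- move=> w; rewrite /q; case: eqP => fw.
    have wz : w - z != 0.
      by apply: contra_neq fz => wz; move: (h3 w); rewrite wz mulr0 addr0 fw.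
    by rewrite fw invr0 divfK // subrr.
  move/eqP: fw => fw; have E : p w * (w - z) = f w - f z by rewrite (h3 w); ring.
  have -> : - p w / (f w * f z) * (w - z) = - (p w * (w - z)) / (f w * f z).
    by field; rewrite fw fz.
  by rewrite E; field; rewrite fw fz.
Qed.

Lemma dif_unique f z l m : dif f z l -> dif f z m -> l = m.
Proof.
move=> dl dm; have := difB dl dm => /difP h.
apply/eqP; rewrite -subr_eq0 -cm_eq0 eq_le cm_ge0 andbT.
apply/ler_addgt0Pl => e e0; rewrite addr0.
have [d d0 hd] := h e e0.
have d2 : 0 < d / 2 by rewrite divr_gt0.
have := hd (z + (d / 2)%:C); rewrite (addrC z) addrK cmR gtr0_norm // => hh.
have {hh} := hh ltac:(lra).
rewrite [X in cm X](_ : _ = - ((l - m) * (d / 2)%:C)); last by ring.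
by rewrite cmN cmM cmR gtr0_norm // ler_pM2r.
Qed.

End Differentiation.

(** * Limits along a free ultrafilter *)

Section Ultra.

Lemma free_ultrafilter_exists : exists F : set_system nat, UltraFilter F /\ \oo `<=` F.
Proof. exact: ultraFilterLemma. Qed.

Definition free_ultrafilter : set_system nat := projT1 (cid free_ultrafilter_exists).

Lemma free_ultrafilter_ultra : UltraFilter free_ultrafilter.
Proof. by rewrite /free_ultrafilter; case: cid => F []. Qed.

Definition UU : pfilter_on nat :=
  PFilterPack free_ultrafilter (@ultra_proper _ _ free_ultrafilter_ultra).

Lemma UU_ge N : UU [set n | (N <= n)%N].
Proof.
rewrite /= /free_ultrafilter; case: cid => F [_ /=]; apply; exact: nbhs_infty_ge.
Qed.

Lemma UU_ev (A : set nat) N : (forall n, (N <= n)%N -> A n) -> UU A.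
Proof. by move=> h; apply: filterS (UU_ge N). Qed.

Lemma UU_dec (A : set nat) : UU A \/ UU (~` A).
Proof. exact: (@in_ultra_setVsetC _ _ A free_ultrafilter_ultra). Qed.

Lemma UU_not (A : set nat) : ~ UU A -> UU (~` A).
Proof. by case: (UU_dec A). Qed.

Context {R : realType}.
Local Notation C := R[i].


Lemma UU_gt_real (M : R) : UU [set n | M < n%:R].
Proof.
apply: (@UU_ev _ (Num.bound `|M|)) => n /= h.
rewrite (le_lt_trans (ler_norm M))// (lt_le_trans (archi_boundP _))//.
by rewrite ler_nat.
Qed.

(** The limit is the supremum of the [x] that lie below [u n] for almost all [n]. No number above
    the supremum has this property, so by the ultrafilter dichotomy almost all [u n] lie below
    it. *)
Lemma ulim_real (u : nat -> R) (M : R) : UU [set n | `|u n| <= M] ->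
  exists l : R, forall e, 0 < e -> UU [set n | `|u n - l| <= e].
Proof.
move=> uM; pose E := [set x | UU [set n | x <= u n]].
have ubE : ubound E M.
  move=> x Ex; have [n /= [h1 h2]] := filter_ex (filterI Ex uM).
  by rewrite (le_trans h1)// (le_trans (ler_norm _)).
have EM : E (- M).
  by move: uM; apply: filterS => n /=; rewrite ler_norml => /andP[].
have hsE : has_sup E by split; [exists (- M)|exists M].
exists (sup E) => e e0.
have [x Ex xe] := sup_adherent e0 hsE.
have nE : ~ E (sup E + e).
  by move=> /(ub_le_sup (proj2 hsE)); rewrite gerDl leNgt e0.
move: Ex (UU_not nE); apply: filterS2 => n /= h1 /negP; rewrite -ltNge => h2.
by rewrite ler_norml; apply/andP; split; lra.
Qed.

Lemma ulim_exists (u : nat -> C) (M : R) : UU [set n | cm (u n) <= M] ->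
  exists l : C, tends UU u l.
Proof.
move=> uM.
have [|a ha] := @ulim_real (fun n => complex.Re (u n)) M.
  by move: uM; apply: filterS => n /=; apply: le_trans; exact: cm_Re.
have [|b hb] := @ulim_real (fun n => complex.Im (u n)) M.
  by move: uM; apply: filterS => n /=; apply: le_trans; exact: cm_Im.
exists (a +i* b) => e e0; have e2 : 0 < e / 2 by rewrite divr_gt0.
move: (ha _ e2) (hb _ e2); apply: filterS2 => n /= h1 h2.
rewrite (le_trans (cm_ReIm _))// ReD ReN ImD ImN /=; lra.
Qed.

(** Weierstrass's theorem, with closedness and continuity phrased by limits along the ultrafilter.
    Every bounded sequence has such a limit, so a maximising sequence needs no subsequence. *)
Lemma argmax (K : C -> Prop) (phi : C -> R) (M : R) :
  (exists z, K z) -> (forall z, K z -> cm z <= M) ->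
  (forall u l, (forall n, K (u n)) -> tends UU u l -> K l) ->
  (forall u l, (forall n, K (u n)) -> tends UU u l -> K l ->
     tends UU (fun n => (phi (u n))%:C) (phi l)%:C) ->
  exists z, K z /\ forall w, K w -> phi w <= phi z.
Proof.
move=> [z0 Kz0] KM Kcl phic.
have lim u : (forall n, K (u n)) ->
    exists l, K l /\ tends UU (fun n => (phi (u n))%:C) (phi l)%:C.
  move=> Ku; have [|l ul] := @ulim_exists u M.
    by apply: filterE => n /=; exact: KM.
  have Kl := Kcl _ _ Ku ul.
  by exists l; split => //; exact: phic.
pose E := [set phi z | z in K].
have hE : has_ubound E.
  apply: contrapT => nE.
  have /choice[u hu] : forall n : nat, exists z, K z /\ n%:R <= phi z.
    move=> n; apply: contrapT => h; apply: nE; exists n%:R => _ [z Kz <-].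
    rewrite leNgt; apply/negP => /ltW nz; apply: h; by exists z.
  have [l [Kl hl]] := lim u (fun n => (hu n).1).
  have [n /= [h1 h2]] := filter_ex (filterI (hl 1 ltr01) (UU_gt_real (phi l + 1))).
  move: h1; rewrite -rmorphB cmR ler_norml => /andP[_ h1].
  have := (hu n).2; lra.
have hs : has_sup E by split => //; exists (phi z0), z0.
have /choice[u hu] : forall n : nat, exists z, K z /\ sup E - n.+1%:R^-1 < phi z.
  move=> n; have n0 : (0 : R) < n.+1%:R^-1 by rewrite invr_gt0 ltr0n.
  by have [_ [z Kz <-] hz] := sup_adherent n0 hs; exists z.
have [l [Kl hl]] := lim u (fun n => (hu n).1).
exists l; split => // w Kw.
apply: (@le_trans _ _ (sup E)); first by apply: ub_le_sup => //; exists w.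
apply/ler_addgt0Pl => e e0; have e2 : 0 < e / 2 by rewrite divr_gt0.
have [n /= [h1 h2]] := filter_ex (filterI (hl _ e2) (UU_gt_real (e / 2)^-1)).
move: h1; rewrite -rmorphB cmR ler_norml => /andP[_ h1].
have := (hu n).2.
have : n.+1%:R^-1 <= e / 2.
  rewrite -[leRHS]invrK lef_pV2 ?posrE ?invr_gt0 ?ltr0n// ltW// (lt_le_trans h2)//.
  by rewrite ler_nat.
by move: (n.+1%:R^-1) => v; lra.
Qed.

End Ultra.

(** * Goursat's theorem for Riemann sums *)

Section Goursat.
Context {R : realType}.
Local Notation C := R[i].
Implicit Types (f : C -> C) (a h k p z : C).

(* left Riemann sum of [f] along the segment from [a] to [a + h] *)
Definition seg n f a h : C := \sum_(j < (2 ^ n)%N) f (a + j%:R / 2 ^+ n * h) * (h / 2 ^+ n).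

(* counterclockwise Riemann sum along the boundary of a parallelogram; opposite
   sides use translated sample points, so it vanishes exactly on affine maps *)
Definition bdry n f a h k : C :=
  seg n f a h + seg n f (a + h) k - seg n f (a + k) h - seg n f a k.

Definition pgram a h k z := exists s t : R,
  [/\ 0 <= s <= 1, 0 <= t <= 1 & z = a + s%:C * h + t%:C * k].

Lemma two_neq0 : (2 : C) != 0. Proof. by rewrite pnatr_eq0. Qed.

Lemma seg_bisect n f a h : seg n.+1 f a h = seg n f a (h / 2) + seg n f (a + h / 2) (h / 2).
Proof.
have t0 := two_neq0; have tn0 : (2 ^+ n : C) != 0 by rewrite expf_neq0.
rewrite /seg expnS mul2n -addnn big_split_ord /=; congr (_ + _); apply: eq_bigr => j _.
  by rewrite exprS; congr (f _ * _); field.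
by rewrite natrD natrX exprS; congr (f _ * _); field.
Qed.

Lemma bdry_bisect n f a h k : bdry n.+1 f a h k =
  bdry n f a (h / 2) (k / 2) + bdry n f (a + h / 2) (h / 2) (k / 2) +
  bdry n f (a + k / 2) (h / 2) (k / 2) + bdry n f (a + h / 2 + k / 2) (h / 2) (k / 2).
Proof.
have t0 := two_neq0.
rewrite /bdry !seg_bisect.
have -> : a + h / 2 + h / 2 = a + h by field.
have -> : a + k / 2 + k / 2 = a + k by field.
have -> : a + h + k / 2 = a + h / 2 + k / 2 + h / 2 by field.
have -> : a + k + h / 2 = a + h / 2 + k / 2 + k / 2 by field.
have -> : a + k / 2 + h / 2 = a + h / 2 + k / 2 by field.
ring.
Qed.

Lemma dyadic_itv n (j : 'I_(2 ^ n)) :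
  exists t : R, 0 <= t <= 1 /\ (j%:R / 2 ^+ n : C) = t%:C.
Proof.
exists (j%:R / 2 ^+ n); split; last by rewrite rmorphM fmorphV rmorphXn !rmorph_nat.
rewrite divr_ge0 ?exprn_ge0//= ler_pdivrMr ?exprn_gt0// mul1r.
by rewrite -natrX ler_nat ltnW.
Qed.

(** Opposite sides are paired sample by sample. The affine part contributes [- be * k * h] from one
    pair and [be * h * k] from the other, so only the deviations from it remain, at most [2 * e] for
    each pair of samples. *)
Lemma bdry_le n f a h k p (al be : C) (e : R) :
  (forall z, pgram a h k z -> cm (f z - (al + be * (z - p))) <= e) ->
  cm (bdry n f a h k) <= 2 * (cm h + cm k) * e.
Proof.
move=> H.
have tn0 : (2 ^+ n : C) != 0 by rewrite expf_neq0 // two_neq0.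
pose r z := f z - (al + be * (z - p)).
pose x j : C := j%:R / 2 ^+ n.
have -> : bdry n f a h k = \sum_(j < (2 ^ n)%N)
   ((r (a + x j * h) - r (a + k + x j * h)) * (h / 2 ^+ n) +
    (r (a + h + x j * k) - r (a + x j * k)) * (k / 2 ^+ n)).
  have e4 (s1 s2 s3 s4 : C) : s1 + s2 - s3 - s4 = (s1 - s3) + (s2 - s4) by ring.
  rewrite /bdry /seg e4 -!sumrB -big_split /=; apply: eq_bigr => j _.
  by rewrite /r -/(x j); field.
apply: le_trans (cm_sum _ _ _) _.
have -> : 2 * (cm h + cm k) * e = \sum_(j < (2 ^ n)%N) (2 * (cm h + cm k) * e / 2 ^+ n).
  by rewrite sumr_const card_ord -[RHS]mulr_natl natrX [RHS]mulrC divfK// expf_neq0.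
apply: ler_sum => j _.
have [t [t01 xt]] := dyadic_itv j; rewrite -/(x j) in xt.
have B1 : cm (r (a + x j * h)) <= e.
  by apply: H; exists t, 0; rewrite lexx ler01; split => //; rewrite xt mul0r addr0.
have B2 : cm (r (a + k + x j * h)) <= e.
  by apply: H; exists t, 1; rewrite lexx ler01; split => //; rewrite xt; ring.
have B3 : cm (r (a + h + x j * k)) <= e.
  by apply: H; exists 1, t; rewrite lexx ler01; split => //; rewrite xt; ring.
have B4 : cm (r (a + x j * k)) <= e.
  by apply: H; exists 0, t; rewrite lexx ler01; split => //; rewrite xt mul0r addr0.
have c2 : cm (2 ^+ n : C) = 2 ^+ n.
  by rewrite cmX -[2 in LHS](rmorph_nat (real_complex R)) cmR normr_nat.
apply: le_trans (cmD _ _) _; rewrite !cmM cmV c2.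
have -> : 2 * (cm h + cm k) * e / 2 ^+ n =
  (2 * e) * (cm h / 2 ^+ n) + (2 * e) * (cm k / 2 ^+ n) by ring.
have d0 : 0 <= (2 ^+ n)^-1 :> R by rewrite invr_ge0 exprn_ge0.
apply: lerD; apply: ler_wpM2r; rewrite ?mulr_ge0 ?cm_ge0//.
  by apply: le_trans (cmB _ _) _; lra.
by apply: le_trans (cmB _ _) _; lra.
Qed.

Lemma pgram_dist a h k z w : pgram a h k z -> pgram a h k w ->
  cm (z - w) <= cm h + cm k.
Proof.
move=> [s [t [/andP[s0 s1] /andP[t0 t1] ->]]] [s' [t' [/andP[s'0 s'1] /andP[t'0 t'1] ->]]].
have -> : a + s%:C * h + t%:C * k - (a + s'%:C * h + t'%:C * k) =
  (s - s')%:C * h + (t - t')%:C * k by rewrite !rmorphB /=; ring.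
rewrite (le_trans (cmD _ _))// !cmM !cmR; apply: lerD.
  by rewrite ler_piMl ?cm_ge0// ler_norml; apply/andP; split; lra.
by rewrite ler_piMl ?cm_ge0// ler_norml; apply/andP; split; lra.
Qed.

Lemma nested_limit (s : nat -> R) (d : nat -> R) :
  (forall n, s n <= s n.+1) -> (forall n, s n.+1 + d n.+1 <= s n + d n) ->
  (forall n, 0 <= d n) -> exists l, forall n, s n <= l <= s n + d n.
Proof.
move=> s1 s2 d0.
have mono n m : s n <= s (n + m)%N.
  by elim: m => [|m IH]; rewrite ?addn0// addnS (le_trans IH).
have anti n m : s (n + m)%N + d (n + m)%N <= s n + d n.
  by elim: m => [|m IH]; rewrite ?addn0// addnS (le_trans (s2 _)).
have ub n m : s m <= s n + d n.
  have [nm|/ltnW mn] := leqP n m.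
    by rewrite -(subnKC nm) (le_trans _ (anti n (m - n)%N))// lerDl.
  by rewrite (le_trans (mono m (n - m)%N))// subnKC// lerDl.
have hs : has_ubound (range s) by exists (s 0%N + d 0%N) => _ [m _ <-].
exists (sup (range s)) => n; apply/andP; split.
  by apply: ub_le_sup => //; exists n.
by apply: ge_sup; [exists (s 0%N), 0%N|move=> _ [m _ <-]].
Qed.

Lemma goursat f a h k : (forall z, pgram a h k z -> exists l, dif f z l) ->
  forall eta : R, 0 < eta -> exists N, forall n, (N <= n)%N -> cm (bdry n f a h k) <= eta.
Proof.
move=> df eta eta0; apply: contrapT => bad0.
pose sub (x : R * R) := a + x.1%:C * h + x.2%:C * k.
(* Badness is failure for arbitrarily fine sums, with the tolerance scaled by the area factor
   [4 ^+ j]. As [bdry_bisect] trades one level of refinement for four quarters, some quarter of a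
   bad piece is bad. *)
pose bad j x := ~ exists N, forall n, (N <= n)%N ->
  cm (bdry n f (sub x) (h / 2 ^+ j) (k / 2 ^+ j)) <= eta / 4 ^+ j.
pose d j : R := (2 ^+ j)^-1.
have dS j : d j.+1 = d j / 2 by rewrite /d exprS invfM mulrC.
have d_gt0 j : 0 < d j by rewrite /d invr_gt0 exprn_gt0.
have t0 := two_neq0.
have dC j : (d j)%:C = (2 ^+ j)^-1 :> C by rewrite /d fmorphV rmorphXn /= rmorph_nat.
have step (jx : nat * (R * R)) : exists y, bad jx.1 jx.2 -> bad jx.1.+1 y /\
   [/\ jx.2.1 <= y.1, y.1 + d jx.1.+1 <= jx.2.1 + d jx.1,
       jx.2.2 <= y.2 & y.2 + d jx.1.+1 <= jx.2.2 + d jx.1].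
  case: jx => j [s t] /=.
  pose e := d j.+1; have e0 : 0 < e by exact: d_gt0.
  have de : d j = e + e by rewrite /e dS; lra.
  apply: contrapT => H.
  have good x : s <= x.1 -> x.1 + e <= s + d j -> t <= x.2 -> x.2 + e <= t + d j ->
      exists N, forall n, (N <= n)%N ->
      cm (bdry n f (sub x) (h / 2 ^+ j.+1) (k / 2 ^+ j.+1)) <= eta / 4 ^+ j.+1.
    move=> h1 h2 h3 h4; apply: contrapT => bx; apply: H; exists x => _; split => //.
  have B : bad j (s, t).
    by apply: contrapT => B; apply: H; exists (s, t).
  apply: B.
  have [||||N1 H1] := good (s, t); rewrite /= ?de; try lra.
  have [||||N2 H2] := good (s + e, t); rewrite /= ?de; try lra.
  have [||||N3 H3] := good (s, t + e); rewrite /= ?de; try lra.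
  have [||||N4 H4] := good (s + e, t + e); rewrite /= ?de; try lra.
  exists (N1 + N2 + N3 + N4).+1 => -[//|n]; rewrite ltnS => hn.
  have n1 : (N1 <= n)%N by lia.
  have n2 : (N2 <= n)%N by lia.
  have n3 : (N3 <= n)%N by lia.
  have n4 : (N4 <= n)%N by lia.
  have tj0 : (2 ^+ j : C) != 0 by rewrite expf_neq0.
  have E v : v / 2 ^+ j / 2 = v / 2 ^+ j.+1 :> C by rewrite exprS; field.
  rewrite bdry_bisect !E.
  have ee v : v / 2 ^+ j.+1 = e%:C * v :> C by rewrite dC mulrC.
  have E2 : sub (s, t) + h / 2 ^+ j.+1 = sub (s + e, t).
    by rewrite /sub /= rmorphD /= ee; ring.
  have E3 : sub (s, t) + k / 2 ^+ j.+1 = sub (s, t + e).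
    by rewrite /sub /= rmorphD /= ee; ring.
  have E4 : sub (s, t) + h / 2 ^+ j.+1 + k / 2 ^+ j.+1 = sub (s + e, t + e).
    by rewrite /sub /= !rmorphD /= !ee; ring.
  rewrite E4 E2 E3.
  have h1 := H1 n n1.
  have h2 := H2 n n2.
  have h3 := H3 n n3.
  have h4 := H4 n n4.
  have E5 : eta / 4 ^+ j.+1 = eta / 4 ^+ j / 4 by rewrite exprS; field; rewrite expf_neq0.
  rewrite E5 in h1 h2 h3 h4.
  apply: le_trans (cmD _ _) _; apply: le_trans (lerD (cmD _ _) (lexx _)) _.
  by apply: le_trans (lerD (lerD (cmD _ _) (lexx _)) (lexx _)) _; lra.
have [nx hnx] := choice step.
pose x := fix x j := if j is j'.+1 then nx (j', x j') else (0, 0) : R * R.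
have badx j : bad j (x j).
  elim: j => [|j IH]; last exact: (hnx (j, x j) IH).1.
  by rewrite /bad /sub /= !expr0 !divr1 !rmorph0 !mul0r !addr0.
have hx j := (hnx (j, x j) (badx j)).2.
have [s hs] : exists l, forall n, (x n).1 <= l <= (x n).1 + d n.
  by apply: nested_limit => n; [have [] := hx n|have [] := hx n|exact: ltW].
have [t ht] : exists l, forall n, (x n).2 <= l <= (x n).2 + d n.
  by apply: nested_limit => n; [have [] := hx n|have [] := hx n|exact: ltW].
pose p := a + s%:C * h + t%:C * k.
have d00 : d 0%N = 1 by rewrite /d expr0 invr1.
have [l /difP dl] : exists l, dif f p l.
  apply: df; exists s, t; split => //.
    by have := hs 0%N; rewrite d00 /= add0r.
  by have := ht 0%N; rewrite d00 /= add0r.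
pose D := cm h + cm k; have D0 : 0 <= D by rewrite addr_ge0 ?cm_ge0.
(* Chosen so that the bound [2 * e * (D * d j) ^+ 2] coming from [bdry_le] stays below
   [eta * d j ^+ 2], which is [eta / 4 ^+ j]; [D + 1] replaces [D] because [D] may be 0. *)
pose e := eta / (2 * (D + 1) ^+ 2).
have D1 : 0 < D + 1 by rewrite ltr_wpDl.
have e0 : 0 < e by rewrite divr_gt0// mulr_gt0// exprn_gt0.
have [r r0 hr] := dl e e0.
have [j hj] : exists j, D * d j < r.
  have br := archi_boundP (divr_ge0 D0 (ltW r0)).
  move: br; set N := Num.bound _ => br; exists N.
  have h1 : N%:R < 2 ^+ N :> R by rewrite -natrX ltr_nat ltn_expl.
  rewrite /d ltr_pdivrMr ?exprn_gt0// -[X in _ < X]mulrC -ltr_pdivrMr//.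
  exact: lt_trans br h1.
apply: (badx j); exists 0%N => n _.
pose h' := h / 2 ^+ j; pose k' := k / 2 ^+ j.
have cd v : cm (v / 2 ^+ j) = cm v * d j by rewrite -dC cmM cmR gtr0_norm.
have pp : pgram (sub (x j)) h' k' p.
  exists ((s - (x j).1) / d j), ((t - (x j).2) / d j).
  have dj := d_gt0 j; split.
  - have /andP[h1 h2] := hs j.
    apply/andP; split; first by apply: divr_ge0; [rewrite subr_ge0|exact: ltW].
    by rewrite ler_pdivrMr// mul1r lerBlDl.
  - have /andP[h1 h2] := ht j.
    apply/andP; split; first by apply: divr_ge0; [rewrite subr_ge0|exact: ltW].
    by rewrite ler_pdivrMr// mul1r lerBlDl.
  - have cdiv u v : (u / d j)%:C * (v * (d j)%:C) = u%:C * v.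
      by rewrite mulrCA -rmorphM /= divfK ?gt_eqF// mulrC.
    by rewrite /p /sub /h' /k' -dC !cdiv !rmorphB /=; ring.
have := @bdry_le n f (sub (x j)) h' k' p (f p) l (e * (D * d j)).
rewrite -/h' -/k'.
have Dd : cm h' + cm k' = D * d j by rewrite !cd -mulrDl.
rewrite Dd; move=> H; apply: le_trans (H _) _.
  move=> z zp; have zd := pgram_dist zp pp; rewrite Dd in zd.
  rewrite opprD addrA; apply: le_trans (hr z (le_lt_trans zd hj)) _.
  by rewrite ler_pM2l.
have -> : eta / 4 ^+ j = eta * d j ^+ 2.
  by rewrite /d exprVn -exprM mulnC exprM; congr (_ / _ ^+ _); ring.
have -> : 2 * (D * d j) * (e * (D * d j)) = (2 * e * D ^+ 2) * d j ^+ 2 by ring.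
apply: ler_wpM2r; first by apply: exprn_ge0; exact: ltW.
rewrite /e.
have -> : 2 * (eta / (2 * (D + 1) ^+ 2)) * D ^+ 2 = eta * (D / (D + 1)) ^+ 2.
  by field; rewrite gt_eqF.
have q0 : 0 <= D / (D + 1) by apply: divr_ge0 => //; exact: ltW.
by rewrite ger_pMr// expr_le1// ler_pdivrMr// mul1r lerDl.
Qed.

End Goursat.

(** * The exponential and mean values on circles *)

Section Exponential.
Context {R : realType}.
Local Notation C := R[i].
Implicit Types (z w : C) (x y e : R).

Lemma cm_cexp w : cm (cexp w) = expR (complex.Re w).
Proof.
rewrite /cexp cmM cmR gtr0_norm ?expR_gt0//.
have -> : cm (cos (complex.Im w) +i* sin (complex.Im w)) = 1 :> R.
  by apply/eqP; rewrite -(@eqrXn2 _ 2) ?cm_ge0// cm_sqr /= cos2Dsin2 expr1n.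
by rewrite mulr1.
Qed.

Lemma cexp_neq0 w : cexp w != 0.
Proof. by rewrite -cm_gt0 cm_cexp expR_gt0. Qed.

Lemma cexpD z w : cexp (z + w) = cexp z * cexp w.
Proof.
rewrite /cexp ReD ImD expRD cosD sinD.
apply/eqP; rewrite eq_complex /=; apply/andP; split; apply/eqP; ring.
Qed.

Lemma cexp0 : cexp 0 = 1 :> C.
Proof. by rewrite /cexp /= expR0 cos0 sin0 mul1r. Qed.

Lemma cexpN w : cexp (- w) = (cexp w)^-1.
Proof.
by apply: (mulfI (cexp_neq0 w)); rewrite -cexpD subrr cexp0 divff// cexp_neq0.
Qed.

Lemma real_derive_le (f : R -> R) x l : is_derive x (1 : R) f l ->
  forall e, 0 < e -> exists2 d, 0 < d &
    forall h, `|h| < d -> `|f (x + h) - f x - l * h| <= e * `|h|.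
Proof.
move=> [df <-] e e0.
have /cvgrPdist_le/(_ e e0) := df.
rewrite /dnbhs /= => /nbhs_ballP[d /= d0 hd].
exists d => // h hd'.
have [->|h0] := eqVneq h 0; first by rewrite addr0 subrr mulr0 subr0 normr0 mulr0.
have := hd h; rewrite /ball /= sub0r normrN => /(_ hd' h0) /=.
rewrite /GRing.scale /= mulr1 (addrC h) => H.
have -> : f (x + h) - f x - 'D_1 f x * h =
  - (h * ('D_1 f x - h^-1 * (f (x + h) - f x))) by field.
by rewrite normrN normrM mulrC ler_wpM2r.
Qed.

Lemma cexp_dif0 : dif (@cexp R) (0 : C) 1.
Proof.
apply/difP => e e0.
(* The real and imaginary parts together produce seven errors of size at most [e1 * cm w], whence
   the divisor 8. *)
have [e1 [e10 e1e e11]] : exists e1 : R, [/\ 0 < e1, e1 <= e / 8 & e1 <= 1].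
  exists (Num.min 1 (e / 8)).
  by rewrite lt_min ltr01 divr_gt0// !ge_min !lexx orbT.
have [d1 d10 h1] := real_derive_le (is_derive_expR (0 : R)) e10.
have [d2 d20 h2] := real_derive_le (is_derive_cos (0 : R)) e10.
have [d3 d30 h3] := real_derive_le (is_derive_sin (0 : R)) e10.
exists (Num.min e1 (Num.min d1 (Num.min d2 d3))); first by rewrite !lt_min e10 d10 d20 d30.
move=> w; rewrite subr0 !lt_min => /and4P[we w1 w2 w3].
have := cm_Re w; have := cm_Im w.
have := h1 (complex.Re w) (le_lt_trans (cm_Re w) w1).
have := h2 (complex.Im w) (le_lt_trans (cm_Im w) w2).
have := h3 (complex.Im w) (le_lt_trans (cm_Im w) w3).
rewrite !add0r expR0 cos0 sin0 oppr0 mul0r !subr0 !mul1r !addr0.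
set x := complex.Re w; set y := complex.Im w => hs hc he ny nx.
apply: le_trans (cm_ReIm _) _.
rewrite cexp0 /cexp !ReD !ImD !ReN !ImN ReRM ImRM /= -/x -/y oppr0 addr0.
have nx0 := normr_ge0 x; have ny0 := normr_ge0 y.
have -> : expR x * cos y - 1 - x = (expR x - 1 - x) * cos y + (1 + x) * (cos y - 1) by ring.
have -> : expR x * sin y - y = (expR x - 1 - x) * sin y + x * sin y + (sin y - y) by ring.
have c1 : `|cos y| <= 1 by rewrite ler_norml cos_geN1 cos_le1.
have s1 : `|sin y| <= 1 by rewrite ler_norml sin_geN1 sin_le1.
have A1 : `|(expR x - 1 - x) * cos y| <= e1 * `|x|.
  by rewrite normrM -[leRHS]mulr1 ler_pM.
have A2 : `|(1 + x) * (cos y - 1)| <= 2 * (e1 * `|y|).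
  rewrite normrM ler_pM// (le_trans (ler_normD _ _))// normr1.
  have := le_lt_trans nx we; lra.
have A3 : `|(expR x - 1 - x) * sin y| <= e1 * `|x|.
  by rewrite normrM -[leRHS]mulr1 ler_pM.
have A4 : `|x * sin y| <= e1 * (2 * `|y|).
  rewrite normrM ler_pM//; first exact: le_trans nx (ltW we).
  have -> : sin y = y + (sin y - y) by ring.
  rewrite (le_trans (ler_normD _ _))//.
  have : e1 * `|y| <= 1 * `|y| by rewrite ler_wpM2r.
  lra.
have B1 : e1 * `|x| <= e1 * cm w by rewrite ler_wpM2l// ltW.
have B2 : e1 * `|y| <= e1 * cm w by rewrite ler_wpM2l// ltW.
have B3 : e1 * cm w <= e / 8 * cm w by rewrite ler_wpM2r// cm_ge0.
have := ler_normD ((expR x - 1 - x) * cos y) ((1 + x) * (cos y - 1)).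
have := ler_normD ((expR x - 1 - x) * sin y + x * sin y) (sin y - y).
have := ler_normD ((expR x - 1 - x) * sin y) (x * sin y).
have : e / 8 * cm w = (e * cm w) / 8 by ring.
have := mulr_ge0 (ltW e0) (cm_ge0 w).
lra.
Qed.

Lemma cexp_dif z : dif (@cexp R) z (cexp z).
Proof.
have d1 : dif (fun w => w - z) z 1.
  by apply: dif_eq (difB (dif_id z) (dif_cst z z)) _; rewrite subr0.
have d0 : dif (@cexp R) (z - z) 1 by rewrite subrr; exact: cexp_dif0.
have := dif_scale (cexp z) (dif_comp d1 d0); rewrite !mulr1.
by apply: dif_ext => w; rewrite -cexpD addrC subrK.
Qed.

Definition tau : C := 0 +i* (2 * pi).

Lemma cexp_tau w : cexp (w + tau) = cexp w.
Proof.
by rewrite /cexp ReD ImD /= addr0 mulr2n mulrDl !mul1r -mulr2n cosD2pi sinD2pi.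
Qed.

Lemma cm_tau : cm tau = 2 * pi.
Proof.
by apply/eqP; rewrite -(@eqrXn2 _ 2) ?cm_ge0 ?mulr_ge0 ?pi_ge0// cm_sqr /= expr0n add0r.
Qed.

Lemma tau_neq0 : tau != 0.
Proof. by rewrite -cm_gt0 cm_tau mulr_gt0// pi_gt0. Qed.

End Exponential.

Section Means.
Context {R : realType}.
Local Notation C := R[i].
Implicit Types (z w p L : C) (r e : R) (G : C -> C).

Definition unity n (j : nat) : C := cexp (j%:R / 2 ^+ n * tau).

Lemma cm_unity n j : cm (unity n j) = 1.
Proof.
rewrite cm_cexp.
have -> : (j%:R / 2 ^+ n : C) = (j%:R / 2 ^+ n)%:C.
  by rewrite rmorphM fmorphV rmorphXn !rmorph_nat.
by rewrite ReRM /= mulr0 expR0.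
Qed.

Definition mean n G p r : C := \sum_(j < (2 ^ n)%N) G (p + r%:C * unity n j) / 2 ^+ n.

Lemma sum_mean n (x : C) : \sum_(j < (2 ^ n)%N) x / 2 ^+ n = x.
Proof.
by rewrite sumr_const card_ord -[LHS]mulr_natl natrX mulrC divfK// expf_neq0 ?two_neq0.
Qed.

Lemma mean_sub n G p r L : mean n G p r - L = mean n (fun z => G z - L) p r.
Proof.
rewrite -[X in _ - X](sum_mean n) -sumrB; apply: eq_bigr => j _; by rewrite mulrBl.
Qed.

Lemma cm_two n : cm (2 ^+ n : C) = 2 ^+ n.
Proof. by rewrite cmX -[2 in LHS](rmorph_nat (real_complex R)) cmR normr_nat. Qed.

Lemma mean_le n G p r e : (forall w, cm w = 1 -> cm (G (p + r%:C * w)) <= e) ->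
  cm (mean n G p r) <= e.
Proof.
move=> H; apply: le_trans (cm_sum _ _ _) _.
have -> : e = \sum_(j < (2 ^ n)%N) (e / 2 ^+ n).
  by rewrite sumr_const card_ord -[RHS]mulr_natl natrX [RHS]mulrC divfK// expf_neq0.
apply: ler_sum => j _; rewrite cmM cmV cm_two ler_wpM2r ?invr_ge0 ?exprn_ge0//.
exact/H/cm_unity.
Qed.

Lemma mean_Re_le n G p r e :
  (forall w, cm w = 1 -> complex.Re (G (p + r%:C * w)) <= e) ->
  complex.Re (mean n G p r) <= e.
Proof.
move=> H.
have -> : e = \sum_(j < (2 ^ n)%N) (e / 2 ^+ n).
  by rewrite sumr_const card_ord -[RHS]mulr_natl natrX [RHS]mulrC divfK// expf_neq0.
have -> : complex.Re (mean n G p r) =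
    \sum_(j < (2 ^ n)%N) complex.Re (G (p + r%:C * unity n j) / 2 ^+ n).
  by rewrite /mean; elim/big_rec2: _ => [//|j x z _ <-]; rewrite ReD.
apply: ler_sum => j _.
have -> : (2 ^+ n)^-1 = ((2 ^+ n)^-1)%:C :> C.
  by rewrite fmorphV rmorphXn rmorph_nat.
rewrite mulrC ReRM mulrC ler_wpM2r ?invr_ge0 ?exprn_ge0//.
exact/H/cm_unity.
Qed.

(* Pulling [G] back by [w |-> p + e^w] turns the two circles into opposite sides
   of a rectangle whose other two sides cancel by periodicity. *)
Lemma mean_limit G p L r0 :
  (forall z, z != p -> cm (z - p) < r0 -> exists l, dif G z l) ->
  (forall e, 0 < e -> exists2 d : R, 0 < d &
    forall z, z != p -> cm (z - p) < d -> cm (G z - L) <= e) ->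
  forall r, 0 < r < r0 -> tends UU (fun n => mean n G p r) L.
Proof.
move=> dG hL r /andP[rp rr0] e e_gt0.
have e2 : 0 < e / 2 by rewrite divr_gt0.
have [d d0 hd] := hL _ e2.
pose q := Num.min (d / 2) r.
have q0 : 0 < q by rewrite lt_min divr_gt0.
have qr : q <= r by rewrite ge_min lexx orbT.
have qd : q < d by rewrite gt_min; apply/orP; left; lra.
pose g w := G (p + cexp w).
have lnqr : ln q <= ln r by rewrite ler_ln.
have dg z : pgram (ln q)%:C (ln r - ln q)%:C tau z -> exists l, dif g z l.
  move=> [s [t [/andP[s0 s1] _ zE]]].
  have [||l dl] := dG (p + cexp z).
  - by rewrite -subr_eq0 addrAC subrr add0r cexp_neq0.
  - rewrite addrAC subrr add0r cm_cexp; apply: le_lt_trans rr0.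
    rewrite -[leRHS](lnK rp) ler_expR zE !ReD !ReRM /= mulr0 addr0.
    have : s * (ln r - ln q) <= 1 * (ln r - ln q) by rewrite ler_wpM2r ?subr_ge0.
    lra.
  - exists (l * (0 + cexp z)).
    exact: (dif_comp (difD (dif_cst p z) (cexp_dif z)) dl).
have et0 : 0 < e / 2 * cm (tau : C) by rewrite mulr_gt0// cm_gt0 tau_neq0.
have [N hN] := goursat dg et0.
apply: (@UU_ev _ N) => n nN /=.
have segE x : 0 < x -> seg n g (ln x)%:C tau = mean n G p x * tau.
  move=> x0; rewrite /seg /mean mulr_suml; apply: eq_bigr => j _.
  rewrite /g cexpD {1}/cexp /= cos0 sin0 mulr1 lnK ?posrE//.
  by rewrite mulrA mulrAC.
have := hN n nN; rewrite /bdry.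
have -> : seg n g ((ln q)%:C + tau) (ln r - ln q)%:C = seg n g (ln q)%:C (ln r - ln q)%:C.
  apply: eq_bigr => j _; congr (_ * _); rewrite /g.
  by rewrite addrAC cexp_tau.
rewrite rmorphB /= [(ln q)%:C + _]addrC subrK !segE//.
rewrite [X in cm X](_ : _ = (mean n G p r - mean n G p q) * tau); last by ring.
rewrite cmM ler_pM2r ?cm_gt0 ?tau_neq0// => H.
apply: le_trans (cm_dist _ (mean n G p q) _) _.
have : cm (mean n G p q - L) <= e / 2; last by lra.
rewrite mean_sub; apply: mean_le => w w1.
have cw : cm (q%:C * w) = q by rewrite cmM w1 mulr1 cmR gtr0_norm.
apply: hd; last by rewrite addrAC subrr add0r cw.
by rewrite -subr_eq0 addrAC subrr add0r -cm_eq0 cw gt_eqF.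
Qed.

Lemma cont_punct f z : cont f z -> forall e : R, 0 < e -> exists2 d : R, 0 < d &
    forall w, w != z -> cm (w - z) < d -> cm (f w - f z) <= e.
Proof.
by move=> cf e e0; have [d d0 hd] := cf e e0; exists d => // w _; exact: hd.
Qed.

Lemma mean_value f p r0 : (forall z, cm (z - p) < r0 -> exists l, dif f z l) ->
  forall r, 0 < r < r0 -> tends UU (fun n => mean n f p r) (f p).
Proof.
move=> df r rr0.
have [|l dl] := df p.
  rewrite subrr cm0; by case/andP: rr0; exact: lt_trans.
apply: mean_limit rr0 => [z _|]; first exact: df.
exact/cont_punct/(dif_cont dl).
Qed.

(** Cauchy's formula for the derivative. The difference quotient is holomorphic off [p] and tends to
    [l] there, which is all that [mean_limit] asks for; nothing is known yet about its
    differentiability at [p]. *)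
Lemma mean_derive f p r0 l : (forall z, cm (z - p) < r0 -> exists l, dif f z l) ->
  dif f p l ->
  forall r, 0 < r < r0 -> tends UU (fun n => mean n (fun z => (f z - f p) / (z - p)) p r) l.
Proof.
move=> df dl r rr0; apply: mean_limit rr0 => [z zp zr|].
  have [m dm] := df z zr; have zp0 : z - p != 0 by rewrite subr_eq0.
  eexists; apply: difM; first exact: (difB dm (dif_cst (f p) z)).
  exact: (difV (difB (dif_id z) (dif_cst p z)) zp0).
move: dl => /difP h e e0; have [d d0 hd] := h e e0; exists d => // w wz wd.
have wz0 : w - p != 0 by rewrite subr_eq0.
have -> : (f w - f p) / (w - p) - l = (f w - f p - l * (w - p)) / (w - p) by field.
by rewrite cmM cmV ler_pdivrMr ?cm_gt0// hd.
Qed.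

End Means.

(** * Derivatives of holomorphic functions *)

Section Derivatives.
Context {R : realType}.
Local Notation C := R[i].
Implicit Types (z w p c l h : C) (r : R) (f g : C -> C).

Definition holo c r f := forall z, cm (z - c) < r -> exists l, dif f z l.

Definition der f z : C := xget 0 [set l | dif f z l].

Lemma der_dif f z l : dif f z l -> dif f z (der f z).
Proof. by move=> dl; rewrite /der; case: xgetP => // /(_ l). Qed.

Lemma der_eq f z l : dif f z l -> der f z = l.
Proof. by move=> dl; apply: dif_unique (der_dif dl) dl. Qed.

Lemma holo_dif c r f z : holo c r f -> cm (z - c) < r -> dif f z (der f z).
Proof. by move=> hf /hf[l /der_dif]. Qed.

Lemma Re_is_derive f a h (t : R) l : dif f (a + t%:C * h) l ->
  is_derive t (1 : R) (fun s : R => complex.Re (f (a + s%:C * h))) (complex.Re (l * h)).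
Proof.
move=> /difP df.
suff H : (fun k : R => k^-1 *: (complex.Re (f (a + (k *: (1 : R) + t)%:C * h)) -
     complex.Re (f (a + t%:C * h)))) @ 0^' --> complex.Re (l * h).
  by split; [apply: cvgP H|apply: cvg_lim H].
apply/cvgrPdist_le => e e0.
have h1 : 0 < cm h + 1 by rewrite ltr_wpDl ?cm_ge0.
have eh : 0 < e / (cm h + 1) by rewrite divr_gt0.
have [d d0 hd] := df _ eh.
rewrite /dnbhs; apply/nbhs_ballP; exists (d / (cm h + 1)); first by rewrite /= divr_gt0.
move=> k; rewrite /ball /= sub0r normrN => kd k0.
rewrite /GRing.scale /= mulr1.
set z := a + t%:C * h in df hd *.
have -> : a + (k + t)%:C * h = z + k%:C * h by rewrite /z rmorphD /=; ring.
have ckh : cm (k%:C * h) = `|k| * cm h by rewrite cmM cmR.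
have kd' : `|k| * cm h < d.
  apply: (@le_lt_trans _ _ (`|k| * (cm h + 1))); first by rewrite ler_wpM2l// lerDl.
  by rewrite -ltr_pdivlMr.
have := hd (z + k%:C * h); rewrite addrAC subrr add0r ckh => /(_ kd') H.
have -> : complex.Re (l * h) - k^-1 * (complex.Re (f (z + k%:C * h)) - complex.Re (f z)) =
   - k^-1 * complex.Re (f (z + k%:C * h) - f z - l * (k%:C * h)).
  rewrite !ReD !ReN mulrCA ReRM; field; exact: k0.
rewrite normrM normrN normfV ler_pdivrMl ?normr_gt0//.
apply: le_trans (cm_Re _) _; apply: le_trans H _.
rewrite mulrCA ler_wpM2l// mulrAC ler_pdivrMr// ler_wpM2l ?(ltW e0)//.
by rewrite lerDl.
Qed.

(** A unimodular factor makes the increment of [f] real and non-negative; the real mean value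
    theorem then applies to the real part of the rotated function along the segment. *)
Lemma mean_value_le f a h (L : R) :
  (forall t : R, 0 <= t <= 1 -> exists l, dif f (a + t%:C * h) l /\ cm l <= L) ->
  cm (f (a + h) - f a) <= L * cm h.
Proof.
move=> df.
have [e [e1 ef]] := rotate (f (a + h) - f a).
pose phi (s : R) := complex.Re ((fun z => e * f z) (a + s%:C * h)).
pose dphi (s : R) := complex.Re (e * der f (a + s%:C * h) * h).
have dd (t : R) : 0 <= t <= 1 -> is_derive t (1 : R) phi (dphi t).
  move=> /df[l [dl _]]; apply: Re_is_derive; apply: dif_scale; exact: der_dif dl.
have [||c] := @MVT_segment R phi dphi 0 1 ler01.
- by move=> t; rewrite in_itv /= => /andP[t0 t1]; apply: dd; rewrite !ltW.
- apply: derivable_within_continuous => t; rewrite in_itv /= => t01.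
  by have [] := dd t t01.
rewrite in_itv /= subr0 mulr1 => c01.
rewrite /phi /= rmorph1 rmorph0 mul1r mul0r addr0 -ReN -ReD -mulrBr ef /= => ->.
have [l [dl lL]] := df c c01.
rewrite /dphi (der_eq dl); apply: le_trans (Re_le_cm _) _.
by rewrite !cmM e1 mul1r ler_wpM2r// cm_ge0.
Qed.

Lemma meanB n f g p r : mean n f p r - mean n g p r = mean n (fun z => f z - g z) p r.
Proof. by rewrite -sumrB; apply: eq_bigr => j _; rewrite mulrBl. Qed.

Lemma meanZ n f p r (k : C) : mean n f p r * k = mean n (fun z => f z * k) p r.
Proof. by rewrite mulr_suml; apply: eq_bigr => j _; rewrite mulrAC. Qed.

Lemma mean_derive0 f p r0 l : holo p r0 f -> dif f p l -> forall r, 0 < r < r0 ->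
  tends UU (fun n => mean n (fun z => (f (p + z) - f p) / z) 0 r) l.
Proof.
move=> hf dl r rr0; apply: (tends_eqf (mean_derive hf dl rr0)) => n.
by apply: eq_bigr => j _; rewrite add0r (addrAC p _ (- p)) subrr add0r.
Qed.

(** The factor 2 arises because the mean formula averages [f (p + z) - f p] rather than
    [f (p + z)]. *)
Lemma cauchy_estimate f p r0 (M r : R) l : holo p r0 f -> dif f p l ->
  (forall z, cm (z - p) < r0 -> cm (f z) <= M) -> 0 < r < r0 -> cm l <= 2 * M / r.
Proof.
move=> hf dl fM rr0; have /andP[rp rr] := rr0.
apply: tends_cm_le (mean_derive0 hf dl rr0) _; apply: filterE => n /=.
apply: mean_le => w w1; rewrite add0r cmM cmV cmM w1 mulr1 cmR gtr0_norm//.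
apply: ler_wpM2r; first by rewrite invr_ge0 ltW.
apply: le_trans (cmB _ _) _.
have h1 : cm (f (p + r%:C * w)) <= M.
  by apply: fM; rewrite addrAC subrr add0r cmM w1 mulr1 cmR gtr0_norm.
have h2 : cm (f p) <= M by apply: fM; rewrite subrr cm0 (lt_trans rp).
lra.
Qed.

Section Quadratic.
Context (f : C -> C) (p : C) (r M : R).
Context (r0 : 0 < r) (hf : holo p (4 * r) f)
  (fM : forall z, cm (z - p) < 4 * r -> cm (f z) <= M).
Local Notation L := (4 * M / r).
Local Notation L2 := (4 * L / r).

Let sub w v (d e : R) : cm (w - p) < d -> cm v < e -> cm (w + v - p) < d + e.
Proof. by move=> h1 h2; rewrite addrAC (le_lt_trans (cmD _ _))// ltrD. Qed.

Let holo_near w : cm (w - p) < 3 * r -> holo w r f.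
Proof.
have rr0 := r0.
move=> wr z zw; apply: hf; have := cm_dist z w p; lra.
Qed.

Lemma der_bound w : cm (w - p) < 3 * r -> cm (der f w) <= 4 * M / r.
Proof.
have rr0 := r0.
move=> wr.
have -> : 4 * M / r = 2 * M / (r / 2) by field; rewrite gt_eqF.
apply: (@cauchy_estimate f w r M (r / 2)).
- exact: holo_near.
- by apply: holo_dif hf _; lra.
- by move=> z zw; apply: fM; have := cm_dist z w p; lra.
- by apply/andP; split; lra.
Qed.

Let seg_in w v d (t : R) : 0 <= t <= 1 -> cm (w - p) < d -> cm (v - p) < d ->
  cm (w + t%:C * (v - w) - p) < d.
Proof.
have rr0 := r0.
move=> /andP[t0 t1] wd vd.
have -> : w + t%:C * (v - w) - p = (1 - t)%:C * (w - p) + t%:C * (v - p).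
  by rewrite rmorphB rmorph1 /=; ring.
apply: le_lt_trans (cmD _ _) _; rewrite !cmM !cmR ger0_norm ?subr_ge0// ger0_norm//.
have [->|tn0] := eqVneq t 0; first by rewrite mul0r addr0 subr0 mul1r.
have tp : 0 < t by rewrite lt_def tn0.
have h1 : (1 - t) * cm (w - p) <= (1 - t) * d by rewrite ler_wpM2l ?subr_ge0// ltW.
have h2 : t * cm (v - p) < t * d by rewrite ltr_pM2l.
lra.
Qed.

Let lip w v : cm (w - p) < 3 * r -> cm (v - p) < 3 * r -> cm (f v - f w) <= L * cm (v - w).
Proof.
have rr0 := r0.
move=> wr vr; rewrite -{1}(subrK w v) [v - w + w]addrC; apply: mean_value_le => t t01.
have h := seg_in t01 wr vr.
exists (der f (w + t%:C * (v - w))); split; last exact: der_bound.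
by apply: holo_dif hf _; lra.
Qed.

Let r2 : 0 < r / 2. Proof. by rewrite divr_gt0. Qed.
Let r2r : 0 < r / 2 < r. Proof. have rr0 := r0; apply/andP; split; lra. Qed.

Let tends_der w : cm (w - p) < 3 * r ->
  tends UU (fun n => mean n (fun z => (f (w + z) - f w) / z) 0 (r / 2)) (der f w).
Proof.
have rr0 := r0.
move=> wr; apply: mean_derive0 r2r; first exact: holo_near.
by apply: holo_dif hf _; lra.
Qed.

(** Both derivatives are limits of means over the same circle. The integrands differ by
    [(f (v + y) - f (w + y)) - (f v - f w)] divided by [y], and each bracket is controlled by the
    Lipschitz constant of [f]. *)
Lemma der_lip w v : cm (w - p) < 2 * r -> cm (v - p) < 2 * r ->
  cm (der f v - der f w) <= L2 * cm (v - w).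
Proof.
have rr0 := r0.
move=> wr vr.
have w3 : cm (w - p) < 3 * r by have := r0; lra.
have v3 : cm (v - p) < 3 * r by have := r0; lra.
apply: tends_cm_le (tendsB (tends_der v3) (tends_der w3)) _.
apply: filterE => n /=; rewrite meanB; apply: mean_le => x x1; rewrite add0r.
set y := _ * x; have cy : cm y = r / 2 by rewrite cmM x1 mulr1 cmR gtr0_norm.
rewrite -mulrBl cmM cmV cy ler_pdivrMr//.
have -> : L2 * cm (v - w) * (r / 2) = 2 * (L * cm (v - w)).
  by field; rewrite gt_eqF.
have -> : f (v + y) - f v - (f (w + y) - f w) = (f (v + y) - f (w + y)) - (f v - f w) by ring.
apply: le_trans (cmB _ _) _.
have yr : cm y < r by rewrite cy; have := r0; lra.
have := lip w3 v3.
have := @lip (w + y) (v + y).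
have -> : v + y - (w + y) = v - w by ring.
move=> H1 H2.
have wy : cm (w + y - p) < 3 * r by have hh := @sub _ _ _ _ wr yr; lra.
have vy : cm (v + y - p) < 3 * r by have hh := @sub _ _ _ _ vr yr; lra.
have := H1 wy vy.
lra.
Qed.

Lemma taylor1 w v : cm (w - p) < 2 * r -> cm (v - p) < 2 * r ->
  cm (f v - f w - der f w * (v - w)) <= 16 * M / r ^+ 2 * cm (v - w) ^+ 2.
Proof.
have rr0 := r0.
move=> wr vr.
have -> : 16 * M / r ^+ 2 = L2 by field; rewrite gt_eqF.
have -> : f v - f w - der f w * (v - w) =
  (fun z => f z - der f w * z) (w + (v - w)) - (fun z => f z - der f w * z) w.
  have E : w + (v - w) = v by ring.
  by rewrite /= E; ring.
rewrite expr2 mulrA.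
apply: (@mean_value_le (fun z => f z - der f w * z) w (v - w)) => t t01.
have h := seg_in t01 wr vr;
exists (der f (w + t%:C * (v - w)) - der f w * 1); split.
  apply: difB; last exact: dif_scale (dif_id _).
  by apply: holo_dif hf _; lra.
rewrite mulr1; apply: le_trans (der_lip wr h) _.
rewrite addrAC subrr add0r cmM cmR.
have L20 : 0 <= L2 * cm (v - w) by apply: le_trans (cm_ge0 _) (der_lip wr vr).
rewrite mulrCA ler_piMl// ger0_norm; by case/andP: t01.
Qed.

(** The candidate [D] is a limit of means of difference quotients of [der f], bounded by [der_lip].
    Writing [der f] itself as a limit of means turns the remainder into the difference of two
    first-order Taylor remainders of [f], at [p + y] and at [p], each quadratic in [z - p]. *)
Lemma der_derivable : exists D, dif (der f) p D.
Proof.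
have rr0 := r0.
have pp d : 0 < d -> cm (p - p) < d by rewrite subrr cm0.
have p2 : cm (p - p) < 2 * r by apply: pp; lra.
have p1 : cm (p - p) < r by apply: pp.
pose s := r / 2.
pose Dn n := mean n (fun z => (der f (p + z) - der f p) / z) 0 s.
have L20 : 0 <= L2.
  have pr : cm (p + s%:C - p) < 2 * r.
    by rewrite addrAC subrr add0r cmR gtr0_norm ?r2// /s; lra.
  have := le_trans (cm_ge0 _) (@der_lip p (p + s%:C) p2 pr).
  by rewrite addrAC subrr add0r pmulr_lge0// cmR gtr0_norm ?r2.
have [|D hD] := @ulim_exists _ Dn L2.
  apply: filterE => n; apply: mean_le => x x1; rewrite add0r.
  set y := _ * x; have cy : cm y = r / 2 by rewrite cmM x1 mulr1 cmR gtr0_norm ?r2.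
  rewrite cmM cmV cy ler_pdivrMr ?r2//.
  have py : cm (p + y - p) < 2 * r by rewrite addrAC subrr add0r cy; lra.
  by have := der_lip p2 py; rewrite (addrAC p y) subrr add0r cy.
exists D; apply/difP => e e0.
have key z : cm (z - p) < r ->
    cm (der f z - der f p - D * (z - p)) <= 4 * L2 / r * cm (z - p) ^+ 2.
  move=> zr; pose h := z - p.
  have z3 : cm (z - p) < 3 * r by lra.
  have p3 : cm (p - p) < 3 * r by apply: pp; lra.
  apply: tends_cm_le (tendsB (tendsB (tends_der z3) (tends_der p3)) (tendsM hD (tends_cst h))) _.
  apply: filterE => n /=; rewrite meanZ !meanB; apply: mean_le => x x1; rewrite add0r.
  set y := _ * x; have cy : cm y = r / 2 by rewrite cmM x1 mulr1 cmR gtr0_norm ?r2.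
  have y0 : y != 0 by rewrite -cm_gt0 cy r2.
  have -> : (f (z + y) - f z) / y - (f (p + y) - f p) / y - (der f (p + y) - der f p) / y * h =
     ((f (z + y) - f (p + y) - der f (p + y) * (z + y - (p + y))) - (f z - f p - der f p * (z - p))) / y.
    by rewrite /h; field.
  rewrite cmM cmV cy ler_pdivrMr ?r2//.
  have zy : z + y - (p + y) = z - p by ring.
  have T1 := @taylor1 (p + y) (z + y).
  have T2 := @taylor1 p z.
  have e16 : 16 * M / r ^+ 2 = L2 by field; rewrite gt_eqF.
  rewrite e16 in T1 T2; rewrite {2}zy in T1.
  have z2 : cm (z - p) < 2 * r by lra.
  have {}T2 := T2 p2 z2.
  have yr : cm y < r by lra.
  have py : cm (p + y - p) < 2 * r by have hh := @sub _ _ _ _ p1 yr; lra.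
  have zy' : cm (z + y - p) < 2 * r by have hh := @sub _ _ _ _ zr yr; lra.
  have {}T1 := T1 py zy'.
  have -> : 4 * L2 / r * cm (z - p) ^+ 2 * (r / 2) = 2 * (L2 * cm (z - p) ^+ 2).
    by field; rewrite gt_eqF.
  apply: le_trans (cmB _ _) _; lra.
pose K := 4 * L2 / r + 1.
have K1 : 0 <= 4 * L2 / r by apply: divr_ge0; [exact: mulr_ge0|exact: ltW].
have K0 : 0 < K by rewrite /K ltr_wpDl.
exists (Num.min r (e / K)); first by rewrite lt_min r0 divr_gt0.
move=> z; rewrite lt_min => /andP[zr ze]; apply: le_trans (key z zr) _.
rewrite expr2 mulrA ler_wpM2r ?cm_ge0//.
have : cm (z - p) * K <= e by rewrite -ler_pdivlMr// ltW.
by rewrite /K; have := cm_ge0 (z - p); nra.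
Qed.

End Quadratic.

Lemma dif_bounded f p l : dif f p l -> exists2 d : R, 0 < d &
  forall z, cm (z - p) < d -> cm (f z) <= cm (f p) + 1.
Proof. by move=> /dif_cont/tends_bounded[d d0 hd]; exists d. Qed.

Lemma holo_der c r f : holo c r f -> holo c r (der f).
Proof.
move=> hf p pr; have dp := holo_dif hf pr.
have [d d0 hd] := dif_bounded dp.
pose e := Num.min d (r - cm (p - c)) / 4.
have e0 : 0 < e by rewrite divr_gt0// lt_min d0 subr_gt0.
have ed : 4 * e <= d by rewrite /e mulrC divfK// ge_min lexx.
have er : 4 * e <= r - cm (p - c) by rewrite /e mulrC divfK// ge_min lexx orbT.
apply: (@der_derivable f p e (cm (f p) + 1)) => //.
- by move=> z zp; apply: hf; have := cm_dist z p c; lra.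
- by move=> z zp; apply: hd; lra.
Qed.

Lemma holo_sub c r f c' r' : holo c r f -> r' + cm (c' - c) <= r -> holo c' r' f.
Proof. by move=> hf h z zr; apply: hf; have := cm_dist z c' c; lra. Qed.

End Derivatives.

(** * Holomorphic functions on discs *)

Section DiscTheory.
Context {R : realType}.
Local Notation C := R[i].
Implicit Types (z w p c l h : C) (r e : R) (f g F : C -> C).

Lemma cm_sqrD z w : cm (z + w) ^+ 2 = cm z ^+ 2 + cm w ^+ 2 + 2 * complex.Re (z^* * w).
Proof. by case: z w => a b [x y]; rewrite !cm_sqr /=; ring. Qed.

Lemma le_limit_left (x y a b : R) : a < b ->
  (forall t, a < t < b -> x * t <= y) -> x * b <= y.
Proof.
move=> ab H; apply/ler_addgt0Pl => e e0.
pose X := `|x| + 1; have X0 : 0 < X by rewrite ltr_wpDl.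
pose d := Num.min ((b - a) / 2) (e / X).
have d0 : 0 < d by rewrite lt_min !divr_gt0 ?subr_gt0.
have dab : d <= (b - a) / 2 by rewrite ge_min lexx.
have dX : d * X <= e by rewrite -ler_pdivlMr// ge_min lexx orbT.
have hb : a < b - d < b by apply/andP; split; lra.
have := H (b - d) hb.
have : x * d <= X * d by rewrite ler_wpM2r ?(ltW d0)// (le_trans (ler_norm x))// lerDl.
rewrite mulrBr; lra.
Qed.

Lemma Re_mean_value f c r r0 (M : R) : holo c r0 f -> 0 < r < r0 ->
  (forall w, cm w = 1 -> complex.Re (f (c + r%:C * w)) <= M) -> complex.Re (f c) <= M.
Proof.
move=> hf rr H; apply: tends_Re_le (mean_value hf rr) _.
by apply: filterE => n; apply: mean_Re_le.
Qed.

Lemma closed_ball_closed c r (u : nat -> C) l :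
  (forall n, cm (u n - c) <= r) -> tends UU u l -> cm (l - c) <= r.
Proof.
move=> ur ul; apply: tends_cm_le (tendsB ul (tends_cst c)) _.
by apply: filterE => n /=.
Qed.

Lemma ball_argmax c r (phi : C -> R) : 0 <= r ->
  (forall u l, cm (l - c) <= r -> tends UU u l ->
     tends UU (fun n => (phi (u n))%:C) (phi l)%:C) ->
  exists z, cm (z - c) <= r /\ forall w, cm (w - c) <= r -> phi w <= phi z.
Proof.
move=> r0 pc; apply: (@argmax _ (fun z => cm (z - c) <= r) phi (cm c + r)).
- by exists c; rewrite subrr cm0.
- by move=> z zr; rewrite (le_trans (cm_le_dist z c))// lerD2l.
- exact: closed_ball_closed.
- by move=> u l _ ul lr; apply: pc.
Qed.

(* Perturbing [|f|] by [eps |z - c|^2] makes it strictly subharmonic. *)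
Lemma max_modulus f c r r0 (M : R) : holo c r0 f -> 0 < r < r0 ->
  (forall z, cm (z - c) = r -> cm (f z) <= M) ->
  forall z, cm (z - c) <= r -> cm (f z) <= M.
Proof.
move=> hf /andP[rp rr] fM.
suff H e : 0 < e -> forall z, cm (z - c) <= r -> cm (f z) <= M + e * r ^+ 2.
  move=> z zr; apply/ler_addgt0Pr => e e0.
  have r20 : 0 < r ^+ 2 by rewrite exprn_gt0.
  have := H (e / r ^+ 2) (divr_gt0 e0 r20) z zr.
  by rewrite divfK // gt_eqF.
move=> e0.
pose phi z := cm (f z) + e * cm (z - c) ^+ 2.
have [|u l lr ul|w [wr wmax]] := @ball_argmax c r phi; first exact: ltW.
  have cf : cont f l by apply: dif_cont (holo_dif hf _); apply: le_lt_trans lr rr.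
  have t1 := tends_cm (tends_comp ul cf).
  have t2 := tends_cm (tendsB ul (tends_cst c)).
  have := tendsD t1 (tendsM (tends_cst (e%:C)) (tendsM t2 t2)).
  move=> t3; have -> : (phi l)%:C = (cm (f l))%:C + e%:C * ((cm (l - c))%:C * (cm (l - c))%:C).
    by rewrite /phi rmorphD !rmorphM.
  by apply: (tends_eqf t3) => n; rewrite /phi rmorphD !rmorphM.
move=> z zr; suff wE : cm (w - c) = r.
  have := wmax z zr; rewrite /phi wE; have := fM w wE.
  by have := mulr_ge0 (ltW e0) (exprn_ge0 2 (cm_ge0 (z - c))); lra.
apply/eqP; rewrite eq_le wr /= leNgt; apply/negP => wlt.
pose s := r - cm (w - c).
have s0 : 0 < s by rewrite subr_gt0.
have [u [u1 uf]] := rotate (f w).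
(* The linear term accounts for the cross term in the expansion of [|w + x - c|^2]. By maximality
   the real part of [G] is at most [cm (f w) - e * s ^+ 2] on the circle, although it equals
   [cm (f w)] at the centre. *)
pose G z := u * f z + (2 * e)%:C * (w - c)^* * (z - w).
have hG : holo w (r0 - cm (w - c)) G.
  move=> v vr; have /hf[l dl] : cm (v - c) < r0 by have := cm_dist v w c; lra.
  by eexists; apply: difD (dif_scale u dl) (dif_scale _ (difB (dif_id v) (dif_cst w v))).
have ss : 0 < s < r0 - cm (w - c) by rewrite s0 /= /s; lra.
have := Re_mean_value (M := cm (f w) - e * s ^+ 2) hG ss.
rewrite /G subrr mulr0 addr0 uf /= => H.
suff : cm (f w) <= cm (f w) - e * s ^+ 2.
  by have := mulr_gt0 e0 (exprn_gt0 2 s0); lra.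
apply: H => v v1; set x := _ * v.
have cx : cm x = s by rewrite cmM v1 mulr1 cmR gtr0_norm.
have xr : cm (w + x - c) <= r.
  by rewrite addrAC (le_trans (cmD _ _))// cx /s; lra.
have E1 : cm (w + x - c) ^+ 2 = cm (w - c) ^+ 2 + s ^+ 2 + 2 * complex.Re ((w - c)^* * x).
  by rewrite (_ : w + x - c = w - c + x) ?cm_sqrD ?cx//; ring.
have := wmax _ xr; rewrite /phi E1.
have -> : w + x - w = x by ring.
rewrite ReD -mulrA ReRM.
have := Re_le_cm (u * f (w + x)); rewrite cmM u1 mul1r.
rewrite !mulrDr; lra.
Qed.

Lemma ball_bounded f c r r0 : holo c r0 f -> 0 <= r < r0 ->
  exists M : R, 0 < M /\ forall z, cm (z - c) <= r -> cm (f z) <= M.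
Proof.
move=> hf /andP[rp rr].
have [u l lr ul|w [_ wmax]] := @ball_argmax c r (fun z => cm (f z)) rp.
  have cf : cont f l by apply: dif_cont (holo_dif hf _); apply: le_lt_trans lr rr.
  exact: tends_cm (tends_comp ul cf).
exists (cm (f w) + 1); split; first by rewrite ltr_wpDl ?cm_ge0.
by move=> z /wmax h; rewrite (le_trans h)// lerDl.
Qed.

Lemma seg_in_ball c r w v (t : R) : 0 <= t <= 1 -> cm (w - c) <= r -> cm (v - c) <= r ->
  cm (w + t%:C * (v - w) - c) <= r.
Proof.
move=> /andP[t0 t1] wr vr.
have -> : w + t%:C * (v - w) - c = (1 - t)%:C * (w - c) + t%:C * (v - c).
  by rewrite rmorphB rmorph1 /=; ring.
apply: le_trans (cmD _ _) _; rewrite !cmM !cmR ger0_norm ?subr_ge0// ger0_norm//.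
have h1 : (1 - t) * cm (w - c) <= (1 - t) * r by rewrite ler_wpM2l ?subr_ge0.
have h2 : t * cm (v - c) <= t * r by rewrite ler_wpM2l.
lra.
Qed.

Lemma lip_ball f c r (L : R) w v :
  (forall z, cm (z - c) <= r -> exists l, dif f z l /\ cm l <= L) ->
  cm (w - c) <= r -> cm (v - c) <= r -> cm (f v - f w) <= L * cm (v - w).
Proof.
move=> H wr vr; have E : w + (v - w) = v by ring.
rewrite -{1}E; apply: mean_value_le => t t01.
exact/H/seg_in_ball.
Qed.

Lemma taylor_ball f c r r0 : holo c r0 f -> 0 <= r < r0 -> exists K : R, 0 < K /\
  forall w v, cm (w - c) <= r -> cm (v - c) <= r ->
  cm (f v - f w - der f w * (v - w)) <= K * cm (v - w) ^+ 2.
Proof.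
move=> hf rr; have h1 := holo_der hf; have h2 := holo_der h1.
have [K [K0 HK]] := ball_bounded h2 rr; exists K; split => // w v wr vr.
have /andP[rp rlt] := rr.
have E : w + (v - w) = v by ring.
pose g z := f z - der f w * z.
have -> : f v - f w - der f w * (v - w) = g (w + (v - w)) - g w by rewrite /g E; ring.
rewrite expr2 mulrA; apply: mean_value_le => t t01.
set y := w + _; have yr : cm (y - c) <= r by exact: seg_in_ball.
exists (der f y - der f w); split.
  apply: difB; first by apply: holo_dif hf _; exact: le_lt_trans yr rlt.
  by apply: dif_eq (dif_scale (der f w) (dif_id y)) _; rewrite mulr1.
apply: le_trans (@lip_ball (der f) c r K w y _ wr yr) _.
  move=> z zr; exists (der (der f) z); split; last exact: HK.
  by apply: holo_dif h1 _; exact: le_lt_trans zr rlt.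
rewrite /y addrAC subrr add0r cmM cmR mulrCA ler_piMl ?mulr_ge0 ?cm_ge0 ?(ltW K0)//.
by rewrite ger0_norm; case/andP: t01.
Qed.

(** At [p] the quotient has derivative [f''(p) / 2]: the mean value inequality is applied to [f]
    minus the linear and quadratic terms of its Taylor expansion, whose derivative is [o(z - p)]
    because [der f] is differentiable. *)
Lemma divide f c r p : holo c r f -> cm (p - c) < r -> exists g,
  [/\ holo c r g, forall z, f z = f p + (z - p) * g z & g p = der f p].
Proof.
move=> hf pr; have dp := holo_dif hf pr; have d2 := holo_dif (holo_der hf) pr.
pose g z := if z == p then der f p else (f z - f p) / (z - p).
have gE z : f z = f p + (z - p) * g z.
  rewrite /g; case: eqP => [->|/eqP zp]; first by rewrite subrr mul0r addr0.
  by rewrite mulrC divfK ?subr_eq0// addrC subrK.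
have gp : g p = der f p by rewrite /g eqxx.
exists g; split => // z zr.
have [->|zp] := eqVneq z p; last first.
  have zp0 : z - p != 0 by rewrite subr_eq0.
  have [l dl] := hf z zr.
  have h : dif (fun v => (f v - f p) / (v - p)) z
      ((l - 0) * (z - p)^-1 + (f z - f p) * (- (1 - 0) / (z - p) ^+ 2)).
    exact: (difM (difB dl (dif_cst (f p) z)) (difV (difB (dif_id z) (dif_cst p z)) zp0)).
  exists ((l - 0) * (z - p)^-1 + (f z - f p) * (- (1 - 0) / (z - p) ^+ 2)).
  apply: dif_local h; exists (cm (z - p)); first by rewrite cm_gt0.
  move=> v vz /=; rewrite /g; case: eqP => // vp.
  by move: vz; rewrite vp cm_sym ltxx.
pose D := der (der f) p.
exists (D / 2); apply/difP => e e0.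
move/difP: (d2) => /(_ e e0)[d d0 hd].
exists (Num.min d (r - cm (p - c))); first by rewrite lt_min d0 subr_gt0.
move=> z'; rewrite lt_min => /andP[zd zr'].
have [->|z'p] := eqVneq z' p; first by rewrite !subrr mulr0 subr0 cm0 mulr0.
have zp0 : z' - p != 0 by rewrite subr_eq0.
have cz : 0 < cm (z' - p) by rewrite cm_gt0.
rewrite -(ler_pM2r cz) -cmM.
pose G v := f v - der f p * v - D / 2 * ((v - p) * (v - p)).
have E : p + (z' - p) = z' by ring.
have -> : (g z' - g p - D / 2 * (z' - p)) * (z' - p) = G (p + (z' - p)) - G p.
  by rewrite E /G gp /g (negbTE z'p); field.
apply: mean_value_le => t t01.
set y := p + _.
have ypE : y - p = t%:C * (z' - p) by rewrite /y; ring.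
have yp : cm (y - p) <= cm (z' - p).
  by rewrite ypE cmM cmR ler_piMl ?cm_ge0// ger0_norm; case/andP: t01.
exists (der f y - der f p - D * (y - p)); split; last first.
  apply: le_trans (hd y (le_lt_trans yp zd)) _.
  by rewrite ler_wpM2l// ltW.
have dy : dif f y (der f y).
  by apply: holo_dif hf _; have := cm_dist y p c; lra.
have dsq := difB (dif_id y) (dif_cst p y).
apply: dif_eq (difB (difB dy (dif_scale (der f p) (dif_id y))) (dif_scale (D / 2) (difM dsq dsq))) _.
by field.
Qed.

(** Weierstrass's theorem for bounded families, under mere pointwise limits: the quadratic Taylor
    bound [taylor1] has a constant independent of [n], so it passes to the limit and yields both the
    derivative of [psi] and the convergence of derivatives. *)
Lemma ulim_holo (phi : nat -> C -> C) (psi : C -> C) c r (M : R) :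
  (forall n, holo c r (phi n)) ->
  UU [set n | forall z, cm (z - c) < r -> cm (phi n z) <= M] ->
  (forall z, cm (z - c) < r -> tends UU (fun n => phi n z) (psi z)) ->
  forall p, cm (p - c) < r -> exists D, dif psi p D /\ tends UU (fun n => der (phi n) p) D.
Proof.
move=> hphi bM lim p pr.
pose d := (r - cm (p - c)) / 4.
have d0 : 0 < d by rewrite divr_gt0// subr_gt0.
have d4 : 4 * d + cm (p - c) <= r by rewrite /d mulrC divfK// subrK.
have inr z : cm (z - p) < 4 * d -> cm (z - c) < r by move=> h; have := cm_dist z p c; lra.
have pp e : 0 < e -> cm (p - p) < e by rewrite subrr cm0.
have p2 : cm (p - p) < 2 * d by apply: pp; lra.
have hn n : holo p (4 * d) (phi n) by apply: holo_sub (hphi n) _; exact: d4.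
have [|D hD] := @ulim_exists _ (fun n => der (phi n) p) (4 * M / d).
  move: bM; apply: filterS => n bn; apply: (@der_bound _ (phi n) p d M) => //.
  - by move=> z /inr; exact: bn.
  - by apply: pp; lra.
exists D; split => //; apply/difP => e e0.
pose K := 16 * M / d ^+ 2.
have key z : cm (z - p) < 2 * d -> cm (psi z - psi p - D * (z - p)) <= K * cm (z - p) ^+ 2.
  move=> zd.
  have z4 : cm (z - c) < r by apply: inr; lra.
  apply: tends_cm_le (tendsB (tendsB (lim z z4) (lim p pr)) (tendsM hD (tends_cst (z - p)))) _.
  move: bM; apply: filterS => n bn; apply: taylor1 => //.
  by move=> v /inr; exact: bn.
exists (Num.min (2 * d) (e / (`|K| + 1))).
  by rewrite lt_min mulr_gt0//= divr_gt0// ltr_wpDl.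
move=> z; rewrite lt_min => /andP[zd ze]; apply: le_trans (key z zd) _.
rewrite expr2 mulrA ler_wpM2r ?cm_ge0//.
have : cm (z - p) * (`|K| + 1) <= e by rewrite -ler_pdivlMr ?ltr_wpDl// ltW.
have : K * cm (z - p) <= `|K| * cm (z - p) by rewrite ler_wpM2r ?cm_ge0// ler_norm.
have := cm_ge0 (z - p); lra.
Qed.

Lemma dif0_const f c r : (forall z, cm (z - c) < r -> dif f z 0) ->
  forall z, cm (z - c) < r -> f z = f c.
Proof.
move=> df z zr; apply/eqP; rewrite -subr_eq0 -cm_eq0 eq_le cm_ge0 andbT.
have := @lip_ball f c (cm (z - c)) 0 c z; rewrite mul0r; apply => //.
- by move=> v vz; exists 0; rewrite cm0 lexx; split => //; apply: df; exact: le_lt_trans vz zr.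
- by rewrite subrr cm0 cm_ge0.
Qed.

End DiscTheory.

(** * Entire functions, primitives and logarithms *)

Section Entire.
Context {R : realType}.
Local Notation C := R[i].
Implicit Types (z w p c l h : C) (r e : R) (f g F : C -> C).

Definition ent f := forall z, exists l, dif f z l.

Lemma ent_dif f z : ent f -> dif f z (der f z).
Proof. by move=> /(_ z)[l /der_dif]. Qed.

Lemma ent_holo f c r : ent f -> holo c r f.
Proof. by move=> hf z _; exact: hf. Qed.

Lemma ent_cont f z : ent f -> cont f z.
Proof. by move=> hf; apply: dif_cont (ent_dif z hf). Qed.

Lemma ent_der f : ent f -> ent (der f).
Proof.
move=> hf z; apply: (holo_der (ent_holo (c := z) (r := 1) hf)).
by rewrite subrr cm0.
Qed.

Lemma ent_cst a : ent (fun=> a). Proof. by move=> z; exists 0; exact: dif_cst. Qed.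
Lemma ent_id : ent (fun z => z). Proof. by move=> z; exists 1; exact: dif_id. Qed.

Lemma entD f g : ent f -> ent g -> ent (fun z => f z + g z).
Proof. by move=> hf hg z; eexists; apply: difD; exact: ent_dif. Qed.

Lemma entB f g : ent f -> ent g -> ent (fun z => f z - g z).
Proof. by move=> hf hg z; eexists; apply: difB; exact: ent_dif. Qed.

Lemma entM f g : ent f -> ent g -> ent (fun z => f z * g z).
Proof. by move=> hf hg z; eexists; apply: difM; exact: ent_dif. Qed.

Lemma ent_scale a f : ent f -> ent (fun z => a * f z).
Proof. by move=> hf z; eexists; apply: dif_scale; exact: ent_dif. Qed.

Lemma ent_subc f a : ent f -> ent (fun z => f z - a).
Proof. by move=> hf; apply: entB => //; exact: ent_cst. Qed.

Lemma entX f n : ent f -> ent (fun z => f z ^+ n).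
Proof.
move=> hf; elim: n => [|n IH]; first exact: ent_cst.
have := entM hf IH => h z; have [l dl] := h z; exists l.
by apply: dif_ext dl => w; rewrite exprS.
Qed.

Lemma ent_comp f g : ent f -> ent g -> ent (fun z => f (g z)).
Proof. by move=> hf hg z; eexists; apply: dif_comp (ent_dif z hg) (ent_dif (g z) hf). Qed.

Lemma ent_affine a b : ent (fun z => a * z + b).
Proof. by apply: entD; [apply: ent_scale; exact: ent_id|exact: ent_cst]. Qed.

Lemma dif_affine a b z : dif (fun z => a * z + b) z a.
Proof.
by apply: dif_eq (difD (dif_scale a (dif_id z)) (dif_cst b z)) _; rewrite mulr1 addr0.
Qed.

Lemma ent_ext f g : (forall z, f z = g z) -> ent f -> ent g.
Proof. by move=> fg hf z; have [l dl] := hf z; exists l; exact: dif_ext dl. Qed.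

Lemma der_ext f g z : (forall z, f z = g z) -> der f z = der g z.
Proof. by move=> /funext ->. Qed.

Lemma der_affine f a b z : ent f -> der (fun w => f (a * w + b)) z = der f (a * z + b) * a.
Proof.
move=> hf; apply: der_eq.
exact: (@dif_comp _ f (fun w => a * w + b) z _ _ (dif_affine a b z) (ent_dif _ hf)).
Qed.

Lemma der_subc f a z : ent f -> der (fun w => f w - a) z = der f z.
Proof.
move=> hf; apply: der_eq.
by apply: dif_eq (difB (ent_dif z hf) (dif_cst a z)) _; rewrite subr0.
Qed.

Lemma ent_dif0_const f : (forall z, dif f z 0) -> forall z w, f z = f w.
Proof.
move=> df z w; apply: (@dif0_const _ f w (cm (z - w) + 1)) => //.
by rewrite ltrDl.
Qed.

Lemma ent_divide f p : ent f -> exists g,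
  [/\ ent g, forall z, f z = f p + (z - p) * g z & g p = der f p].
Proof.
move=> hf; have pp : cm (p - p) < 1 by rewrite subrr cm0.
have [g [hg fg gp]] := divide (ent_holo hf) pp; exists g; split => // z.
have [->|zp] := eqVneq z p; first exact: hg.
have zp0 : z - p != 0 by rewrite subr_eq0.
have h : dif (fun v => (f v - f p) / (v - p)) z
    ((der f z - 0) * (z - p)^-1 + (f z - f p) * (- (1 - 0) / (z - p) ^+ 2)).
  exact: (difM (difB (ent_dif z hf) (dif_cst (f p) z))
    (difV (difB (dif_id z) (dif_cst p z)) zp0)).
eexists; apply: dif_local h; exists (cm (z - p)); first by rewrite cm_gt0.
move=> v vz /=; have vp : v - p != 0.
  by rewrite subr_eq0; apply: contraTneq vz => ->; rewrite cm_sym ltxx.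
by rewrite (fg v); field.
Qed.

Lemma ent_divide0 f p : ent f -> f p = 0 -> exists g,
  [/\ ent g, forall z, f z = (z - p) * g z & g p = der f p].
Proof.
move=> hf fp; have [g [hg fg gp]] := ent_divide p hf; exists g; split => // z.
by rewrite fg fp add0r.
Qed.

(** If no finite order existed, [(z - p) ^+ m] would divide [f] for every [m]. The maximum principle
    on a circle of twice the distance [|z - p|] then gives [cm (f z) <= 2^-1 ^+ m * M] for all [m],
    so [f z = 0]. This replaces power series. *)
Lemma zero_order f p : ent f -> ~ (forall z, f z = 0) -> exists m g,
  [/\ ent g, g p != 0 & forall z, f z = (z - p) ^+ m * g z].
Proof.
move=> hf nf; apply: contrapT => H; apply: nf.
have dv m : exists g, ent g /\ forall z, f z = (z - p) ^+ m * g z.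
  elim: m => [|m [g [hg fg]]]; first by exists f; split => // z; rewrite expr0 mul1r.
  have [gp|gp] := eqVneq (g p) 0; last by case: H; exists m, g.
  have [k [hk gk _]] := ent_divide0 hg gp; exists k; split => // z.
  by rewrite fg gk exprSr mulrA.
move=> z; have [->|zp] := eqVneq z p.
  by have [g [_ ->]] := dv 1%N; rewrite subrr expr1 mul0r.
pose d := cm (z - p); have d0 : 0 < d by rewrite cm_gt0 subr_eq0.
pose r := 2 * d; have r0 : 0 < r by rewrite mulr_gt0.
have rr : 0 <= r < r + 1 by rewrite ltW//= ltrDl.
have rr' : 0 < r < r + 1 by rewrite r0/= ltrDl.
have [M [M0 HM]] := ball_bounded (ent_holo (c := p) hf) rr.
apply/eqP; rewrite -cm_eq0 eq_le cm_ge0 andbT.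
have key m : cm (f z) <= 2^-1 ^+ m * M.
  have [g [hg fg]] := dv m.
  have := max_modulus (M := M / r ^+ m) (ent_holo (c := p) hg) rr' _ (z := z).
  move=> /(_ _ _) H1; have {H1} : cm (g z) <= M / r ^+ m.
    apply: H1; last by rewrite /r -/d; lra.
    move=> v vr; have := HM v; rewrite vr lexx => /(_ isT).
    by rewrite fg cmM cmX vr ler_pdivlMr ?exprn_gt0// mulrC.
  move=> gz; rewrite fg cmM cmX -/d.
  apply: (@le_trans _ _ (d ^+ m * (M / r ^+ m))); first by rewrite ler_wpM2l ?exprn_ge0 ?cm_ge0.
  rewrite /r exprMn exprVn invfM.
  have -> : d ^+ m * (M * ((2 ^+ m)^-1 * (d ^+ m)^-1)) = (2 ^+ m)^-1 * M.
    by field; rewrite !expf_neq0// gt_eqF.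
  by [].
rewrite leNgt; apply/negP => fz.
have := archi_boundP (ltW (divr_gt0 M0 fz)); set N := Num.bound _ => hN.
have N2 : N%:R < 2 ^+ N :> R by rewrite -natrX ltr_nat ltn_expl.
have := key N; rewrite leNgt exprVn mulrC ltr_pdivrMr ?exprn_gt0// mulrC.
by rewrite -ltr_pdivrMr// (lt_trans hN N2).
Qed.

Lemma isolated_zeros f p : ent f -> ~ (forall z, f z = 0) ->
  exists2 d : R, 0 < d & forall z, z != p -> cm (z - p) <= d -> f z != 0.
Proof.
move=> hf nf; have [m [g [hg gp fg]]] := zero_order p hf nf.
have [d d0 hd] := tends_away (ent_cont p hg) gp.
exists (d / 2); first by rewrite divr_gt0.
move=> z zp zd; rewrite fg mulf_neq0// ?expf_neq0// ?subr_eq0//.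
rewrite -cm_gt0; apply: lt_le_trans (hd z _); first by rewrite divr_gt0// cm_gt0.
by lra.
Qed.

Lemma ent_identity f p d : ent f -> 0 < d -> (forall z, cm (z - p) < d -> f z = 0) ->
  forall z, f z = 0.
Proof.
move=> hf d0 H; apply: contrapT => nf.
have [d' d'0 hd] := isolated_zeros p hf nf.
pose e := Num.min (d / 2) d'.
have e0 : 0 < e by rewrite lt_min divr_gt0.
have ed : e <= d / 2 by rewrite ge_min lexx.
have ed' : e <= d' by rewrite ge_min lexx orbT.
have cz : cm (p + e%:C - p) = e by rewrite addrAC subrr add0r cmR gtr0_norm.
have zp : p + e%:C != p.
  by rewrite -subr_eq0 -cm_eq0 cz gt_eqF.
have := hd _ zp; rewrite cz => /(_ ed').
by rewrite H ?eqxx// cz; lra.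
Qed.

Lemma ent_mul0 f g : ent f -> ent g -> (forall z, f z * g z = 0) ->
  ~ (forall z, f z = 0) -> forall z, g z = 0.
Proof.
move=> hf hg fg nf.
have [p fp] : exists p, f p != 0.
  by apply: contrapT => H; apply: nf => z; apply/eqP; apply: contrapT => /negP h; apply: H; exists z.
have [d d0 hd] := tends_away (ent_cont p hf) fp.
apply: (@ent_identity g p d) => // z zd.
have fz : f z != 0.
  by rewrite -cm_gt0; apply: lt_le_trans (hd z zd); rewrite divr_gt0// cm_gt0.
by have /eqP := fg z; rewrite mulf_eq0 (negbTE fz) => /eqP.
Qed.

Lemma ge0_le_div_nat (x K : R) : 0 <= x -> (forall r, 1 <= r -> x <= K / r) -> x = 0.
Proof.
move=> x0 H; apply/eqP; rewrite eq_le x0 andbT leNgt; apply/negP => xp.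
pose r := `|K| / x + 1.
have r1 : 1 <= r by rewrite lerDr divr_ge0.
have := H r r1; rewrite ler_pdivlMr ?(lt_le_trans ltr01)// /r mulrDr mulr1 mulrC divfK ?gt_eqF//.
by have := ler_norm K; lra.
Qed.

Lemma liouville f (M : R) : ent f -> (forall z, cm (f z) <= M) -> forall z w, f z = f w.
Proof.
move=> hf fM; apply: ent_dif0_const => z.
suff <- : der f z = 0 by exact: ent_dif.
apply/eqP; rewrite -cm_eq0; apply/eqP/(@ge0_le_div_nat _ (2 * M)); first exact: cm_ge0.
move=> r r1; have rr : 0 < r < r + 1 by rewrite ltrDl ltr01 andbT (lt_le_trans ltr01).
exact: (cauchy_estimate (ent_holo hf) (ent_dif z hf) (fun v _ => fM v) rr).
Qed.

Lemma dif_sum (I : Type) (s : seq I) (f : I -> C -> C) (l : I -> C) z :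
  (forall i, dif (f i) z (l i)) ->
  dif (fun w => \sum_(i <- s) f i w) z (\sum_(i <- s) l i).
Proof.
move=> df; elim: s => [|i s IH].
  by rewrite big_nil; apply: dif_ext (dif_cst 0 z) => w; rewrite big_nil.
by rewrite big_cons; apply: dif_ext (difD (df i) IH) => w; rewrite big_cons.
Qed.

Definition prim_sum c (q : C -> C) n z : C :=
  \sum_(j < (2 ^ n)%N) (z - c) * q (c + j%:R / 2 ^+ n * (z - c)) / 2 ^+ n.

Definition prim c q z : C := xget 0 [set l | tends UU (fun n => prim_sum c q n z) l].

Lemma riemann_sum (psi : C -> C) (r0 : R) : 1 < r0 -> holo 0 r0 psi ->
  tends UU (fun n => \sum_(j < (2 ^ n)%N) der psi (j%:R / 2 ^+ n) / 2 ^+ n) (psi 1 - psi 0).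
Proof.
move=> r1 hpsi.
have [K [K0 HK]] := taylor_ball (r := 1) hpsi ltac:(by rewrite ler01).
move=> e e0.
have [N hN] : exists N, K / 2 ^+ N <= e.
  have := archi_boundP (ltW (divr_gt0 K0 e0)); set N := Num.bound _ => hN; exists N.
  have N2 : N%:R < 2 ^+ N :> R by rewrite -natrX ltr_nat ltn_expl.
  rewrite ler_pdivrMr ?exprn_gt0// mulrC -ler_pdivrMr//.
  exact: ltW (lt_trans hN N2).
apply: (@UU_ev _ N) => n nN /=.
have t0 : (2 ^+ n : C) != 0 by rewrite expf_neq0// two_neq0.
pose t (j : nat) : C := j%:R / 2 ^+ n.
have tele : psi 1 - psi 0 = \sum_(j < (2 ^ n)%N) (psi (t j.+1) - psi (t j)).
  rewrite -(big_mkord xpredT (fun j => psi (t j.+1) - psi (t j))) telescope_sumr//.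
  by rewrite /t mul0r natrX divff.
rewrite tele -sumrB; apply: le_trans (cm_sum _ _ _) _.
have E : K / 2 ^+ n = \sum_(j < (2 ^ n)%N) (K / 2 ^+ n ^+ 2).
  rewrite sumr_const card_ord -[RHS]mulr_natl natrX expr2.
  by field; rewrite expf_neq0.
apply: (@le_trans _ _ (K / 2 ^+ n)); last first.
  apply: le_trans hN; rewrite ler_pM2l// lef_pV2 ?posrE ?exprn_gt0//.
  by rewrite ler_eXn2l// ltr1n.
rewrite E; apply: ler_sum => j _.
have cj (k : nat) : (k <= 2 ^ n)%N -> cm (t k - 0) <= 1.
  move=> kn; rewrite subr0 /t cmM cmV cm_two ler_pdivrMr ?exprn_gt0// mul1r.
  by rewrite -(rmorph_nat (real_complex R)) cmR normr_nat -natrX ler_nat.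
have := HK (t j) (t j.+1) (cj _ (ltnW (ltn_ord j))) (cj _ (ltn_ord j)).
have -> : t j.+1 - t j = (2 ^+ n)^-1 by rewrite /t -natr1; field.
rewrite cmV cm_two exprVn => H; rewrite -cmN opprB.
by rewrite -/(t j).
Qed.

(** The Riemann sums are holomorphic in [z], and their derivatives converge by [ulim_holo]. For
    fixed [z] these derivatives are Riemann sums of [psi'] with [psi t = t * q (c + t * (z - c))],
    so [riemann_sum] gives the limit [psi 1 - psi 0 = q z]. *)
Lemma prim_dif c r q z : holo c r q -> cm (z - c) < r -> dif (prim c q) z (q z).
Proof.
move=> hq zr0.
pose r1 := (cm (z - c) + r) / 2.
have r1r : r1 < r by rewrite /r1; lra.
have zr : cm (z - c) < r1 by rewrite /r1; lra.
have r1p : 0 < r1 by apply: le_lt_trans zr; exact: cm_ge0.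
have [M [M0 HM]] := ball_bounded (r := r1) hq ltac:(by rewrite ltW).
have scal (w : C) (t : R) : 0 <= t <= 1 -> cm (c + t%:C * (w - c) - c) <= cm (w - c).
  move=> /andP[t0 t1]; rewrite addrAC subrr add0r cmM cmR ger0_norm// ler_piMl//.
  exact: cm_ge0.
have bd n w : cm (w - c) < r1 -> cm (prim_sum c q n w) <= r1 * M.
  move=> wr; apply: le_trans (cm_sum _ _ _) _.
  have -> : r1 * M = \sum_(j < (2 ^ n)%N) (r1 * M / 2 ^+ n).
    by rewrite sumr_const card_ord -[RHS]mulr_natl natrX [RHS]mulrC divfK// expf_neq0.
  apply: ler_sum => j _; rewrite !cmM cmV cm_two ler_wpM2r ?invr_ge0 ?exprn_ge0//.
  rewrite ler_pM ?cm_ge0 ?(ltW wr)//.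
  have [t [t01 ->]] := @dyadic_itv R _ j.
  by apply: HM; rewrite (le_trans (scal _ _ t01))// ltW.
have lim w : cm (w - c) < r1 -> tends UU (fun n => prim_sum c q n w) (prim c q w).
  move=> wr; have [|l hl] := @ulim_exists _ (fun n => prim_sum c q n w) (r1 * M).
    by apply: filterE => n /=; exact: bd.
  by rewrite /prim; case: xgetP => // /(_ l).
pose dS n (w : C) : C := \sum_(j < (2 ^ n)%N)
  (q (c + j%:R / 2 ^+ n * (w - c)) + (w - c) * (der q (c + j%:R / 2 ^+ n * (w - c)) * (j%:R / 2 ^+ n))) / 2 ^+ n.
have dsum n w : cm (w - c) < r1 -> dif (prim_sum c q n) w (dS n w).
  move=> wr; rewrite /prim_sum /dS.
  apply: dif_sum => j.
  have dw := difB (dif_id w) (dif_cst c w).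
  have [t [t01 tE]] := @dyadic_itv R _ j.
  have dq : dif q (c + j%:R / 2 ^+ n * (w - c)) (der q (c + j%:R / 2 ^+ n * (w - c))).
    apply: holo_dif hq _; rewrite tE; apply: le_lt_trans (scal _ _ t01) _.
    exact: lt_trans wr r1r.
  have d2 := dif_comp (difD (dif_cst c w) (dif_scale (j%:R / 2 ^+ n) dw)) dq.
  apply: dif_eq (difM (difM dw d2) (dif_cst _ w)) _.
  by rewrite mulr0 addr0 subr0 mul1r mulr1 add0r.
have [||D [dD tD]] := @ulim_holo _ (prim_sum c q) (prim c q) c r1 (r1 * M) _ _ lim z zr.
- by move=> n w wr; exists (dS n w); exact: dsum.
- by apply: filterE => n w; exact: bd.
suff <- : D = q z by [].
apply: tends_unique tD _.
pose psi (t : C) := t * q (c + t * (z - c)).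
(* A radius above 1 with [r0 * cm (z - c) <= r], so that [psi] is holomorphic beyond the unit
   disc. *)
pose r0 := 2 * r / (cm (z - c) + r).
have zc0 := cm_ge0 (z - c).
have rp : 0 < r by exact: le_lt_trans zr0.
have den : 0 < cm (z - c) + r by rewrite ltr_wpDl.
have r01 : 1 < r0 by rewrite /r0 ltr_pdivlMr// mul1r; lra.
have dpsi t : cm (t - 0) < r0 -> dif psi t
    (1 * q (c + t * (z - c)) + t * (der q (c + t * (z - c)) * (z - c))).
  rewrite subr0 => tr.
  have dq : dif q (c + t * (z - c)) (der q (c + t * (z - c))).
    apply: holo_dif hq _; rewrite addrAC subrr add0r cmM.
    have [->|zn] := eqVneq (cm (z - c)) 0; first by rewrite mulr0.
    apply: (@lt_le_trans _ _ (r0 * cm (z - c))); first by rewrite ltr_pM2r// lt_def zn.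
    rewrite /r0 mulrAC ler_pdivrMr//.
    have : 0 <= r * (r - cm (z - c)) by rewrite mulr_ge0 ?subr_ge0// ltW.
    lra.
  have dt := difD (dif_cst c t) (difM (dif_id t) (dif_cst (z - c) t)).
  apply: dif_eq (difM (dif_id t) (dif_comp dt dq)) _.
  by ring.
have hpsi : holo 0 r0 psi by move=> t tr; eexists; exact: dpsi.
have psi1 : psi 1 = q z by rewrite /psi !mul1r addrC subrK.
have psi0 : psi 0 = 0 by rewrite /psi mul0r.
have H := riemann_sum r01 hpsi; rewrite psi1 psi0 subr0 in H.
apply: (tends_eqf H) => n; rewrite (der_eq (dsum n z zr)); apply: eq_bigr => j _.
have [t [/andP[t0 t1] tE]] := @dyadic_itv R _ j.
rewrite (der_eq (dpsi _ _)); first by rewrite mul1r; congr (_ / _); ring.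
by rewrite subr0 tE cmR ger0_norm// (le_lt_trans t1).
Qed.

Lemma cexp_surj z : z != 0 -> exists w, cexp w = z.
Proof.
move=> z0; have c0 : 0 < cm z by rewrite cm_gt0.
pose x := complex.Re z / cm z; pose y := complex.Im z / cm z.
have xy : x ^+ 2 + y ^+ 2 = 1.
  by rewrite /x /y !expr_div_n -mulrDl -cm_sqr divff// expf_neq0// gt_eqF.
have x1 : -1 <= x <= 1.
  rewrite -ler_norml -(@ler_pXn2r _ 2) ?nnegrE// expr1n real_normK ?num_real//.
  by have := sqr_ge0 y; lra.
have [th [cth sth]] : exists th, cos th = x /\ sin th = y.
  have s2 : Num.sqrt (1 - x ^+ 2) = `|y|.
    by rewrite -sqrtr_sqr; congr Num.sqrt; lra.
  have [y0|y0] := leP 0 y.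
    by exists (acos x); rewrite acosK// sin_acos// s2 ger0_norm.
  by exists (- acos x); rewrite cosN sinN acosK// sin_acos// s2 ltr0_norm// opprK.
exists (ln (cm z) +i* th); rewrite /cexp /= cth sth lnK//.
rewrite [RHS](complexE z); apply/eqP; rewrite eq_complex /x /y /=.
by apply/andP; split; apply/eqP; field; rewrite gt_eqF.
Qed.

(* one logarithm serves every disc around [c] on which [F] has no zero *)
Lemma log_exists c F : F c != 0 -> exists h : C -> C, forall r, holo c r F ->
  (forall z, cm (z - c) < r -> F z != 0) ->
  forall z, cm (z - c) < r -> (exists l, dif h z l) /\ F z = cexp (h z).
Proof.
move=> Fc; pose q z := der F z / F z; pose P := prim c q.
have [k kE] : exists k, cexp k = F c * cexp (- P c).
  by apply: cexp_surj; rewrite mulf_neq0// cexp_neq0.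
exists (fun z => P z + k) => r hF F0.
have dP z : cm (z - c) < r -> dif P z (q z).
  apply: prim_dif => w wr; eexists; apply: difM; first exact: holo_dif (holo_der hF) wr.
  by apply: difV (F0 w wr); exact: holo_dif hF wr.
pose G z := F z * cexp (- P z).
have GE : forall z, cm (z - c) < r -> G z = G c.
  apply: dif0_const => z zr.
  have dE := dif_comp (difN (dP z zr)) (cexp_dif (- P z)).
  apply: dif_eq (difM (holo_dif hF zr) dE) _.
  by rewrite /q; field; exact: F0.
move=> z zr; split; first by eexists; apply: difD (dP z zr) (dif_cst k z).
by rewrite cexpD kE -/(G c) -(GE z zr) /G cexpN; field; exact: cexp_neq0.
Qed.

Lemma ent_log F : ent F -> (forall z, F z != 0) -> exists h : C -> C, ent h /\ forall z, F z = cexp (h z).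
Proof.
move=> hF F0; have [h hh] := log_exists (F0 0).
have H z := hh (cm (z - 0) + 1) (ent_holo hF) (fun v _ => F0 v) z ltac:(by rewrite ltrDl).
by exists h; split => z; have [] := H z.
Qed.

End Entire.

(** * Harnack and Hopf estimates *)

Section Harnack.
Context {R : realType}.
Local Notation C := R[i].
Implicit Types (z w p q c l : C) (r e : R) (f g h F : C -> C).

(** The Cayley transform [k] maps the right half-plane to the unit disc and [h c] to 0; dividing by
    [z - c] and applying the maximum principle is Schwarz's lemma. The derivative at [c] gives the
    first claim, the bound on [|k z|] a Harnack inequality whose constant 1/4 is not the sharp
    one. *)
Lemma schwarz h c r : 0 < r -> holo c r h -> (forall z, cm (z - c) < r -> 0 < complex.Re (h z)) ->
  cm (der h c) <= 2 * complex.Re (h c) / r /\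
  forall z, cm (z - c) < r ->
    complex.Re (h c) * (1 - cm (z - c) / r) / 4 <= complex.Re (h z).
Proof.
move=> r0 hh hp.
pose u := complex.Re (h c).
have cc : cm (c - c) < r by rewrite subrr cm0.
have u0 : 0 < u by exact: hp.
pose k z := (h z - h c) / (h z + (h c)^*).
have ReJ v : complex.Re (v^* : C) = complex.Re v by case: v.
have ImJ v : complex.Im (v^* : C) = - complex.Im v by case: v.
have den z : cm (z - c) < r -> h z + (h c)^* != 0.
  move=> zr; apply: contraTneq (hp z zr) => E.
  have : complex.Re (h z + (h c)^*) = 0 by rewrite E.
  by rewrite ReD ReJ -/u -leNgt; lra.
have sq z : cm (h z - h c) ^+ 2 = cm (h z + (h c)^*) ^+ 2 - 4 * complex.Re (h z) * u.
  rewrite !cm_sqr !ReD !ImD ReN ImN ReJ ImJ /u; ring.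
have k1 z : cm (z - c) < r -> cm (k z) <= 1.
  move=> zr; rewrite cmM cmV ler_pdivrMr ?cm_gt0 ?den// mul1r.
  rewrite -(@ler_pXn2r _ 2) ?nnegrE ?cm_ge0// sq gerBl.
  by rewrite mulr_ge0 ?(ltW u0)// mulr_ge0// ltW// hp.
have kc : k c = 0 by rewrite /k subrr mul0r.
have dden z : cm (z - c) < r -> dif (fun w => h w + (h c)^*) z (der h z + 0).
  by move=> zr; apply: difD (holo_dif hh zr) (dif_cst _ z).
have dnum z : cm (z - c) < r -> dif (fun w => h w - h c) z (der h z - 0).
  by move=> zr; apply: difB (holo_dif hh zr) (dif_cst _ z).
have hk : holo c r k.
  by move=> z zr; eexists; apply: difM (dnum z zr) (difV (dden z zr) (den z zr)).
have [g [hg kg gc]] := divide hk cc.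
have gr z : cm (z - c) < r -> cm (g z) * r <= 1.
  move=> zr; apply: (@le_limit_left R _ _ (cm (z - c))) => // t /andP[zt tr].
  have t0 : 0 < t by apply: le_lt_trans zt; exact: cm_ge0.
  rewrite -ler_pdivlMr//; apply: (max_modulus hg (r := t)); rewrite ?t0 ?(ltW zt)//.
  move=> v vt; rewrite div1r -[leLHS]mul1r -(ler_pM2l t0) mulfV ?gt_eqF//.
  have := k1 v; rewrite kg kc add0r cmM vt mul1r; exact.
split.
  have dk : der k c = der h c / (2 * u)%:C.
    rewrite (der_eq (difM (dnum c cc) (difV (dden c cc) (den c cc)))).
    rewrite subrr mul0r addr0 subr0 addcJ; congr (_ / _).
    by rewrite rmorphM /= rmorph_nat.
  have := gr c cc; rewrite gc dk cmM cmV cmR gtr0_norm ?mulr_gt0//.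
  by rewrite ler_pdivlMr// mulrAC ler_pdivrMr ?mulr_gt0// mul1r.
move=> z zr; pose t := cm (z - c) / r.
have t0 : 0 <= t by apply: divr_ge0; [exact: cm_ge0|exact: ltW].
have t1 : t < 1 by rewrite /t ltr_pdivrMr// mul1r.
have kt : cm (k z) <= t.
  rewrite kg kc add0r cmM /t ler_wpM2l ?cm_ge0//.
  by rewrite -[r^-1]mul1r ler_pdivlMr// gr.
have D0 : 0 < cm (h z + (h c)^*) by rewrite cm_gt0 den.
have le1 : cm (h z - h c) <= t * cm (h z + (h c)^*).
  by move: kt; rewrite /k cmM cmV ler_pdivrMr.
have le2 : cm (h z - h c) ^+ 2 <= (t * cm (h z + (h c)^*)) ^+ 2.
  by rewrite ler_pXn2r ?nnegrE ?cm_ge0// mulr_ge0// cm_ge0.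
have Dge : u <= cm (h z + (h c)^*).
  apply: le_trans (Re_le_cm _); rewrite ReD ReJ -/u lerDr ltW//; exact: hp.
rewrite -/t -/u; set D := cm (h z + (h c)^*) in sq le2 D0 Dge *.
rewrite sq exprMn in le2.
set X := complex.Re (h z) in le2 sq *.
have h1 : (1 - t ^+ 2) * D ^+ 2 <= 4 * X * u by rewrite mulrBl mul1r; lra.
have h2 : (1 - t) <= 1 - t ^+ 2 by rewrite expr2; nra.
have h3 : u ^+ 2 <= D ^+ 2 by rewrite ler_pXn2r ?nnegrE// ltW.
have h4 : (1 - t) * u ^+ 2 <= (1 - t ^+ 2) * D ^+ 2.
  by rewrite ler_pM// ?exprn_ge0//; [lra|exact: ltW].
have : ((1 - t) * u) * u <= (4 * X) * u by rewrite -mulrA -expr2; lra.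
by rewrite ler_pM2r// => h5; rewrite ler_pdivrMr// mulrC; lra.
Qed.

(** [schwarz] applied to a logarithm of [F] minus [ln m], whose real part [ln (cm (F z) / m)] is
    positive. *)
Lemma harnack F c r m : 0 < r -> 0 < m -> holo c r F -> (forall z, cm (z - c) < r -> m < cm (F z)) ->
  cm (der F c) <= 2 * ln (cm (F c) / m) / r * cm (F c) /\
  forall z, cm (z - c) < r ->
    ln (cm (F c) / m) * (1 - cm (z - c) / r) / 4 <= ln (cm (F z) / m).
Proof.
move=> r0 m0 hF Fm.
have cc : cm (c - c) < r by rewrite subrr cm0.
have F0 z : cm (z - c) < r -> F z != 0.
  by move=> zr; rewrite -cm_gt0 (lt_trans m0)// Fm.
have [h0 hh0] := log_exists (F0 c cc).
have hl := hh0 r hF F0.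
pose h z := h0 z - (ln m)%:C.
have hh : holo c r h.
  by move=> z zr; have [[l dl] _] := hl z zr; eexists; apply: difB dl (dif_cst _ z).
have ReE z : cm (z - c) < r -> complex.Re (h z) = ln (cm (F z) / m).
  move=> zr; have [_ FE] := hl z zr.
  rewrite ln_div ?posrE// ?cm_gt0 ?F0//.
  by rewrite /h ReD ReN /= FE cm_cexp expRK.
have [|H1 H2] := @schwarz h c r r0 hh.
  by move=> z zr; rewrite ReE// ln_gt0// ltr_pdivlMr// mul1r Fm.
split; last by move=> z zr; rewrite -!ReE//; exact: H2.
have -> : der F c = F c * der h c.
  have [[l dl] FE] := hl c cc.
  have dh : der h c = l by apply: der_eq; apply: dif_eq (difB dl (dif_cst _ c)) _; rewrite subr0.
  rewrite dh FE; apply: der_eq; apply: dif_local (dif_comp dl (cexp_dif _)).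
  by exists r => // z zr /=; have [_ ->] := hl z zr.
by rewrite cmM mulrC -ReE// ler_wpM2r ?cm_ge0.
Qed.

(* Hopf's boundary lemma for [ln |F|]: at a point where the disc touches the level
   set [|F| = m], the gradient bounds the growth at the centre. *)
Lemma touching F c r m q l (K : R) : 0 < r -> 0 < m -> holo c r F ->
  (forall z, cm (z - c) < r -> m < cm (F z)) ->
  cm (q - c) = r -> cm (F q) = m -> dif F q l -> cm l <= K ->
  ln (cm (F c) / m) * m <= 4 * K * r /\ cm (der F c) <= 8 * K / m * cm (F c).
Proof.
move=> r0 m0 hF Fm qr Fq dl lK.
have [H1 H2] := harnack r0 m0 hF Fm.
set A := ln (cm (F c) / m) in H1 H2 *.
have cc : cm (c - c) < r by rewrite subrr cm0.
have A0 : 0 <= A by rewrite ln_ge0// ler_pdivlMr// mul1r ltW// Fm.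
have key : A * m <= 4 * K * r.
  apply/ler_addgt0Pl => e e0.
  have e4 : 0 < e / (4 * r) by rewrite divr_gt0 ?mulr_gt0.
  move/difP: dl => /(_ _ e4)[d d0 hd].
  (* On the radius to [q], at distance [s * r] from [q], Harnack's inequality bounds [|F| - m] below
     by a multiple of [s] and the derivative at [q] bounds it above by another; cancelling [s]
     compares the two slopes. *)
  pose s := Num.min 2^-1 (d / (2 * r)).
  have s0 : 0 < s by rewrite lt_min invr_gt0 ltr0n divr_gt0 ?mulr_gt0.
  have s1 : s <= 2^-1 by rewrite ge_min lexx.
  have sd : s * (2 * r) <= d by rewrite -ler_pdivlMr ?mulr_gt0// ge_min lexx orbT.
  pose z := c + (1 - s)%:C * (q - c).
  have zc : cm (z - c) = (1 - s) * r.
    by rewrite /z addrAC subrr add0r cmM cmR qr ger0_norm// subr_ge0; lra.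
  have zq : cm (z - q) = s * r.
    have -> : z - q = - (s%:C * (q - c)) by rewrite /z rmorphB rmorph1 /=; ring.
    by rewrite cmN cmM cmR qr gtr0_norm.
  have srp : 0 < s * r by rewrite mulr_gt0.
  have zr : cm (z - c) < r by rewrite zc; lra.
  have := H2 z zr; rewrite zc mulfK ?gt_eqF// => H3.
  have Fz : m < cm (F z) by exact: Fm.
  have H4 : ln (cm (F z) / m) <= cm (F z) / m - 1.
    have Fm0 : 0 < cm (F z) / m by rewrite divr_gt0// (lt_trans m0).
    have E1 : 1 + (cm (F z) / m - 1) = cm (F z) / m by ring.
    have := @le_ln1Dx R (cm (F z) / m - 1); rewrite E1; apply; lra.
  have H5 : A * s / 4 * m <= cm (F z) - m.
    have -> : cm (F z) - m = (cm (F z) / m - 1) * m by rewrite mulrBl divfK ?gt_eqF// mul1r.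
    rewrite ler_wpM2r ?(ltW m0)//; apply: le_trans H4; apply: le_trans H3.
    by have -> : 1 - (1 - s) = s by ring.
  have zd : cm (z - q) < d.
    by rewrite zq; apply: lt_le_trans sd; rewrite mulrCA ltr_pMl// ltr1n.
  have H6 := hd z zd; rewrite zq in H6.
  have H7 : cm (F z) - m <= K * (s * r) + e / (4 * r) * (s * r).
    have := cm_le_dist (F z) (F q); have := cm_le_dist (F z - F q) (l * (z - q)).
    rewrite Fq cmM zq.
    have : cm l * (s * r) <= K * (s * r) by rewrite ler_wpM2r// ltW.
    lra.
  have E7 : e / (4 * r) * (s * r) = s * (e / 4) by field; rewrite gt_eqF.
  rewrite E7 in H7.
  have : s * (A * m) <= s * (4 * K * r + e) by lra.
  by rewrite ler_pM2l// addrC.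
split => //; apply: le_trans H1 _; rewrite ler_wpM2r ?cm_ge0//.
rewrite ler_pdivrMr// mulrAC ler_pdivlMr//; lra.
Qed.

Lemma nearest_point (S : C -> Prop) z0 s0 : S s0 -> ~ S z0 ->
  (forall u l, (forall n, S (u n)) -> tends UU u l -> S l) ->
  exists q, [/\ S q, 0 < cm (q - z0), cm (q - z0) <= cm (s0 - z0) &
    forall z, cm (z - z0) < cm (q - z0) -> ~ S z].
Proof.
move=> Ss0 Sz0 Scl.
have [||||q [[Sq qs] qmax]] := @argmax _ (fun z => S z /\ cm (z - z0) <= cm (s0 - z0))
    (fun z => - cm (z - z0)) (cm z0 + cm (s0 - z0)).
- by exists s0.
- by move=> z [_ zr]; rewrite (le_trans (cm_le_dist z z0))// lerD2l.
- move=> u l ur ul; split; first by apply: Scl ul => n; have [] := ur n.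
  by apply: (closed_ball_closed _ ul) => n; have [] := ur n.
- move=> u l _ ul _.
  have := tendsN (tends_cm (tendsB ul (tends_cst z0))).
  by rewrite -rmorphN => h; apply: (tends_eqf h) => n; rewrite rmorphN.
exists q; split => //.
  by rewrite cm_gt0 subr_eq0; apply/eqP => E; apply: Sz0; rewrite -E.
move=> z zq Sz; have := qmax z (conj Sz (le_trans (ltW zq) qs)).
by rewrite lerN2 leNgt zq.
Qed.

Lemma sublevel_closed f m : (forall z, cont f z) ->
  forall u l, (forall n, cm (f (u n)) <= m) -> tends UU u l -> cm (f l) <= m.
Proof.
move=> cf u l um ul; apply: tends_cm_le (tends_comp ul (cf l)) _.
by apply: filterE => n /=.
Qed.

Lemma superlevel_closed f m : (forall z, cont f z) ->
  forall u l, (forall n, m <= cm (f (u n))) -> tends UU u l -> m <= cm (f l).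
Proof.
move=> cf u l um ul; apply: tends_cm_ge (tends_comp ul (cf l)) _.
by apply: filterE => n /=.
Qed.

Lemma cont_boundary_le f z0 q m : cont f q -> 0 < cm (q - z0) ->
  (forall z, cm (z - z0) < cm (q - z0) -> m <= cm (f z)) -> m <= cm (f q).
Proof.
move=> cf qz H; pose u (n : nat) := q + (n.+1%:R^-1)%:C * (z0 - q).
have inv0 e : 0 < e -> UU [set n | n.+1%:R^-1 <= e :> R].
  move=> e0; apply: filterS (UU_gt_real e^-1) => n /= hn.
  rewrite -[leRHS]invrK lef_pV2 ?posrE ?invr_gt0 ?ltr0n// ltW// (lt_le_trans hn)//.
  by rewrite ler_nat.
have ul : tends UU u q.
  move=> e e0; have := inv0 (e / cm (q - z0)) (divr_gt0 e0 qz).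
  apply: filterS => n /= hn; rewrite /u addrAC subrr add0r cmM cmR cm_sym.
  by rewrite ger0_norm ?invr_ge0// -ler_pdivlMr.
apply: tends_cm_ge (tends_comp ul cf) _; apply: filterE => n /=; apply: H.
have -> : u n - z0 = (1 - n.+1%:R^-1)%:C * (q - z0) by rewrite /u rmorphB rmorph1 /=; ring.
have n0 : 0 < n.+1%:R^-1 :> R by rewrite invr_gt0.
have n1 : n.+1%:R^-1 <= 1 :> R by rewrite invf_le1// ler1n.
by rewrite cmM cmR ger0_norm ?subr_ge0// gtr_pMl// gtrBl.
Qed.

Lemma cont_boundary_ge f z0 q m : cont f q -> 0 < cm (q - z0) ->
  (forall z, cm (z - z0) < cm (q - z0) -> cm (f z) <= m) -> cm (f q) <= m.
Proof.
move=> cf qz H; rewrite leNgt; apply/negP => mf.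
pose e := cm (f q) - m; have e0 : 0 < e by rewrite subr_gt0.
have [d d0 hd] := cf (e / 2) ltac:(by rewrite divr_gt0).
pose s := Num.min 2^-1 (d / (2 * cm (q - z0))).
have s0 : 0 < s by rewrite lt_min invr_gt0 ltr0n divr_gt0 ?mulr_gt0.
have s1 : s <= 2^-1 by rewrite ge_min lexx.
have sd : s * (2 * cm (q - z0)) <= d by rewrite -ler_pdivlMr ?mulr_gt0// ge_min lexx orbT.
pose z := q + s%:C * (z0 - q).
have zq : cm (z - q) = s * cm (q - z0).
  by rewrite /z addrAC subrr add0r cmM cmR gtr0_norm// (cm_sym z0).
have sp : 0 < s * cm (q - z0) by rewrite mulr_gt0.
have zz0 : cm (z - z0) < cm (q - z0).
  have -> : z - z0 = (1 - s)%:C * (q - z0) by rewrite /z rmorphB rmorph1 /=; ring.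
  by rewrite cmM cmR ger0_norm ?subr_ge0; [rewrite gtr_pMl//; lra|lra].
have sd2 : s * cm (q - z0) < d by lra.
have := H z zz0; have := hd z; rewrite zq => /(_ sd2).
have := cm_le_dist (f q) (f z); rewrite (cm_sym (f q)) /e /=; lra.
Qed.

(** A logarithm [h] of [H] has real part at most [ln A + B * cm z]. Applying [schwarz] to [T - h] on
    discs of radius [r], with [T] an upper bound there, gives [|h'| <= 2 * B] as [r] grows, and
    Liouville's theorem makes [h'] constant. *)
Lemma ent_cexp_linear H (A B : R) : ent H -> (forall z, H z != 0) -> 0 < A -> 0 <= B ->
  (forall z, cm (H z) <= A * expR (B * cm z)) ->
  exists la mu : C, forall z, H z = cexp (la * z + mu).
Proof.
move=> hH H0 A0 B0 HAB.
have [h [hh hE]] := ent_log hH H0.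
have Reh z : complex.Re (h z) <= ln A + B * cm z.
  by rewrite -ler_expR expRD lnK// -cm_cexp -hE.
have bd p : cm (der h p) <= 2 * B.
  rewrite leNgt; apply/negP => hp.
  pose x := cm (der h p) - 2 * B; have x0 : 0 < x by rewrite subr_gt0.
  suff /eqP : x = 0 by rewrite gt_eqF.
  apply: (@ge0_le_div_nat _ _ (2 * (ln A + B * cm p + 1 - complex.Re (h p)))); first exact: ltW.
  move=> r r1; have r0 : 0 < r by exact: lt_le_trans r1.
  pose T := ln A + B * (cm p + r) + 1.
  pose g z := T%:C - h z.
  have hg : ent g by apply: entB => //; exact: ent_cst.
  have [|H1 _] := @schwarz g p r r0 (ent_holo hg).
    move=> z zr; rewrite /g ReD ReN /=; have := Reh z; rewrite /T.
    have : B * cm z <= B * (cm p + r).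
      by rewrite ler_wpM2l// (le_trans (cm_le_dist z p))// lerD2l ltW.
    lra.
  have dg : cm (der g p) = cm (der h p).
    rewrite (der_eq (difB (dif_cst T%:C p) (ent_dif p hh))) sub0r cmN //.
  rewrite dg ler_pdivlMr// in H1.
  rewrite ler_pdivlMr// /x mulrBl; apply: le_trans (lerB H1 (lexx _)) _.
  rewrite /g ReD ReN /= /T; lra.
have la := liouville (ent_der hh) bd.
exists (der h 0), (h 0) => z; rewrite hE; congr cexp.
have dz : forall v, dif (fun w => h w - der h 0 * w) v 0.
  move=> v; apply: dif_eq (difB (ent_dif v hh) (dif_scale _ (dif_id v))) _.
  by rewrite (la v 0) mulr1 subrr.
by have := ent_dif0_const dz z 0; rewrite mulr0 subr0 => /eqP; rewrite subr_eq addrC => /eqP.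
Qed.

End Harnack.

(** * Locally bounded families *)

Section Families.
Context {R : realType}.
Local Notation C := R[i].
Implicit Types (z w p c l : C) (r e : R) (f g x y : C -> C) (phi psi : nat -> C -> C).

Definition locb phi := forall r, exists M : R, 0 <= M /\
  UU [set n | forall z, cm z <= r -> cm (phi n z) <= M].

(** Pointwise convergence is enough in place of locally uniform convergence: with local boundedness,
    [ulim_holo] makes [f] entire and carries the limit over to derivatives. *)
Definition clim phi f :=
  [/\ forall n, ent (phi n), locb phi & forall z, tends UU (fun n => phi n z) (f z)].

Lemma clim_exists phi : (forall n, ent (phi n)) -> locb phi -> exists f, clim phi f.
Proof.
move=> hphi lb; suff /choice[f hf] : forall z, exists l, tends UU (fun n => phi n z) l by exists f.
move=> z; have [M [_ HM]] := lb (cm z); apply: (@ulim_exists _ _ M).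
by apply: filterS HM => n /(_ z (lexx _)).
Qed.

Lemma locb_der phi : (forall n, ent (phi n)) -> locb phi -> locb (fun n => der (phi n)).
Proof.
move=> hphi lb r; have [M [M0 HM]] := lb (r + 2); exists (2 * M); split; first by rewrite mulr_ge0.
apply: filterS HM => n HM z zr; rewrite -[leRHS]divr1.
apply: (cauchy_estimate (r0 := 2) (ent_holo (hphi n)) (ent_dif z (hphi n))).
  by move=> w wz; apply: HM; rewrite (le_trans (cm_le_dist w z))// lerD// ltW.
by rewrite ltr01/=; lra.
Qed.

Lemma clim_dif phi f : clim phi f -> forall p, exists D,
  dif f p D /\ tends UU (fun n => der (phi n) p) D.
Proof.
move=> [hphi lb lim] p; have [M [M0 HM]] := lb (cm p + 1).
apply: (@ulim_holo _ phi f p 1 M) => [n||z _|]; [exact: ent_holo| |exact: lim|].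
  apply: filterS HM => n HM z zr; apply: HM.
  by rewrite (le_trans (cm_le_dist z p))// lerD2l ltW.
by rewrite subrr cm0.
Qed.

Lemma clim_ent phi f : clim phi f -> ent f.
Proof. by move=> h p; have [D [dD _]] := clim_dif h p; exists D. Qed.

Lemma clim_der phi f : clim phi f -> clim (fun n => der (phi n)) (der f).
Proof.
move=> h; have [hphi lb lim] := h; split.
- by move=> n; apply: ent_der.
- exact: locb_der.
- by move=> z; have [D [dD tD]] := clim_dif h z; rewrite (der_eq dD).
Qed.

Lemma clim_cst (u : nat -> C) l : tends UU u l -> clim (fun n _ => u n) (fun=> l).
Proof.
move=> ul; split=> //; first by move=> n; exact: ent_cst.
move=> r; exists (cm l + 1); split; first by rewrite addr_ge0 ?cm_ge0.
by apply: filterS (tends_bounded ul) => n /=.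
Qed.

Lemma climB phi psi f g : clim phi f -> clim psi g ->
  clim (fun n z => phi n z - psi n z) (fun z => f z - g z).
Proof.
move=> [h1 h2 h3] [k1 k2 k3]; split => [n|r|z].
- exact: entB.
- have [M [M0 HM]] := h2 r; have [N [N0 HN]] := k2 r; exists (M + N); split; first exact: addr_ge0.
  apply: filterS2 HM HN => n HM HN z zr.
  by rewrite (le_trans (cmB _ _))// lerD ?HM ?HN.
- exact: tendsB.
Qed.

Lemma climM phi psi f g : clim phi f -> clim psi g ->
  clim (fun n z => phi n z * psi n z) (fun z => f z * g z).
Proof.
move=> [h1 h2 h3] [k1 k2 k3]; split => [n|r|z].
- exact: entM.
- have [M [M0 HM]] := h2 r; have [N [N0 HN]] := k2 r; exists (M * N); split; first exact: mulr_ge0.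
  apply: filterS2 HM HN => n HM HN z zr.
  by rewrite cmM ler_pM ?cm_ge0 ?HM ?HN.
- exact: tendsM.
Qed.

Lemma climBc phi f (a : C) : clim phi f -> clim (fun n z => phi n z - a) (fun z => f z - a).
Proof. by move=> h; apply: climB h (clim_cst (tends_cst a)). Qed.

Lemma locb_lip phi : (forall n, ent (phi n)) -> locb phi -> forall r, exists L : R,
  0 < L /\ UU [set n | forall z w, cm z <= r -> cm w <= r -> cm (phi n w - phi n z) <= L * cm (w - z)].
Proof.
move=> hphi lb r; have [M [M0 HM]] := locb_der hphi lb r; exists (M + 1); split.
  by rewrite ltr_wpDl.
apply: filterS HM => n HM z w zr wr; apply: (@lip_ball _ (phi n) 0 r); rewrite ?subr0//.
move=> v; rewrite subr0 => vr; exists (der (phi n) v); split; first exact: ent_dif.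
by rewrite (le_trans (HM v vr))// lerDl.
Qed.

Lemma clim_moving phi f (u : nat -> C) l (B : R) : clim phi f -> (forall n, cm (u n) <= B) ->
  tends UU u l -> tends UU (fun n => phi n (u n)) (f l).
Proof.
move=> [hphi lb lim] uB ul; have lB : cm l <= B.
  by apply: tends_cm_le ul _; apply: filterE.
have [L [L0 HL]] := locb_lip hphi lb B.
have h : tends UU (fun n => phi n (u n) - phi n l) 0.
  apply: (@tends_squeeze _ _ _ _ (fun n => L * cm (u n - l))).
    by apply: filterS HL => n H; apply: H.
  have := tendsM (tends_cst L%:C) (tends_cm (tendsB ul (tends_cst l))).
  rewrite subrr cm0 rmorph0 mulr0 => h; apply: (tends_eqf h) => n.
  by rewrite rmorphM.
have := tendsD h (lim l); rewrite add0r => h'; apply: (tends_eqf h') => n.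
by rewrite subrK.
Qed.

(** Minimisers of [|phi n|] on the circle converge along the ultrafilter to a point of the circle,
    and by [clim_moving] the minima converge to the modulus of [f] there, which is not 0. *)
Lemma circle_lower phi f p r : clim phi f -> 0 < r ->
  (forall z, cm (z - p) = r -> f z != 0) ->
  exists mu : R, 0 < mu /\ UU [set n | forall z, cm (z - p) = r -> mu <= cm (phi n z)].
Proof.
move=> h r0 fn0; have [hphi lb lim] := h.
have /choice[u hu] : forall n, exists z, cm (z - p) = r /\
    forall w, cm (w - p) = r -> cm (phi n z) <= cm (phi n w).
  move=> n.
  have [||||z [zr zm]] := @argmax _ (fun z => cm (z - p) = r) (fun z => - cm (phi n z)) (cm p + r).
  - by exists (p + r%:C); rewrite addrAC subrr add0r cmR gtr0_norm.
  - by move=> z zr; rewrite (le_trans (cm_le_dist z p))// zr.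
  - move=> v l vr vl; have t := tendsB vl (tends_cst p).
    apply/eqP; rewrite eq_le; apply/andP; split.
      by apply: tends_cm_le t _; apply: filterE => k /=; rewrite vr.
    by apply: tends_cm_ge t _; apply: filterE => k /=; rewrite vr.
  - move=> v l _ vl _; have := tendsN (tends_cm (tends_comp vl (ent_cont l (hphi n)))).
    by rewrite -rmorphN => t; apply: (tends_eqf t) => k; rewrite rmorphN.
  by exists z; split => // w wr; have := zm w wr; rewrite lerN2.
have uB n : cm (u n) <= cm p + r by rewrite (le_trans (cm_le_dist _ p))// (hu n).1.
have [|l ul] := @ulim_exists _ u (cm p + r); first exact: filterE.
have lr : cm (l - p) = r.
  have t := tendsB ul (tends_cst p).
  apply/eqP; rewrite eq_le; apply/andP; split.
    by apply: tends_cm_le t _; apply: filterE => k /=; rewrite (hu k).1.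
  by apply: tends_cm_ge t _; apply: filterE => k /=; rewrite (hu k).1.
have fl := fn0 l lr.
exists (cm (f l) / 2); split; first by rewrite divr_gt0// cm_gt0.
apply: filterS (tends_away (clim_moving h uB ul) fl) => n /= H z zr.
exact: le_trans H ((hu n).2 z zr).
Qed.

(** If [g p] were not 0, then [psi n], hence [phi n], would have no zero on a disc about [p] of
    radius [rho] independent of [n], by equi-Lipschitz continuity. The maximum principle for
    [1 / phi n] and [circle_lower] would keep [phi n p] away from 0. In this form an implication
    between shared values survives the limit. *)
Lemma hurwitz phi psi f g p : clim phi f -> clim psi g ->
  (forall n z, phi n z = 0 -> psi n z = 0) ->
  f p = 0 -> ~ (forall z, f z = 0) -> g p = 0.
Proof.
move=> hf hg tr fp nf; apply/eqP; apply: contrapT => /negP gp.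
have [hphi _ lim] := hf; have [hpsi lbpsi limpsi] := hg.
have [L [L0 HL]] := locb_lip hpsi lbpsi (cm p + 1).
have gp0 : 0 < cm (g p) by rewrite cm_gt0.
pose rho := Num.min 1 (cm (g p) / (4 * L)).
have rho0 : 0 < rho by rewrite lt_min ltr01 divr_gt0 ?mulr_gt0.
have rho1 : rho <= 1 by rewrite ge_min lexx.
have rhoL : rho * (4 * L) <= cm (g p) by rewrite -ler_pdivlMr ?mulr_gt0// ge_min lexx orbT.
have [d d0 hd] := isolated_zeros p (clim_ent hf) nf.
pose r := Num.min (rho / 2) d.
have r0 : 0 < r by rewrite lt_min divr_gt0.
have rrho : r <= rho / 2 by rewrite ge_min lexx.
have rd : r <= d by rewrite ge_min lexx orbT.
have [|mu [mu0 Hmu]] := circle_lower hf r0 (p := p).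
  by move=> z zr; apply: hd; rewrite ?zr// -subr_eq0 -cm_eq0 zr gt_eqF.
have mu2 : 0 < mu / 2 by rewrite divr_gt0.
have [n [[H1 H2] [H3 H4]]] := filter_ex (filterI
  (filterI (tends_away (limpsi p) gp) HL) (filterI Hmu (lim p _ mu2))).
have phi0 z : cm (z - p) < rho -> phi n z != 0.
  move=> zr; apply/eqP => /tr pz.
  have := H2 p z; rewrite pz sub0r cmN lerDl ler01 => /(_ isT).
  have zp1 : cm z <= cm p + 1.
    by rewrite (le_trans (cm_le_dist z p))// lerD2l (le_trans (ltW zr)).
  move=> /(_ zp1) H5; move: H1 => /= H1.
  have : L * cm (z - p) <= L * rho by rewrite ler_wpM2l ?ltW.
  lra.
have hinv : holo p rho (fun z => (phi n z)^-1).
  by move=> z zr; eexists; apply: difV (phi0 z zr); exact: ent_dif.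
have rr : 0 < r < rho by rewrite r0; lra.
have := max_modulus hinv rr (M := mu^-1) _ (z := p).
rewrite subrr cm0 (ltW r0) => /(_ _ isT) H5.
have : cm (phi n p)^-1 <= mu^-1.
  apply: H5 => z zr; rewrite cmV lef_pV2 ?posrE ?H3//.
  exact: lt_le_trans mu0 (H3 z zr).
have pp : phi n p != 0 by apply: phi0; rewrite subrr cm0.
rewrite cmV lef_pV2 ?posrE ?cm_gt0// => H6.
by move: H4; rewrite /= fp subr0; lra.
Qed.

(** Zeros of [Y n] near 0 do no harm: [T n] is entire, so it suffices to bound it on a circle about
    0 where the limit [y] has no zero. *)
Lemma quotient_bounded (T X Y : nat -> C -> C) x y : clim X x -> clim Y y ->
  (forall n, ent (T n)) -> (forall n z, T n z * Y n z = X n z) ->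
  ~ (forall z, y z = 0) -> exists M : R, UU [set n | cm (T n 0) <= M].
Proof.
move=> hX hY hT TE ny.
have [d d0 hd] := isolated_zeros 0 (clim_ent hY) ny.
have [|mu [mu0 Hmu]] := circle_lower hY d0 (p := 0).
  by move=> z zd; apply: hd; rewrite ?zd// -[z]subr0 -cm_eq0 zd gt_eqF.
have [_ lb _] := hX; have [M [M0 HM]] := lb d.
exists (M / mu); apply: filterS2 Hmu HM => n H1 H2 /=.
have dd : 0 < d < d + 1 by rewrite d0 ltrDl/=.
apply: (max_modulus (ent_holo (hT n)) dd (c := 0)); last by rewrite subrr cm0 ltW.
move=> z zd; have Yz := H1 z zd.
have zd' : cm z <= d by rewrite -[z]subr0 zd.
have := H2 z zd'; rewrite -TE cmM ler_pdivlMr// => H3.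
by apply: le_trans H3; rewrite ler_wpM2l ?cm_ge0.
Qed.

(** The function [ln (1 + |f|^2)] is smooth even at zeros of [f], and its derivative along the
    segment, parametrised by [0, 1], is at most [8 * K * cm (z - c)]. The claim follows from
    [|f| <= 1 + |f|^2]. *)
Lemma gronwall f c r (K : R) : ent f -> 0 <= K ->
  (forall z, cm (z - c) <= r -> cm (der f z) <= K * (1 + cm (f z))) ->
  forall z, cm (z - c) <= r -> cm (f z) <= (1 + cm (f c) ^+ 2) * expR (8 * K * cm (z - c)).
Proof.
move=> hf K0 H z zr; pose h := z - c.
have hc : cm h = cm (z - c) by [].
pose xx (t : R) := complex.Re (f (c + t%:C * h)).
pose yy (t : R) := complex.Im (f (c + t%:C * h)).
pose dx (t : R) := complex.Re (der f (c + t%:C * h) * h).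
pose dy (t : R) := complex.Im (der f (c + t%:C * h) * h).
have Dx t : is_derive t (1 : R) xx (dx t) by apply: Re_is_derive; exact: ent_dif.
have ImE (v : C) : complex.Im v = complex.Re (- 'i * v) by case: v => a b /=; ring.
have Dy t : is_derive t (1 : R) yy (dy t).
  have -> : yy = (fun s : R => complex.Re ((fun v => - 'i * f v) (c + s%:C * h))).
    by apply/funext => s; rewrite /yy ImE.
  have -> : dy t = complex.Re ((- 'i * der f (c + t%:C * h)) * h) by rewrite /dy ImE mulrA.
  exact: (@Re_is_derive _ (fun v => - 'i * f v) c h t _ (dif_scale (- 'i) (ent_dif _ hf))).
pose N (t : R) := 1 + xx t * xx t + yy t * yy t.
have NE t : N t = 1 + cm (f (c + t%:C * h)) ^+ 2.
  by rewrite cm_sqr /N /xx /yy !expr2 addrA.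
have N0 t : 0 < N t by rewrite NE ltr_wpDr ?ltr01// exprn_ge0 ?cm_ge0.
pose phi (t : R) := ln (N t).
pose dphi (t : R) := (N t)^-1 * (2 * (xx t * dx t + yy t * dy t)).
have Dphi t : is_derive t (1 : R) phi (dphi t).
  have D1 : is_derive t (1 : R) N (2 * (xx t * dx t + yy t * dy t)).
    have xM := @is_deriveM _ _ xx xx t 1 _ _ (Dx t) (Dx t).
    have yM := @is_deriveM _ _ yy yy t 1 _ _ (Dy t) (Dy t).
    have := @is_deriveD _ _ _ _ _ t 1 _ _
      (@is_deriveD _ _ _ _ _ t 1 _ _ (is_derive_cst (1 : R) t 1) xM) yM.
    by move=> D; apply: (@is_derive_eq _ _ _ _ _ _ _ _ D); rewrite /GRing.scale /=; ring.
  by have D2 := is_derive1_ln (N0 t); exact: is_derive1_comp.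
have [|s] := @MVT_segment R phi dphi 0 1 ler01 (fun t _ => Dphi t).
- by apply: derivable_within_continuous => t _; have [] := Dphi t.
rewrite in_itv /= subr0 mulr1 => s01 E.
have bnd : dphi s <= 8 * K * cm h.
  set v := c + s%:C * h.
  have vr : cm (v - c) <= r.
    rewrite /v addrAC subrr add0r cmM cmR ger0_norm; last by case/andP: s01.
    by apply: le_trans zr; rewrite -hc ler_piMl ?cm_ge0//; case/andP: s01.
  have Hv := H v vr.
  rewrite /dphi mulrC ler_pdivrMr// NE -/v.
  set G := cm (f v) in Hv *; have G0 : 0 <= G by exact: cm_ge0.
  set D := cm (der f v * h).
  have D0 : 0 <= D by exact: cm_ge0.
  have a1 : xx s * dx s <= G * D.
    apply: le_trans (ler_norm _) _; rewrite normrM ler_pM//; exact: cm_Re.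
  have a2 : yy s * dy s <= G * D.
    apply: le_trans (ler_norm _) _; rewrite normrM ler_pM//; exact: cm_Im.
  have DK : D <= K * (1 + G) * cm h by rewrite /D cmM ler_wpM2r ?cm_ge0.
  have a3 : G * D <= G * (K * (1 + G) * cm h) by rewrite ler_wpM2l.
  have Kh : 0 <= K * cm h by rewrite mulr_ge0 ?cm_ge0.
  have a4 : (G + G ^+ 2) * (K * cm h) <= (2 * (1 + G ^+ 2)) * (K * cm h).
    by rewrite ler_wpM2r//; nra.
  have e1 : G * (K * (1 + G) * cm h) = (G + G ^+ 2) * (K * cm h) by ring.
  rewrite e1 in a3.
  have e2 : 8 * K * cm h * (1 + G ^+ 2) = 4 * ((2 * (1 + G ^+ 2)) * (K * cm h)) by ring.
  rewrite e2; lra.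
have cz : c + 1%:C * h = z by rewrite rmorph1 /h; ring.
have phi1 : phi 1 = ln (1 + cm (f z) ^+ 2) by rewrite /phi NE cz.
have phi0 : phi 0 = ln (1 + cm (f c) ^+ 2) by rewrite /phi NE rmorph0 mul0r addr0.
have p0 v : 0 < 1 + cm (f v) ^+ 2 by rewrite ltr_wpDr ?ltr01// exprn_ge0 ?cm_ge0.
have : ln (1 + cm (f z) ^+ 2) <= ln (1 + cm (f c) ^+ 2) + 8 * K * cm (z - c).
  by rewrite -phi1 -phi0 -hc; lra.
rewrite -ler_expR expRD !lnK ?posrE//; apply: le_trans.
by have := sqr_ge0 (cm (f z) - 1); have := cm_ge0 (f z); nra.
Qed.

End Families.

(** * Rescaling near the zeros *)

Section Rescaling.
Context {R : realType}.
Local Notation C := R[i].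
Implicit Types (z w p q : C) (m r : R) (F G : C -> C).

(** The point [q] of [|F| <= m] nearest to [z0] lies on the level set, and the disc about [z0]
    through [q] satisfies the conditions of [touching]. The point [s0] ensures that [q] exists and
    limits the region in which the gradient bound is needed. *)
Lemma level_gradient F z0 s0 m (K : R) : ent F -> 0 < m -> m < cm (F z0) -> cm (F s0) <= m ->
  (forall q, cm (q - z0) <= cm (s0 - z0) -> cm (F q) = m -> cm (der F q) <= K) ->
  cm (der F z0) <= 8 * K / m * cm (F z0).
Proof.
move=> hF m0 mz sm HK.
have cF z : cont F z by exact: ent_cont.
have [||q [qm q0 qs qn]] := @nearest_point R (fun z => cm (F z) <= m) z0 s0 sm.
- by move=> h; move: mz; rewrite ltNge h.
- exact: sublevel_closed.
have Fz z : cm (z - z0) < cm (q - z0) -> m < cm (F z).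
  by move=> /qn /negP; rewrite -ltNge.
have qE : cm (F q) = m.
  apply/eqP; rewrite eq_le qm /=; apply: (cont_boundary_le (cF q) q0) => z /Fz; exact: ltW.
have := touching q0 m0 (ent_holo hF) Fz erefl qE (ent_dif q hF) (HK q qs qE).
by case.
Qed.

(** An affine [G] with non-zero slope has a zero, hence slope [b]; so [G'] is not identically [a],
    thus omits it, and [G' - a = e^(al z + be)]. The bound at 0 excludes [al = 0]. It follows that
    [G] has at most one zero. Without zeros, [G] is an exponential and [G'] attains [a]; with one
    zero, [G = (z - z0) e^(la z + mu)] and [G''] has a zero, although [G'' = al e^(al z + be)]. *)
Lemma no_rescaled_limit G (a b : C) (K : R) : ent G -> a != 0 -> b != 0 -> a != b -> 0 <= K ->
  (forall z, G z = 0 -> der G z = b) ->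
  (forall p, der G p = a -> forall z, der G z = a) ->
  (forall z, cm (der G z) <= K * (1 + cm (G z))) ->
  cm b + 1 <= cm (der G 0) -> False.
Proof.
move=> hG a0 b0 ab K0 Gb Ga GK Gd.
have hG' := ent_der hG; have hG'' := ent_der hG'.
have lin k : (forall z, der G z = k) -> k != 0 -> k = b.
  move=> dk k0.
  have c0 z : dif (fun w => G w - k * w) z 0.
    apply: dif_eq (difB (ent_dif z hG) (dif_scale k (dif_id z))) _.
    by rewrite dk mulr1 subrr.
  have E := ent_dif0_const c0 (- G 0 / k) 0.
  rewrite mulr0 subr0 in E.
  have : G (- G 0 / k) = 0.
    by move/eqP: E; rewrite subr_eq => /eqP ->; field.
  by move/Gb; rewrite dk.
have dGa z : der G z != a.
  apply/eqP => /Ga H; have := lin a H a0 => E; by rewrite E eqxx in ab.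
pose A0 := 1 + cm (G 0) ^+ 2.
have A0p : 0 < A0 by rewrite ltr_wpDr ?ltr01// exprn_ge0 ?cm_ge0.
pose B := 8 * K; have B0 : 0 <= B by rewrite mulr_ge0.
have Ggr z : cm (G z) <= A0 * expR (B * cm z).
  have := @gronwall R G 0 (cm z) K hG K0 (fun w _ => GK w) z; rewrite subr0; exact.
have ex1 z : 1 <= expR (B * cm z) by rewrite -expR0 ler_expR mulr_ge0 ?cm_ge0.
have [al [be dGE]] : exists al be : C, forall z, der G z - a = cexp (al * z + be).
  apply: (@ent_cexp_linear R _ (K + K * A0 + cm a + 1) B) => //.
  - exact: ent_subc.
  - by move=> z; rewrite subr_eq0.
  - by rewrite ltr_wpDl// !addr_ge0 ?cm_ge0// mulr_ge0// ltW.
  - move=> z; rewrite (le_trans (cmB _ _))//.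
    have h1 := GK z; have h2 : K * cm (G z) <= K * (A0 * expR (B * cm z)) by rewrite ler_wpM2l.
    have h3 : K * 1 <= K * expR (B * cm z) by rewrite ler_wpM2l.
    have h4 : cm a * 1 <= cm a * expR (B * cm z) by rewrite ler_wpM2l ?cm_ge0.
    rewrite !mulrDl; have := ex1 z; lra.
have dG0 : der G 0 != 0.
  by rewrite -cm_gt0; apply: lt_le_trans Gd; rewrite ltr_wpDl ?cm_ge0.
have ddG z : der (der G) z = al * cexp (al * z + be).
  rewrite -(der_subc a z hG') (der_ext z dGE); apply: der_eq.
  by apply: dif_eq (dif_comp (dif_affine al be z) (cexp_dif _)) _; rewrite mulrC.
have [al0|al0] := eqVneq al 0.
  have dk z : der G z = der G 0.
    by apply/eqP; rewrite -(inj_eq (addIr (- a))) !dGE al0 !mul0r.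
  have E := lin _ dk dG0; move: Gd; rewrite E; lra.
have ddG0 z : der (der G) z != 0 by rewrite ddG mulf_neq0// cexp_neq0.
(* [G - a z - (G' - a) / al] is constant. At a zero of [G] the derivative is [b], so this expression
   determines [a z]. *)
have uniq z w : G z = 0 -> G w = 0 -> z = w.
  move=> Gz Gw.
  have c0 v : dif (fun x => G x - a * x - al^-1 * cexp (al * x + be)) v 0.
    have d1 := dif_comp (dif_affine al be v) (cexp_dif (al * v + be)).
    apply: dif_eq (difB (difB (ent_dif v hG) (dif_scale a (dif_id v))) (dif_scale al^-1 d1)) _.
    by rewrite -dGE; field.
  have := ent_dif0_const c0 z w; rewrite -!dGE (Gb z Gz) (Gb w Gw) Gz Gw.
  by move=> /addIr; rewrite !sub0r => /oppr_inj /(mulfI a0).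
have [[z0 Gz0]|nz] := pselect (exists z, G z = 0); last first.
  have [|la [mu GE]] := @ent_cexp_linear R G A0 B hG _ A0p B0 Ggr.
    by move=> z; apply/eqP => Gz; apply: nz; exists z.
  have dG z : der G z = la * G z.
    rewrite (der_ext z GE) GE; apply: der_eq.
    by apply: dif_eq (dif_comp (dif_affine la mu z) (cexp_dif _)) _; rewrite mulrC.
  have la0 : la != 0 by apply: contra_neq dG0 => la0; rewrite dG la0 mul0r.
  have [w wE] : exists w : C, cexp w = a / la by apply: cexp_surj; rewrite mulf_neq0 ?invr_eq0.
  have := dGa ((w - mu) / la); rewrite dG GE.
  have -> : la * ((w - mu) / la) + mu = w by field.
  by rewrite wE mulrC divfK// eqxx.
have [g [hg Gg gz0]] := ent_divide0 hG Gz0.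
have gn0 z : g z != 0.
  apply/eqP => gz; have zz : z = z0 by apply: uniq => //; rewrite Gg gz mulr0.
  by move: gz; rewrite zz gz0 (Gb _ Gz0); move/eqP: b0.
have rr : 0 <= (1 : R) < 2 by apply/andP; split; lra.
have [M [M0 HM]] := ball_bounded (ent_holo (c := z0) hg) rr.
(* Outside the unit disc about [z0], dividing by [z - z0] does not increase the modulus; inside, [M]
   bounds the quotient. *)
have [|la [mu gE]] := @ent_cexp_linear R g (A0 + M) B hg gn0 (addr_gt0 A0p M0) B0.
  move=> z; have [zr|zr] := leP (cm (z - z0)) 1.
    apply: le_trans (HM z zr) _; have := ex1 z; rewrite mulrDl.
    have : M * 1 <= M * expR (B * cm z) by rewrite ler_pM2l.
    have : 0 <= A0 * expR (B * cm z) by rewrite mulr_ge0 ?expR_ge0// ltW.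
    lra.
  apply: (@le_trans _ _ (cm (G z))).
    by rewrite Gg cmM ler_peMl ?cm_ge0// ltW.
  apply: le_trans (Ggr z) _; rewrite ler_wpM2r ?expR_ge0// lerDl; exact: ltW.
have dg z : dif g z (la * g z).
  have := ent_dif z hg; suff -> : der g z = la * g z by [].
  rewrite (der_ext z gE) gE; apply: der_eq.
  by apply: dif_eq (dif_comp (dif_affine la mu z) (cexp_dif _)) _; rewrite mulrC.
have dz v : dif (fun z => z - z0) v 1.
  by apply: dif_eq (difB (dif_id v) (dif_cst z0 v)) _; rewrite subr0.
have dGE2 z : der G z = (1 + la * (z - z0)) * g z.
  rewrite (der_ext z Gg); apply: der_eq; apply: dif_eq (difM (dz z) (dg z)) _; ring.
have ddGE2 z : der (der G) z = (2 * la + la ^+ 2 * (z - z0)) * g z.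
  rewrite (der_ext z dGE2); apply: der_eq.
  apply: dif_eq (difM (difD (dif_cst 1 z) (dif_scale la (dz z))) (dg z)) _; ring.
have [la0|la0] := eqVneq la 0.
  by have := ddG0 0; rewrite ddGE2 la0 mulr0 expr0n /= mul0r addr0 mul0r eqxx.
have := ddG0 (z0 - 2 / la); rewrite ddGE2.
have -> : 2 * la + la ^+ 2 * (z0 - 2 / la - z0) = 0 by field.
by rewrite mul0r eqxx.
Qed.

(* Maximising [(1 - |q - y|) / |F q|] over [|F'| >= K] near [y] yields a point
   where [F] is almost minimal on a disc that is large relative to [|F p|]. *)
Lemma doubling F (K : R) (n : nat) y : ent F -> 0 < K ->
  (forall z, F z = 0 -> cm (der F z) < K) ->
  K <= cm (der F y) -> cm (F y) < (2 * n.+1%:R)^-1 ->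
  exists p, [/\ F p != 0, cm (F p) <= n.+1%:R^-1, K <= cm (der F p) &
    forall q, cm (q - p) <= n%:R * cm (F p) -> K <= cm (der F q) ->
      cm (F p) / 2 <= cm (F q)].
Proof.
move=> hF K0 F0 Ky yn.
have Fn0 z : K <= cm (der F z) -> 0 < cm (F z).
  move=> Kz; rewrite cm_gt0; apply/eqP => /F0; by rewrite ltNge Kz.
pose phi q := (1 - cm (q - y)) / cm (F q).
have [||||p [[py Kp] pmax]] := @argmax R (fun q => cm (q - y) <= 1 /\ K <= cm (der F q)) phi (cm y + 1).
- by exists y; rewrite subrr cm0 ler01.
- by move=> z [zr _]; rewrite (le_trans (cm_le_dist z y))// lerD2l.
- move=> u l Hu ul; split; first by apply: closed_ball_closed ul => n0; exact: (Hu n0).1.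
  apply: superlevel_closed ul; last by move=> n0; exact: (Hu n0).2.
  by move=> z; apply: ent_cont; exact: ent_der.
- move=> u l Hu ul [lr Kl].
  have t1 := tends_cm (tendsB ul (tends_cst y)).
  have t2 := tends_cm (tends_comp ul (ent_cont l hF)).
  have l0 : (cm (F l))%:C != 0 :> C by rewrite eq_complex /= gt_eqF// Fn0.
  have := tends_div (tendsB (tends_cst 1%:C) t1) t2 l0.
  rewrite /phi -rmorphB -fmorphV -rmorphM => t3.
  by apply: (tends_eqf t3) => k; rewrite rmorphM fmorphV rmorphB.
have Fp := Fn0 p Kp; have Fy := Fn0 y Ky.
pose V := phi p.
have V1 : (cm (F y))^-1 <= V.
  have := pmax y; rewrite {1}/phi subrr cm0 subr0 div1r; apply.
  by rewrite ler01.
have n0 : (0 : R) < 2 * n.+1%:R by rewrite mulr_gt0.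
have V2 : 2 * n.+1%:R < V.
  apply: lt_le_trans V1; rewrite -(ltr_pM2r Fy) mulVf ?gt_eqF// mulrC.
  by move: yn; rewrite -[X in _ < X]div1r ltr_pdivlMr.
have sE : 1 - cm (p - y) = V * cm (F p) by rewrite /V /phi divfK// gt_eqF.
have V0 : 0 < V by exact: lt_trans V2.
have cpy := cm_ge0 (p - y).
exists p; split => //.
- by rewrite -cm_gt0.
- rewrite -[leRHS]mul1r ler_pdivlMr ?ltr0n//.
  have : cm (F p) * (2 * n.+1%:R) <= cm (F p) * V by rewrite ler_pM2l// ltW.
  have : 0 <= cm (F p) * n.+1%:R by rewrite mulr_ge0// ltW.
  lra.
- move=> q qp Kq; have Fq := Fn0 q Kq.
  (* [V * cm (F p)] is the distance [1 - cm (p - y)] left to the boundary. At most half of it is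
     used up in going from [p] to [q], so the weight in [phi] drops at most by the factor 2. *)
  have nV : n%:R * cm (F p) <= V * cm (F p) / 2.
    have : n%:R * cm (F p) <= n.+1%:R * cm (F p) by rewrite ler_pM2r// ler_nat.
    have : (2 * n.+1%:R) * cm (F p) <= V * cm (F p) by rewrite ler_pM2r// ltW.
    lra.
  have qy : cm (q - y) <= 1 - V * cm (F p) / 2 by have := cm_dist q p y; lra.
  have Vp : 0 < V * cm (F p) by rewrite mulr_gt0.
  have qy1 : cm (q - y) <= 1 by lra.
  have := pmax q (conj qy1 Kq); rewrite -/V {1}/phi ler_pdivrMr// => H.
  have : V * (cm (F p) / 2) <= V * cm (F q) by lra.
  by rewrite ler_pM2l.
Qed.

Lemma tends_small (u : nat -> C) : (forall n, cm (u n) <= n.+1%:R^-1) -> tends UU u 0.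
Proof.
move=> hu e e0; apply: filterS (UU_gt_real e^-1) => n /= hn; rewrite subr0.
apply: le_trans (hu n) _.
rewrite -[leRHS]invrK lef_pV2 ?posrE ?invr_gt0 ?ltr0n// ltW// (lt_le_trans hn)//.
by rewrite ler_nat.
Qed.

Lemma ln4_le3 : ln (4 : R) <= 3.
Proof.
have E : 1 + 3 = 4 :> R by ring.
by have := @le_ln1Dx R 3; rewrite E; apply; lra.
Qed.

Lemma derivative_bound_near_zeros F (a b : C) : ent F -> a != 0 -> b != 0 -> a != b ->
  (forall z, F z = 0 -> der F z = b) -> (forall z, der F z = a -> F z = a - b) ->
  exists m : R, 0 < m /\ forall z, cm (F z) < m -> cm (der F z) < cm b + 1.
Proof.
move=> hF a0 b0 ab Fb Fa; apply: contrapT => H.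
pose K := cm b + 1.
have K1 : 1 <= K by rewrite lerDr cm_ge0.
have K0 : 0 < K by exact: lt_le_trans K1.
have FK z : F z = 0 -> cm (der F z) < K by move=> /Fb ->; rewrite ltrDl.
have /choice[p hp] : forall n : nat, exists p, [/\ F p != 0, cm (F p) <= n.+1%:R^-1,
    K <= cm (der F p) & forall q, cm (q - p) <= n%:R * cm (F p) -> K <= cm (der F q) ->
      cm (F p) / 2 <= cm (F q)].
  move=> n; have n0 : (0 : R) < (2 * n.+1%:R)^-1 by rewrite invr_gt0 mulr_gt0.
  have [y [yn Ky]] : exists y, cm (F y) < (2 * n.+1%:R)^-1 /\ K <= cm (der F y).
    apply: contrapT => Hy; apply: H; exists (2 * n.+1%:R)^-1; split => // z zn.
    by rewrite ltNge; apply/negP => Kz; apply: Hy; exists z.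
  exact: (doubling hF K0 FK Ky yn).
pose rho n := cm (F (p n)).
have rho0 n : 0 < rho n by rewrite cm_gt0; have [] := hp n.
have rhoC n : (rho n)%:C != 0 :> C by rewrite eq_complex /= gt_eqF.
pose G n z := (rho n)%:C^-1 * F ((rho n)%:C * z + p n).
have hG n : ent (G n).
  exact: ent_scale (@ent_comp _ F (fun z => (rho n)%:C * z + p n) hF (ent_affine _ _)).
have dG n z : der (G n) z = der F ((rho n)%:C * z + p n).
  apply: der_eq; apply: dif_eq (dif_scale _ (@dif_comp _ F
    (fun z => (rho n)%:C * z + p n) z _ _ (dif_affine _ _ z) (ent_dif _ hF))) _.
  by rewrite mulrCA mulVf// mulr1.
have cG n z : cm (G n z) = cm (F ((rho n)%:C * z + p n)) / rho n.
  by rewrite cmM cmV cmR gtr0_norm// mulrC.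
have G0 n : cm (G n 0) = 1 by rewrite cG mulr0 add0r -/(rho n) divff// gt_eqF.
have dG0 n : K <= cm (der (G n) 0) by rewrite dG mulr0 add0r; have [] := hp n.
have Ghalf n z : cm z <= n%:R -> cm (G n z) < 2^-1 -> cm (der (G n) z) < K.
  move=> zn; rewrite cG dG ltr_pdivrMr// => Gz; rewrite ltNge; apply/negP => Kz.
  have [_ _ _ /(_ ((rho n)%:C * z + p n))] := hp n.
  rewrite addrK cmM cmR gtr0_norm// mulrC ler_pM2r// => /(_ zn Kz).
  have E : cm (F (p n)) / 2 = 2^-1 * rho n by rewrite mulrC.
  by rewrite E leNgt Gz.
(* If [|G n| > 1/4] on the disc of radius 7, then [harnack] would give
   [|G n'(0)| <= 2 ln 4 / 7 <= 6/7], below [K >= 1]. *)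
have near0 n : (8 <= n)%N -> exists s, cm s <= 7 /\ cm (G n s) <= 4^-1.
  move=> n8; apply: contrapT => Hs.
  have Hm z : cm (z - 0) < 7 -> 4^-1 < cm (G n z).
    rewrite subr0 => z7; rewrite ltNge; apply/negP => Gz; apply: Hs; exists z.
    by rewrite (ltW z7).
  have p7 : 0 < 7 :> R by []; have p4 : 0 < 4^-1 :> R by rewrite invr_gt0.
  have [H1 _] := harnack p7 p4 (ent_holo (hG n)) Hm.
  move: H1; rewrite G0 mulr1 invrK mul1r; have := dG0 n; have := ln4_le3; lra.
have K32 : 0 <= 32 * K by rewrite mulr_ge0// ltW.
(* [level_gradient] at level 1/4 gives the factor [8 * K / 4^-1]. The touching point has modulus at
   most [2 * cm z + 7], so it lies in the disc of radius [n] in which [Ghalf] holds. *)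
have Glog n z : (8 <= n)%N -> 2 * cm z + 7 <= n%:R ->
    cm (der (G n) z) <= 32 * K * (1 + cm (G n z)).
  move=> n8 zn; have cz := cm_ge0 z; have cGz := cm_ge0 (G n z).
  have KG : 0 <= K * cm (G n z) by rewrite mulr_ge0// ltW.
  have [Gz|Gz] := leP (cm (G n z)) 4^-1.
    have := @Ghalf n z; have -> : cm z <= n%:R by lra.
    move=> /(_ isT) H1; have {}H1 := H1 ltac:(lra); lra.
  have [s [s7 Gs]] := near0 n n8.
  have p4 : 0 < 4^-1 :> R by rewrite invr_gt0.
  have := @level_gradient (G n) z s 4^-1 K (hG n) p4 Gz Gs.
  move=> H1; have {}H1 : cm (der (G n) z) <= 8 * K / 4^-1 * cm (G n z).
    apply: H1 => q qz Gq; apply/ltW/Ghalf; last by rewrite Gq; lra.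
    have := cm_le_dist q z; have := cmB s z; lra.
  rewrite invrK in H1; lra.
have lb : locb G.
  move=> r; exists (2 * expR (8 * (32 * K) * `|r|)); split; first by rewrite mulr_ge0 ?expR_ge0.
  have [N hN] : exists N : nat, 2 * `|r| + 7 <= N%:R.
    exists (Num.bound (2 * `|r| + 7)); apply/ltW/archi_boundP; rewrite addr_ge0// mulr_ge0//.
  apply: (@UU_ev _ (8 + N)%N) => n nN z zr.
  have n8 : (8 <= n)%N by exact: leq_trans (leq_addr _ _) nN.
  have Nn : N%:R <= n%:R :> R by rewrite ler_nat (leq_trans (leq_addl _ _) nN).
  have zr' : cm (z - 0) <= `|r| by rewrite subr0 (le_trans zr)// ler_norm.
  apply: le_trans (@gronwall R (G n) 0 `|r| (32 * K) (hG n) K32 _ z zr') _.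
    by move=> w; rewrite subr0 => wr; apply: Glog => //; lra.
  rewrite G0 expr1n; have -> : 1 + 1 = 2 :> R by ring.
  by rewrite ler_pM2l// ler_expR; apply: ler_wpM2l => //; rewrite mulr_ge0.
have [g cg] := clim_exists hG lb.
have cg' := clim_der cg; have [_ _ tg] := cg; have [_ _ tg'] := cg'.
have gn0 : ~ forall z, g z = 0.
  move=> /(_ 0) g0; have := @tends_cm_ge R nat UU (fun n => G n 0) (g 0) 1 (tg 0).
  rewrite g0 cm0 => H1; have : (1 : R) <= 0; last lra.
  by apply: H1; apply: filterE => n /=; rewrite G0.
apply: (@no_rescaled_limit g a b (32 * K) (clim_ent cg) a0 b0 ab K32).
- move=> z gz; apply/eqP; rewrite -subr_eq0; apply/eqP.
  apply: (hurwitz cg (climBc b cg') _ gz gn0) => n w /= /eqP.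
  rewrite mulf_eq0 invr_eq0 (negbTE (rhoC n)) /= => /eqP Fw.
  by rewrite dG Fb// subrr.
- move=> q gq z; apply/eqP; rewrite -subr_eq0; apply/eqP; move: z; apply: contrapT => nz.
  (* Rescaled, [F' = a => F = a - b] reads [G n' = a => rho n * G n = a - b]. Since
     [rho n * G n - (a - b)] has the non-zero constant limit [b - a], [hurwitz] forbids [g' = a] at
     a point unless it holds everywhere. *)
  have trho : tends UU (fun n => (rho n)%:C) 0.
    by apply: tends_small => n; rewrite cmR gtr0_norm//; have [] := hp n.
  have cpsi := climBc (a - b) (climM (clim_cst trho) cg).
  have := @hurwitz R _ _ _ _ q (climBc a cg') cpsi _ _ nz.
  rewrite gq subrr mul0r sub0r => H1.
  have : - (a - b) = 0.
    apply: H1 => // n w /= /eqP; rewrite subr_eq0 dG => /eqP /Fa Fw.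
    by rewrite /G Fw mulVKf// subrr.
  by move/eqP; rewrite oppr_eq0 subr_eq0 (negbTE ab).
- move=> z.
  have t1 := tendsB (tends_cm (tg' z)) (tendsM (tends_cst (32 * K)%:C)
    (tendsD (tends_cst 1%:C) (tends_cm (tg z)))).
  have := @tends_Re_le R nat UU _ _ 0 t1.
  rewrite -rmorphD -rmorphM -rmorphB /= subr_le0; apply.
  have [N hN] : exists N : nat, 2 * cm z + 7 <= N%:R.
    exists (Num.bound (2 * cm z + 7)); apply/ltW/archi_boundP.
    by rewrite addr_ge0// mulr_ge0// cm_ge0.
  apply: (@UU_ev _ (8 + N)%N) => n nN.
  change (complex.Re ((cm (der (G n) z))%:C - (32 * K)%:C * (1%:C + (cm (G n z))%:C)) <= 0).
  rewrite -rmorphD -rmorphM -rmorphB /= subr_le0.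
  have n8 : (8 <= n)%N by exact: leq_trans (leq_addr _ _) nN.
  have Nn : N%:R <= n%:R :> R by rewrite ler_nat (leq_trans (leq_addl _ _) nN).
  by apply: Glog => //; lra.
- by apply: tends_cm_ge (tg' 0) _; apply: filterE => n /=; exact: dG0.
Qed.

End Rescaling.

(** * Values, quotients and isolated singularities of entire functions *)

Section EntireMore.
Context {R : realType}.
Local Notation C := R[i].
Implicit Types (z w p q : C) (m r : R) (f g F : C -> C).

Definition nonconst f := ~ forall z, f z = f 0.

Lemma der0_const f : ent f -> (forall z, der f z = 0) -> ~ nonconst f.
Proof.
move=> hf d0; apply; move=> z; apply: ent_dif0_const => w.
by rewrite -(d0 w); exact: ent_dif.
Qed.

(** If [|f|] stayed above [m], [harnack] on discs of every radius would force [f' = 0]. *)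
Lemma small_value f m : ent f -> nonconst f -> 0 < m -> exists s, cm (f s) <= m.
Proof.
move=> hf nf m0; apply: contrapT => H.
have fm z : m < cm (f z) by rewrite ltNge; apply/negP => fz; apply: H; exists z.
apply: (der0_const hf _ nf) => z.
apply/eqP; rewrite -cm_eq0; apply/eqP.
apply: (@ge0_le_div_nat R _ (2 * ln (cm (f z) / m) * cm (f z))); first exact: cm_ge0.
move=> r r1; have r0 : 0 < r by exact: lt_le_trans r1.
have [H1 _] := harnack r0 m0 (ent_holo (c := z) hf) (fun w _ => fm w).
by rewrite mulrAC.
Qed.

Lemma large_value f m : ent f -> nonconst f -> exists s, m <= cm (f s).
Proof.
move=> hf nf; apply: contrapT => H; apply: nf => z.
apply: (liouville (M := m) hf) => w.
by rewrite leNgt; apply/negP => /ltW mw; apply: H; exists w.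
Qed.

Lemma ent_linear f k : ent f -> (forall z, der f z = k) -> forall z, f z = f 0 + k * z.
Proof.
move=> hf dk z.
have c0 v : dif (fun w => f w - k * w) v 0.
  apply: dif_eq (difB (ent_dif v hf) (dif_scale k (dif_id v))) _.
  by rewrite dk mulr1 subrr.
by have := ent_dif0_const c0 z 0; rewrite mulr0 subr0 => <-; rewrite subrK.
Qed.

(** The value of [T] at [p] is taken from the local representation chosen at [p]. Near [p], the
    zeros of [Y] being isolated, the representations at other points give the same values, so [T] is
    differentiable. *)
Lemma ent_quotient (X Y : C -> C) : ent X -> ent Y -> ~ (forall z, Y z = 0) ->
  (forall p, exists X1 Y1, [/\ ent X1, ent Y1, Y1 p != 0 & forall z, X z * Y1 z = Y z * X1 z]) ->
  exists T, ent T /\ forall z, T z * Y z = X z.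
Proof.
move=> hX hY nY H.
have /choice[X1 /choice[Y1 h1]] := H.
pose T p := X1 p p / Y1 p p.
have TE z : T z * Y z = X z.
  have [_ _ Yz /(_ z) E] := h1 z.
  have -> : T z * Y z = Y z * X1 z z / Y1 z z by rewrite /T; ring.
  by rewrite -E mulfK.
exists T; split => // p.
have [hX1 hY1 Yp E] := h1 p.
have [d d0 hd] := isolated_zeros p hY nY.
have [d' d'0 hd'] := tends_away (ent_cont p hY1) Yp.
have h : dif (fun z => X1 p z / Y1 p z) p _ :=
  difM (ent_dif p hX1) (difV (ent_dif p hY1) Yp).
eexists; apply: dif_local h.
exists (Num.min d d'); first by rewrite lt_min d0.
move=> z; rewrite lt_min => /andP[zd zd'] /=.
have [->//|zp] := eqVneq z p.
have Yz : Y z != 0 by apply: hd => //; exact: ltW.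
have Y1z : Y1 p z != 0.
  rewrite -cm_gt0; apply: lt_le_trans (hd' z zd'); by rewrite divr_gt0// cm_gt0.
apply: (mulfI Yz); rewrite [Y z * T z]mulrC TE mulrA -E mulfK//.
Qed.

Lemma dif_pow p k z : dif (fun w => (w - p) ^+ k.+1) z (k.+1%:R * (z - p) ^+ k).
Proof.
have d1 : dif (fun w => w - p) z 1.
  by apply: dif_eq (difB (dif_id z) (dif_cst p z)) _; rewrite subr0.
elim: k => [|k IH]; first by apply: dif_eq d1 _; rewrite expr0 mulr1.
have h := difM d1 IH.
apply: dif_ext (dif_eq h _); first by move=> w; rewrite [in RHS]exprS.
by rewrite -[k.+2%:R]natr1 [(z - p) ^+ k.+1]exprS; ring.
Qed.

Lemma vanish_off0 (p : C -> C) : ent p -> (forall x, x != 0 -> p x = 0) -> p 0 = 0.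
Proof.
move=> hp h; apply/eqP; apply: contrapT => /negP p0.
have [d d0 hd] := tends_away (ent_cont 0 hp) p0.
have d2 : 0 < d / 2 by rewrite divr_gt0.
have cd : cm (d / 2)%:C = d / 2 :> R by rewrite cmR gtr0_norm.
have dn0 : (d / 2)%:C != 0 :> C by rewrite -cm_gt0 cd.
have := hd (d / 2)%:C; rewrite /= subr0 cd (h _ dn0) cm0 => H.
have {}H := H ltac:(lra).
by move: p0; rewrite -cm_gt0; lra.
Qed.

End EntireMore.

(** * Entire functions sharing values with their derivative *)

Section Sharing.
Context {R : realType}.
Local Notation C := R[i].
Implicit Types (z w p q : C) (m r : R).
Context (f : C -> C) (a b : C).
Context (hf : ent f) (nf : nonconst f) (a0 : a != 0) (b0 : b != 0) (ab : a != b).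
Context (Ha : forall z, der f z = a -> f z = a)
  (Hb : forall z, f z = b -> der f z = b) (Hb' : forall z, der f z = b -> f z = b).

Let F z := f z - b.
Let hF : ent F. Proof. exact: ent_subc. Qed.
Let hf' : ent (der f). Proof. exact: ent_der. Qed.
Let hf'' : ent (der (der f)). Proof. exact: ent_der. Qed.
Let dF z : der F z = der f z. Proof. exact: der_subc. Qed.
Let nF : nonconst F. Proof. by move=> H; apply: nf => z; have /addIr := H z. Qed.

Lemma sharing_growth : exists K : R, 1 <= K /\ forall z, cm (der f z) <= K * (1 + cm (f z)).
Proof.
have F0 z : F z = 0 -> der F z = b by move=> /eqP; rewrite subr_eq0 dF => /eqP /Hb.
have Fa z : der F z = a -> F z = a - b by rewrite dF => /Ha; rewrite /F => ->.
have [m [m0 Hm]] := derivative_bound_near_zeros hF a0 b0 ab F0 Fa.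
pose K := cm b + 1.
have K1 : 1 <= K by rewrite lerDr cm_ge0.
(* The derivative bound holds for [|F| < m] strictly, so it is available on the level set
   [|F| = m / 2]. *)
have m2 : 0 < m / 2 by rewrite divr_gt0.
have [s sm] := small_value hF nF m2.
have L0 : 0 <= 8 * K / (m / 2) by apply: divr_ge0; [lra|exact: ltW].
set L := 8 * K / (m / 2) in L0.
exists ((K + L) * K); split.
  have : 1 * 1 <= (K + L) * K by rewrite ler_pM//; lra.
  by rewrite mulr1.
move=> z; have cz := cm_ge0 (f z).
have Fz : cm (F z) <= cm (f z) + cm b by exact: cmB.
have h1 : cm (der f z) <= K + L * cm (F z).
  have [Fm|Fm] := leP (cm (F z)) (m / 2).
    have := Hm z; rewrite dF => H1; have {}H1 : cm (der f z) < K by apply: H1; lra.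
    have : 0 <= L * cm (F z) by rewrite mulr_ge0// cm_ge0.
    lra.
  have H1 : cm (der F z) <= L * cm (F z).
    by apply: level_gradient hF m2 Fm sm _ => q _ Fq; apply/ltW/Hm; lra.
  rewrite dF in H1; lra.
have h2 : cm (F z) <= K * (1 + cm (f z)).
  have : 0 <= cm b * cm (f z) by rewrite mulr_ge0 ?cm_ge0.
  rewrite /K; lra.
have h3 : L * cm (F z) <= L * (K * (1 + cm (f z))) by rewrite ler_wpM2l.
have h4 : K * 1 <= K * (K * (1 + cm (f z))).
  rewrite ler_wpM2l//; first lra.
  have : 1 * 1 <= K * (1 + cm (f z)) by rewrite ler_pM//; lra.
  by rewrite mulr1.
lra.
Qed.

Definition trans (g : C -> C) (u : nat -> C) n z := g (z + u n).

Lemma ent_shift g c : ent g -> ent (fun z => g (z + c)).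
Proof.
move=> hg; have := @ent_comp R g (fun z => 1 * z + c) hg (ent_affine 1 c).
by apply: ent_ext => z; rewrite mul1r.
Qed.

Lemma der_shift g c z : ent g -> der (fun w => g (w + c)) z = der g (z + c).
Proof.
move=> hg; have := der_affine 1 c z hg; rewrite mulr1 mul1r => <-.
by apply: der_ext => w; rewrite mul1r.
Qed.

Lemma trans_clim (u : nat -> C) (B : R) : UU [set n | cm (f (u n)) <= B] ->
  exists g, clim (trans f u) g.
Proof.
move=> uB; have [K [K1 HK]] := sharing_growth.
have K0 : 0 <= K by lra.
apply: clim_exists => [n|r]; first exact: ent_shift.
exists ((1 + `|B| ^+ 2) * expR (8 * K * `|r|)); split.
  by rewrite mulr_ge0 ?expR_ge0// addr_ge0// exprn_ge0.
apply: filterS uB => n /= uB z zr.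
have zr' : cm (z + u n - u n) <= `|r| by rewrite addrK (le_trans zr)// ler_norm.
apply: le_trans (@gronwall R f (u n) `|r| K hf K0 (fun w _ => HK w) _ zr') _.
apply: ler_pM; rewrite ?addr_ge0 ?exprn_ge0 ?cm_ge0 ?expR_ge0//.
  by rewrite lerD2l ler_pXn2r ?nnegrE ?cm_ge0// (le_trans uB)// ler_norm.
by rewrite ler_expR ler_wpM2l// mulr_ge0.
Qed.

Lemma trans_clim_der u g : clim (trans f u) g -> clim (trans (der f) u) (der g).
Proof.
move=> /clim_der h; suff -> : trans (der f) u = (fun n => der (trans f u n)) by [].
by apply/funext => n; apply/funext => z; rewrite /trans der_shift.
Qed.

Lemma trans_clim_der2 u g : clim (trans f u) g -> clim (trans (der (der f)) u) (der (der g)).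
Proof.
move=> /trans_clim_der /clim_der h.
suff -> : trans (der (der f)) u = (fun n => der (trans (der f) u n)) by [].
by apply/funext => n; apply/funext => z; rewrite /trans der_shift.
Qed.

(** A limit with slope [a] everywhere would take the value [b] somewhere; since [f = b => f' = b]
    survives the limit by [hurwitz], its slope there would be [b]. *)
Lemma limit_not_linear u g : clim (trans f u) g -> ~ forall z, der g z = a.
Proof.
move=> cg H; have hg := clim_ent cg.
have E := ent_linear hg H.
pose p := (b - g 0) / a.
have gp : g p = b by rewrite E /p mulrC divfK// addrC subrK.
have nz : ~ forall z, g z - b = 0.
  move=> Z; have : der g 0 = 0; last by move/eqP; rewrite H (negbTE a0).
  apply: der_eq; apply: dif_ext (dif_cst b 0) => w.
  by have /eqP := Z w; rewrite subr_eq0 => /eqP.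
have := hurwitz (climBc b cg) (climBc b (trans_clim_der cg)) _ _ nz (p := p).
rewrite gp subrr H => H1.
have : a - b = 0.
  apply: H1 => // n z /eqP; rewrite subr_eq0 => /eqP fz.
  by rewrite /trans (Hb fz) subrr.
by move/eqP; rewrite subr_eq0 (negbTE ab).
Qed.

Let X z := der (der f) z * (f z - der f z).
Let Y z := (der f z - a) * (f z - b).

Lemma der_not_a : ~ forall z, der f z - a = 0.
Proof.
move=> H; have dfa z : der f z = a by apply/eqP; rewrite -subr_eq0 H.
have E := ent_linear hf dfa; pose p := (b - f 0) / a.
have : f p = b by rewrite E /p mulrC divfK// addrC subrK.
by move/Hb/eqP; rewrite dfa (negbTE ab).
Qed.

Lemma f_not_b : ~ forall z, f z - b = 0.
Proof. by move=> H; apply: nF => z; rewrite /F !H. Qed.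

Lemma Y_neq0 : ~ forall z, Y z = 0.
Proof.
move=> H; apply: f_not_b.
exact: (ent_mul0 (ent_subc a hf') (ent_subc b hf) H der_not_a).
Qed.

(** Every zero of [Y] cancels. Where [f' - a] vanishes to order [k + 1], [f''] vanishes to order at
    least [k] and [f - f'] supplies one more, since [f = f' = a] there. Where [f = b], the zero of
    [f - b] is simple because [f' = b] is not 0, and [f - f'] vanishes. *)
Lemma theta_exists : exists T, ent T /\ forall z, T z * Y z = X z.
Proof.
have hX : ent X by apply: entM => //; exact: entB.
have hY : ent Y by apply: entM; exact: ent_subc.
apply: ent_quotient Y_neq0 _ => // p.
have hu : ent (fun z => f z - der f z) by exact: entB.
have [fa|fa] := eqVneq (der f p) a.
  have fp : f p = a by exact: Ha.
  have [k [g [hg gp gE]]] := zero_order p (ent_subc a hf') der_not_a.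
  case: k gE => [|k] gE.
    by have := gE p; rewrite fa subrr expr0 mul1r => g0; rewrite -g0 eqxx in gp.
  have [s [hs sE _]] := @ent_divide0 R (fun z => f z - der f z) p hu ltac:(by rewrite /= fa fp subrr).
  pose L z := k.+1%:R * g z + (z - p) * der g z.
  have ddf z : der (der f) z = (z - p) ^+ k * L z.
    rewrite -(der_subc a z hf') (der_ext z gE); apply: der_eq.
    apply: dif_eq (difM (dif_pow p k z) (ent_dif z hg)) _.
    by rewrite /L exprS; ring.
  exists (fun z => L z * s z), (fun z => g z * (f z - b)); split.
  - apply: entM => //; apply: entD; first exact: ent_scale.
    by apply: entM; [apply: ent_subc; exact: ent_id|exact: ent_der].
  - by apply: entM => //; exact: ent_subc.
  - by rewrite mulf_neq0// fp subr_eq0.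
  - by move=> z; rewrite /X /Y ddf sE gE exprS; ring.
have [fb|fb] := eqVneq (f p) b.
  have dfb : der f p = b by exact: Hb.
  have [k [hk kE kp]] := @ent_divide0 R F p hF ltac:(by rewrite /F fb subrr).
  have [s [hs sE _]] := @ent_divide0 R (fun z => f z - der f z) p hu ltac:(by rewrite /= fb dfb subrr).
  exists (fun z => der (der f) z * s z), (fun z => (der f z - a) * k z); split.
  - exact: entM.
  - by apply: entM => //; exact: ent_subc.
  - by rewrite mulf_neq0 ?subr_eq0// kp dF dfb.
  - by move=> z; rewrite /X /Y sE -/(F z) kE; ring.
exists X, Y; split => // [|z]; first by rewrite mulf_neq0// subr_eq0.
by rewrite mulrC.
Qed.

Lemma Q_exists : exists Q, ent Q /\ forall z, Q z * F z = der f z - b.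
Proof.
apply: ent_quotient => // [|p|]; [exact: ent_subc|exact: f_not_b|] => p.
have [fb|fb] := eqVneq (f p) b.
  have dfb : der f p = b by exact: Hb.
  have [k [hk kE kp]] := @ent_divide0 R F p hF ltac:(by rewrite /F fb subrr).
  have [s [hs sE _]] := @ent_divide0 R (fun z => der f z - b) p (ent_subc b hf') ltac:(by rewrite /= dfb subrr).
  exists s, k; split => //; first by rewrite kp dF dfb.
  by move=> z; rewrite sE kE; ring.
exists (fun z => der f z - b), F; split => //; first exact: ent_subc.
  by rewrite subr_eq0.
by move=> z; rewrite mulrC.
Qed.


Lemma trans_quotient_bounded (T X1 Y1 : C -> C) u x y : ent T -> (forall z, T z * Y1 z = X1 z) ->
  clim (trans X1 u) x -> clim (trans Y1 u) y -> ~ (forall z, y z = 0) ->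
  UU [set n | n%:R <= cm (T (u n))] -> False.
Proof.
move=> hT TE cx cy ny Tn.
have [M HM] := quotient_bounded (T := trans T u) cx cy
  (fun n => ent_shift (u n) hT) (fun n z => TE (z + u n)) ny.
have [n [h1 [h2 h3]]] := filter_ex (filterI HM (filterI Tn (UU_gt_real M))).
by move: h1 h2 h3; rewrite /= /trans add0r; lra.
Qed.

Lemma clim_X u g : clim (trans f u) g ->
  clim (trans X u) (fun z => der (der g) z * (g z - der g z)).
Proof.
move=> cg; have := climM (trans_clim_der2 cg) (climB cg (trans_clim_der cg)).
by [].
Qed.

Lemma clim_Y u g : clim (trans f u) g ->
  clim (trans Y u) (fun z => (der g z - a) * (g z - b)).
Proof. by move=> cg; exact: climM (climBc a (trans_clim_der cg)) (climBc b cg). Qed.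

(* Far from small values of [f] the function [f' - a] has no zero, and a large
   logarithmic derivative would force [f'] close to [a] near the level [|f| = A]. *)
Lemma second_bound : exists A K : R, [/\ cm a + cm b + 1 <= A, 0 <= K &
  forall z, A < cm (f z) -> cm (der (der f) z) <= K * cm (der f z - a)].
Proof.
have [K [K1 HK]] := sharing_growth.
have K0 : 0 <= K by lra.
pose A := cm a + cm b + 1.
have ca := cm_ge0 a; have cb := cm_ge0 b.
have A1 : 1 <= A by rewrite /A; lra.
(* By [gronwall], [|f| <= A2] within distance 1 of any point with [|f| <= A]; so a point with
   [|f| > A2] is the centre of a disc of radius above 1 on which [|f| > A]. *)
pose A2 := (1 + A ^+ 2) * expR (8 * K).
have AA2 : A <= A2.
  have e1 : 1 <= expR (8 * K) by rewrite -expR0 ler_expR mulr_ge0.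
  have : (1 + A ^+ 2) * 1 <= A2 by rewrite ler_pM2l// ltr_wpDr// exprn_ge0//; lra.
  by have := sqr_ge0 (A - 1); nra.
exists A2; apply: contrapT => H.
have /choice[z hz] : forall n : nat, exists z, A2 < cm (f z) /\
    n%:R * cm (der f z - a) < cm (der (der f) z).
  move=> n; apply: contrapT => Hn; apply: H; exists n%:R; split => // z zA.
  by rewrite leNgt; apply/negP => zn; apply: Hn; exists z.
have [s sA] := small_value hf nf (lt_le_trans ltr01 A1).
have near q w : cm (f q) <= A -> cm (w - q) <= 1 -> cm (f w) <= A2.
  move=> qA wq; have := @gronwall R f q 1 K hf K0 (fun v _ => HK v) w wq => h.
  apply: le_trans h _; rewrite /A2; apply: ler_pM; rewrite ?addr_ge0 ?exprn_ge0 ?cm_ge0 ?expR_ge0//.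
    by rewrite lerD2l ler_pXn2r ?nnegrE ?cm_ge0//; lra.
  by rewrite ler_expR -[leRHS]mulr1 ler_wpM2l// mulr_ge0.
have /choice[q hq] : forall n, exists q, [/\ cm (f q) <= A, 1 < cm (q - z n) &
    forall w, cm (w - z n) < cm (q - z n) -> A < cm (f w)].
  move=> n; have [zA _] := hz n.
  have nz : ~ cm (f (z n)) <= A by move=> h; move: zA; rewrite ltNge (le_trans h).
  have [|q [qA q0 _ qn]] := @nearest_point R (fun v => cm (f v) <= A) (z n) s sA nz.
    by apply: sublevel_closed => v; exact: ent_cont.
  exists q; split => // [|w /qn/negP]; last by rewrite -ltNge.
  rewrite ltNge cm_sym; apply/negP => qz.
  by move: zA; rewrite ltNge (near q).
pose d n := cm (q n - z n).
have d1 n : 1 < d n by have [] := hq n.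
pose C3 := 2 * K + cm a.
have C30 : 0 < C3 by rewrite /C3; lra.
have fa w : A < cm (f w) -> der f w - a != 0.
  move=> Aw; rewrite subr_eq0; apply/eqP => /Ha fw; move: Aw; rewrite fw /A; lra.
have fa_le w : A < cm (f w) -> cm (der f w - a) <= C3 * cm (f w).
  move=> Aw; apply: le_trans (cmB _ _) _; have := HK w.
  have : K * (1 + cm (f w)) <= K * (2 * cm (f w)) by rewrite ler_wpM2l//; lra.
  have : cm a * 1 <= cm a * cm (f w) by rewrite ler_wpM2l//; lra.
  rewrite /C3; lra.
(* Where [|f| > A] this is holomorphic with [|E| >= 1], so [harnack] applies with [m = 2^-1]. Its
   logarithmic derivative is [f'/f - f''/(f' - a)], whose first term is at most [2 * K]. *)
pose E w := C3%:C * f w / (der f w - a).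
have cE w : cm (E w) = C3 * cm (f w) / cm (der f w - a) by rewrite !cmM cmV cmR gtr0_norm.
have E1 w : A < cm (f w) -> 2^-1 < cm (E w).
  move=> Aw; rewrite cE; apply: (@lt_le_trans _ _ 1); first lra.
  by rewrite ler_pdivlMr ?cm_gt0 ?fa// mul1r fa_le.
have dE w : A < cm (f w) -> dif E w (E w * (der f w / f w - der (der f) w / (der f w - a))).
  move=> Aw; have fw : f w != 0 by rewrite -cm_gt0; lra.
  have h := difM (dif_scale C3%:C (ent_dif w hf)) (difV (ent_dif w (ent_subc a hf')) (fa w Aw)).
  apply: dif_eq h _; rewrite der_subc// /E; field; rewrite fw fa//.
have hE n : holo (z n) (d n) E.
  by move=> w wz; have [_ _ /(_ w wz) Aw] := hq n; eexists; exact: dE.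
have Nlow n : (n%:R - 2 * K) / 2 <= ln (cm (E (z n)) / 2^-1) / d n.
  have d0 : 0 < d n by apply: lt_trans (d1 n).
  have [zA zn] := hz n; have Az : A < cm (f (z n)) by exact: le_lt_trans zA.
  have [H1 _] := harnack d0 (m := 2^-1) ltac:(by rewrite invr_gt0) (hE n)
     (fun w wz => E1 w (let: And3 _ _ h := hq n in h w wz)).
  have Ez : 0 < cm (E (z n)) by have := E1 _ Az; lra.
  rewrite (der_eq (dE _ Az)) cmM mulrC ler_pM2r// in H1.
  have fz : 0 < cm (f (z n)) by lra.
  have h2 : cm (der f (z n) / f (z n)) <= 2 * K.
    rewrite cmM cmV ler_pdivrMr//; apply: le_trans (HK _) _.
    have : K * (1 + cm (f (z n))) <= K * (2 * cm (f (z n))) by rewrite ler_wpM2l//; lra.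
    lra.
  have h3 : n%:R <= cm (der (der f) (z n) / (der f (z n) - a)).
    by rewrite cmM cmV ler_pdivlMr ?cm_gt0 ?fa// ltW.
  have h4 := cm_le_dist (der (der f) (z n) / (der f (z n) - a)) (der f (z n) / f (z n)).
  rewrite cm_sym in h4.
  have e1 : 2 * ln (cm (E (z n)) / 2^-1) / d n = 2 * (ln (cm (E (z n)) / 2^-1) / d n) by ring.
  rewrite e1 in H1; lra.
(* At distance 1/2 from [q n] on the way to [z n]: the disc of radius 1/4 about [w n] keeps distance
   1/4 from the boundary of the disc about [z n], so Harnack's inequality makes [E] large on it; yet
   [|f| <= A2] there, so [f' - a] must be small. The translates then converge to a function of slope
   [a], contrary to [limit_not_linear]. *)
pose w n := q n + (2^-1 / d n)%:C * (z n - q n).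
have dn0 n : 0 < d n by apply: lt_trans (d1 n).
have wq n : cm (w n - q n) = 2^-1.
  rewrite /w addrAC subrr add0r cmM cmR (cm_sym (z n)) -/(d n) ger0_norm.
    by rewrite divfK// gt_eqF.
  by apply: divr_ge0 => //; exact: ltW.
have wz n : cm (w n - z n) = d n - 2^-1.
  have -> : w n - z n = (1 - 2^-1 / d n)%:C * (q n - z n) by rewrite /w rmorphB rmorph1 /=; ring.
  rewrite cmM cmR -/(d n) ger0_norm ?mulrBl ?divfK ?gt_eqF// ?mul1r//.
  rewrite subr_ge0 ler_pdivrMr// mul1r; have := d1 n; lra.
have fw n x : cm x <= 2^-1 -> cm (f (x + w n)) <= A2.
  move=> x2; apply: (near (q n)); first by have [] := hq n.
  rewrite -addrA (le_trans (cmD _ _))// wq; lra.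
have [g cg] : exists g, clim (trans f w) g.
  apply: (@trans_clim w A2); apply: filterE => n /=.
  by have := fw n 0; rewrite add0r cm0; apply; rewrite invr_ge0.
apply: (limit_not_linear cg) => x0; apply/eqP; rewrite -subr_eq0; apply/eqP; move: x0.
have hg' : ent (der g) by apply: ent_der; exact: clim_ent cg.
apply: (@ent_identity R (fun z => der g z - a) 0 4^-1); [exact: ent_subc|by rewrite invr_gt0|].
move=> x; rewrite subr0 => x4.
have [_ _ tg] := climBc a (trans_clim_der cg).
apply/eqP; rewrite -cm_eq0 eq_le cm_ge0 andbT; apply/ler_addgt0Pl => e e0; rewrite addr0.
apply: tends_cm_le (tg x) _.
pose M := 64 * (C3 * A2) / e + 2 * K.
apply: filterS (UU_gt_real M) => n /= hn; rewrite /trans.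
set y := x + w n.
have yz : cm (y - z n) <= d n - 4^-1.
  by rewrite /y -addrA (le_trans (cmD _ _))// wz; lra.
have yd : cm (y - z n) < d n by lra.
have Ay : A < cm (f y) by have [_ _] := hq n; exact.
have [_ /(_ y yd) H2] := harnack (dn0 n) (m := 2^-1) ltac:(by rewrite invr_gt0) (hE n)
   (fun v vz => E1 v (let: And3 _ _ h := hq n in h v vz)).
have Ny : (n%:R - 2 * K) / 2 / 16 <= ln (cm (E y) / 2^-1).
  apply: le_trans H2.
  have h4 : 4^-1 / d n <= 1 - cm (y - z n) / d n.
    by rewrite ler_pdivrMr// mulrBl divfK ?gt_eqF// mul1r; lra.
  have L0 : 0 <= ln (cm (E (z n)) / 2^-1).
    by rewrite ln_ge0// ler_pdivlMr// mul1r; apply/ltW/E1; have [zA _] := hz n; exact: le_lt_trans zA.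
  have h5 : ln (cm (E (z n)) / 2^-1) * (4^-1 / d n) <= ln (cm (E (z n)) / 2^-1) * (1 - cm (y - z n) / d n).
    by rewrite ler_wpM2l.
  have h6 := Nlow n.
  have e1 : ln (cm (E (z n)) / 2^-1) * (4^-1 / d n) = ln (cm (E (z n)) / 2^-1) / d n / 4 by ring.
  rewrite e1 in h5; lra.
have Ey : 0 < cm (E y) / 2^-1 by rewrite divr_gt0//; have := E1 _ Ay; lra.
have h7 := @le_ln1Dx R (cm (E y) / 2^-1 - 1).
have e8 : 1 + (cm (E y) / 2^-1 - 1) = cm (E y) / 2^-1 by ring.
rewrite e8 invrK in h7.
have {}h7 : ln (cm (E y) * 2) <= cm (E y) * 2 - 1 by apply: h7; rewrite invrK in Ey; lra.
rewrite invrK in Ny.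
have fya : 0 < cm (der f y - a) by rewrite cm_gt0 fa.
have CA : 0 < C3 * A2 by rewrite mulr_gt0//; lra.
have h8 : (C3 * A2) / e <= cm (E y).
  have : 64 * (C3 * A2) / e = 64 * ((C3 * A2) / e) by ring.
  rewrite /M in hn; lra.
move: h8; rewrite cE ler_pdivlMr// => h8.
have h9 : C3 * cm (f y) <= C3 * A2 by rewrite ler_pM2l//; apply: fw; lra.
have h10 : C3 * A2 / e * cm (der f y - a) <= C3 * A2 by exact: le_trans h9.
by move: h10; rewrite mulrAC ler_pdivrMr// ler_pM2l.
Qed.

(** About each zero of [F], on a disc of fixed radius [r], [f'] stays close to [b]. A point with
    small [F] and [|f'| < |b| / 2] is therefore far from all zeros; the largest disc about it with
    [|F| < d] has no zero of [F], and [touching] applies to [1 / F] on it. Its gradient bound gives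
    the first claim and its growth bound the second. *)
Lemma log_derivative_near_b : exists d K : R, [/\ 0 < d, 0 <= K &
  forall z, cm (F z) < d -> cm (der f z) < cm b / 2 ->
    cm (der f z) <= K * cm (F z) /\ (cm (F z))^-1 <= d^-1 * expR (K * (1 + cm z))].
Proof.
have [K [K1 HK]] := sharing_growth.
have K0 : 0 <= K by lra.
have cb : 0 < cm b by rewrite cm_gt0.
pose M1 := (1 + cm b ^+ 2) * expR (8 * K).
have M10 : 0 <= M1 by rewrite mulr_ge0 ?expR_ge0// addr_ge0// exprn_ge0// ltW.
pose M2 := K * (1 + M1).
have M20 : 0 < M2 by rewrite mulr_gt0//; lra.
have near p w : F p = 0 -> cm (w - p) <= 1 -> cm (der f w) <= M2.
  move=> /eqP; rewrite subr_eq0 => /eqP fp wp.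
  have h := @gronwall R f p 1 K hf K0 (fun v _ => HK v) w wp.
  apply: le_trans (HK w) _; rewrite /M2 ler_wpM2l// lerD2l; apply: le_trans h _.
  rewrite fp /M1 ler_wpM2l ?addr_ge0 ?exprn_ge0 ?cm_ge0//.
  by rewrite ler_expR -[leRHS]mulr1 ler_wpM2l// mulr_ge0.
have M16 : 0 < 16 * M2 by rewrite pmulr_rgt0.
(* Cauchy's estimate with radius 1/4 gives [|f''| <= 8 * M2] near a zero of [F], hence
   [|f' - b| <= |b| / 2] on the disc of radius [r]. *)
pose r := Num.min 2^-1 (cm b / (16 * M2)).
have r0 : 0 < r by rewrite lt_min invr_gt0 ltr0n divr_gt0.
have r2 : r <= 2^-1 by rewrite ge_min lexx.
have rM : r * (16 * M2) <= cm b by rewrite -(ler_pdivlMr _ _ M16) ge_min lexx orbT.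
have d1 p w : F p = 0 -> cm (w - p) <= r -> cm (der f w - b) <= cm b / 2.
  move=> Fp wp.
  have dp : der f p = b by apply: Hb; apply/eqP; rewrite -subr_eq0; apply/eqP.
  have := @lip_ball R (der f) p r (8 * M2) p w; rewrite subrr cm0 dp => H1.
  have {}H1 : cm (der f w - b) <= 8 * M2 * cm (w - p).
    apply: H1 => //; last exact: ltW.
    move=> v vp; exists (der (der f) v); split; first exact: ent_dif.
    have -> : 8 * M2 = 2 * M2 / 4^-1 by field.
    apply: (cauchy_estimate (r0 := 2^-1) (ent_holo hf') (ent_dif v hf')).
      by move=> x xv; apply: (near p) => //; have := cm_dist x v p; lra.
    by apply/andP; split; lra.
  have : 8 * M2 * cm (w - p) <= 8 * M2 * r by rewrite ler_pM2l// mulr_gt0.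
  lra.
have F1 p w : F p = 0 -> cm (w - p) <= r -> cm b / 2 * cm (w - p) <= cm (F w).
  move=> Fp wp; pose g v := F v - b * v.
  have := @lip_ball R g p r (cm b / 2) p w; rewrite subrr cm0 => H1.
  have {}H1 : cm (g w - g p) <= cm b / 2 * cm (w - p).
    apply: H1 => //; last exact: ltW.
    move=> v vp; exists (der f v - b); split; last exact: d1 vp.
    have := difB (ent_dif v hF) (dif_scale b (dif_id v)); rewrite dF mulr1; exact.
  have e1 : g w - g p = F w - b * (w - p) by rewrite /g Fp; ring.
  rewrite e1 in H1; have := cm_le_dist (b * (w - p)) (F w); rewrite (cm_sym (b * (w - p))) cmM.
  have := cm_ge0 (w - p); lra.
pose d := Num.min 1 (cm b * r / 8).
have d0 : 0 < d by rewrite lt_min ltr01 divr_gt0// mulr_gt0.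
have dl1 : d <= 1 by rewrite ge_min lexx.
have dbr : d <= cm b * r / 8 by rewrite ge_min lexx orbT.
have br : 0 < cm b * r by rewrite mulr_gt0.
have [s sd] := large_value d hF nF.
pose K1' := K * (2 + cm b).
have K1p : 0 <= K1' by rewrite mulr_ge0// addr_ge0// ltW.
pose KK := 8 * K1' / d * (1 + cm s).
have K8 : 0 <= 8 * K1' / d by apply: divr_ge0; [exact: mulr_ge0|exact: ltW].
have s0 := cm_ge0 s.
have KK8 : 8 * K1' / d <= KK by rewrite /KK mulrDr mulr1 lerDl mulr_ge0.
have KK0 : 0 <= KK by lra.
exists d, KK; split => // z zd zb.
have F0 w : F w = 0 -> cm b <= cm (der f w).
  move=> Fw; have -> // : der f w = b by apply: Hb; apply/eqP; rewrite -subr_eq0; apply/eqP.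
have nz : ~ d <= cm (F z) by rewrite leNgt zd.
have [|q [qd q0 qs qn]] := @nearest_point R (fun v => d <= cm (F v)) z s sd nz.
  by apply: superlevel_closed => v; exact: ent_cont.
set D := cm (q - z) in q0 qs qn.
have Fd w : cm (w - z) < D -> cm (F w) < d by move=> /qn/negP; rewrite -ltNge.
(* A zero [w] within [r] of [z] would put [f' z] too close to [b]. If it is farther away, the
   segment from [w] to [z] passes at distance [r / 2] from [w], where [|F| >= |b| * r / 4], which
   exceeds [d]. *)
have Fn0 w : cm (w - z) < D -> F w != 0.
  move=> wD; apply/eqP => Fw.
  have [zw|zw] := leP (cm (z - w)) r.
    have := d1 w z Fw zw; have := cm_le_dist b (der f z); rewrite (cm_sym b); lra.
  have zw0 : 0 < cm (z - w) by exact: lt_trans zw.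
  pose v := w + (r / 2 / cm (z - w))%:C * (z - w).
  have rz : 0 < r / 2 / cm (z - w) by rewrite !divr_gt0.
  have vw : cm (v - w) = r / 2.
    by rewrite /v addrAC subrr add0r cmM cmR gtr0_norm// divfK// gt_eqF.
  have vz : cm (v - z) < D.
    have -> : v - z = (1 - r / 2 / cm (z - w))%:C * (w - z) by rewrite /v rmorphB rmorph1 /=; ring.
    have t1 : r / 2 / cm (z - w) <= 1 by rewrite ler_pdivrMr// mul1r; lra.
    rewrite cmM cmR ger0_norm ?subr_ge0//; apply: le_lt_trans wD.
    by rewrite ler_piMl ?cm_ge0// gerBl ltW.
  have := Fd v vz; have := F1 w v Fw; rewrite vw => H1.
  have {}H1 := H1 ltac:(lra); lra.
have qE : cm (F q) = d.
  apply/eqP; rewrite eq_le qd andbT.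
  by apply: (cont_boundary_ge (ent_cont q hF) q0) => w /Fd; exact: ltW.
have Fq0 : F q != 0 by rewrite -cm_gt0 qE.
pose P w := (F w)^-1.
have dP w : F w != 0 -> dif P w (- der f w / F w ^+ 2).
  by move=> Fw; rewrite -dF; apply: difV Fw; exact: ent_dif.
have hP : holo z D P by move=> w wD; eexists; exact: dP (Fn0 w wD).
have Plow w : cm (w - z) < D -> d^-1 < cm (P w).
  by move=> wD; rewrite cmV ltf_pV2 ?posrE ?cm_gt0 ?Fn0// Fd.
have zD : cm (z - z) < D by rewrite subrr cm0.
have Fz := Fn0 z zD; have cFz : 0 < cm (F z) by rewrite cm_gt0.
have di0 : 0 < d^-1 by rewrite invr_gt0.
have Pq : cm (P q) = d^-1 by rewrite cmV qE.
have lK : cm (- der f q / F q ^+ 2) <= K1' / d ^+ 2.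
  rewrite cmM cmN cmV cmX qE ler_wpM2r ?invr_ge0 ?exprn_ge0 ?(ltW d0)//.
  apply: le_trans (HK q) _; rewrite ler_wpM2l//.
  have := cm_le_dist (f q) b; rewrite -/(F q) qE; lra.
have [T1 T2] := touching q0 di0 hP Plow erefl Pq (dP q Fq0) lK.
split.
  rewrite (der_eq (dP z Fz)) cmM cmN !cmV cmX in T2.
  have e1 : 8 * (K1' / d ^+ 2) / d^-1 = 8 * K1' / d by field; rewrite gt_eqF.
  rewrite e1 in T2.
  have : cm (der f z) <= 8 * K1' / d * cm (F z).
    move: T2; rewrite ler_pdivrMr ?exprn_gt0// => T2; apply: le_trans T2 _.
    by rewrite expr2 mulrA mulfVK ?gt_eqF.
  have : 8 * K1' / d * cm (F z) <= KK * cm (F z) by rewrite ler_pM2r.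
  lra.
have e2 : cm (P z) / d^-1 = d / cm (F z) by rewrite cmV invrK mulrC.
rewrite e2 in T1.
have T3 : ln (d / cm (F z)) <= KK * (1 + cm z).
  have : ln (d / cm (F z)) <= 4 * K1' / d * D.
    rewrite ler_pdivrMr// in T1; apply: le_trans T1 _.
    by have -> // : 4 * (K1' / d ^+ 2) * D * d = 4 * K1' / d * D by field; rewrite gt_eqF.
  have hD : D <= (1 + cm s) * (1 + cm z).
    have := cmB s z; have := cm_ge0 z; have : 0 <= cm s * cm z by rewrite mulr_ge0 ?cm_ge0.
    lra.
  have : 8 * K1' / d * D <= 8 * K1' / d * ((1 + cm s) * (1 + cm z)) by rewrite ler_wpM2l.
  have : 0 <= 8 * K1' / d * D by rewrite mulr_ge0// ltW.
  have -> : KK * (1 + cm z) = 8 * K1' / d * ((1 + cm s) * (1 + cm z)) by rewrite /KK; ring.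
  have -> : 4 * K1' / d * D = (8 * K1' / d * D) / 2 by field; rewrite gt_eqF.
  lra.
have dF0 : 0 < d / cm (F z) by rewrite divr_gt0.
rewrite -ler_expR lnK// in T3.
have -> : (cm (F z))^-1 = d^-1 * (d / cm (F z)) by field; rewrite !gt_eqF.
by rewrite ler_wpM2l// ltW.
Qed.

End Sharing.

(** * Constancy of Theta and elimination of the function *)

Section Rigidity.
Context {R : realType}.
Local Notation C := R[i].
Implicit Types (z w p q : C) (m r : R).

(** The lowest coefficients in [x] are read off in turn: [al k (al - c) = 0], then, with [c = al],
    [2 al k (1 - al) = 0], then, with [al = 1], [- 3 k = 0]. Each division by a power of [x] gives
    an identity off 0, which [vanish_off0] extends to 0 by continuity. *)
Lemma no_polynomial_relation (al b c k : C) : al != 0 -> k != 0 ->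
  (forall x : C, x != 0 ->
    let N := k - b * x * (1 - x) in let D := x * ((1 - x) * (al + x) - c) in
    let D' := (al - c) + 2 * (1 - al) * x - 3 * x ^+ 2 in let N' := - b * (1 - 2 * x) in
    b * D ^+ 2 + x * N * D + al * x * N * D' - al * x * N' * D = 0) -> False.
Proof.
move=> al0 k0 H.
pose N x := k - b * x * (1 - x).
pose N' x := - b * (1 - 2 * x).
pose D1 x := (al - c) + (1 - al) * x - x ^+ 2.
pose p1 x := al * N x * D1 x +
  x * (b * D1 x ^+ 2 + N x * D1 x + al * N x * ((1 - al) - 2 * x) - al * N' x * D1 x).
have e1 : ent p1.
  by rewrite /p1 /N /D1 /N'; repeat (apply: ent_cst || apply: ent_id || apply: entB || apply: entD || apply: entM || apply: entX).
have h1 : p1 0 = 0.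
  apply: vanish_off0 e1 _ => x x0; apply: (mulfI x0); rewrite mulr0 -(H x x0) /= /p1 /N /D1 /N'; ring.
have ec : c = al.
  apply/esym/eqP; rewrite -subr_eq0; apply/eqP/(mulfI (mulf_neq0 al0 k0)).
  by rewrite mulr0 -h1 /p1 /N /D1; ring.
subst c.
pose D2 x := (1 - al) - x.
pose p2 x := 2 * al * N x * D2 x +
  x * (b * x * D2 x ^+ 2 + N x * D2 x - al * N x - al * N' x * D2 x).
have e2 : ent p2.
  by rewrite /p2 /N /D2 /N'; repeat (apply: ent_cst || apply: ent_id || apply: entB || apply: entD || apply: entM || apply: entX).
have h2 : p2 0 = 0.
  apply: vanish_off0 e2 _ => x x0; apply: (mulfI (expf_neq0 2 x0)).
  by rewrite mulr0 -(H x x0) /= /p2 /N /D2 /N'; ring.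
have ea : al = 1.
  apply/esym/eqP; rewrite -subr_eq0; apply/eqP/(mulfI (mulf_neq0 (mulf_neq0 two_neq0 al0) k0)).
  by rewrite mulr0 -h2 /p2 /N /D2; ring.
subst al.
pose p3 x := - 3 * N x + x * (b * x ^+ 2 - N x + N' x).
have e3 : ent p3.
  by rewrite /p3 /N /N'; repeat (apply: ent_cst || apply: ent_id || apply: entB || apply: entD || apply: entM || apply: entX).
have h3 : p3 0 = 0.
  apply: vanish_off0 e3 _ => x x0; apply: (mulfI (expf_neq0 3 x0)).
  by rewrite mulr0 -(H x x0) /= /p3 /N /N'; ring.
have : 3 * k = 0 by rewrite -[RHS]oppr0 -h3 /p3 /N; ring.
by move/eqP; rewrite mulf_eq0 (negbTE k0) orbF pnatr_eq0.
Qed.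

Context (f : C -> C) (a b : C).
Context (hf : ent f) (nf : nonconst f) (a0 : a != 0) (b0 : b != 0) (ab : a != b).
Context (Ha : forall z, der f z = a -> f z = a)
  (Hb : forall z, f z = b -> der f z = b) (Hb' : forall z, der f z = b -> f z = b).

Let hf' : ent (der f). Proof. exact: ent_der. Qed.
Let hf'' : ent (der (der f)). Proof. exact: ent_der. Qed.

(** For [|f| > A], [second_bound] and the linear growth of [f'] bound Theta directly. For
    [|f| <= A], unbounded values along [u n] are refuted on a limit [g] of translates: unless [g] is
    the constant [b], the denominator does not degenerate and [quotient_bounded] applies. *)
Lemma theta_constant : exists c : C, forall z,
  der (der f) z * (f z - der f z) = c * ((der f z - a) * (f z - b)).
Proof.
have [T [hT TE]] := theta_exists hf nf a0 b0 ab Ha Hb.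
suff [M HM] : exists M : R, forall z, cm (T z) <= M.
  by exists (T 0) => z; rewrite -TE (liouville hT HM z 0).
have [A [K2 [AA K20 HK2]]] := second_bound hf nf a0 b0 ab Ha Hb.
have [K [K1 HK]] := sharing_growth hf nf a0 b0 ab Ha Hb.
have [d [Kb [d0 Kb0 HKb]]] := log_derivative_near_b hf nf a0 b0 ab Ha Hb.
have ca : 0 < cm a by rewrite cm_gt0.
have cb : 0 < cm b by rewrite cm_gt0.
have K0 : 0 <= K by lra.
have [M1 HM1] : exists M : R, forall z, A < cm (f z) -> cm (T z) <= M.
  exists (K2 * (1 + 2 * K) * (1 + cm b)) => z Az.
  have fa : der f z - a != 0.
    by rewrite subr_eq0; apply/eqP => /Ha fz; move: Az; rewrite fz; lra.
  have cfa : 0 < cm (der f z - a) by rewrite cm_gt0.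
  have fb1 : cm (f z) - cm b <= cm (f z - b) by have := cm_le_dist (f z) b; lra.
  have fb : 0 < cm (f z - b) by lra.
  have fp : 1 <= cm (f z) by lra.
  have := congr1 cm (TE z); rewrite !cmM => E.
  have h1 : cm (f z - der f z) <= (1 + 2 * K) * cm (f z).
    apply: le_trans (cmB _ _) _; have := HK z.
    have : K * (1 + cm (f z)) <= K * (2 * cm (f z)) by rewrite ler_wpM2l//; lra.
    lra.
  have h2 : cm (f z) <= (1 + cm b) * cm (f z - b).
    have : (1 + cm b) * (cm (f z) - cm b) <= (1 + cm b) * cm (f z - b).
      by rewrite ler_wpM2l//; lra.
    have : 0 <= cm b * (cm (f z) - cm b - 1) by rewrite mulr_ge0//; lra.
    lra.
  have h3 : cm (der (der f) z) * cm (f z - der f z) <=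
      (K2 * cm (der f z - a)) * ((1 + 2 * K) * ((1 + cm b) * cm (f z - b))).
    rewrite ler_pM ?cm_ge0 ?HK2//; apply: le_trans h1 _; rewrite ler_wpM2l//; lra.
  rewrite -E in h3.
  have pp : 0 < cm (der f z - a) * cm (f z - b) by rewrite mulr_gt0.
  rewrite -(ler_pM2r pp); apply: le_trans h3 _.
  by rewrite le_eqVlt; apply/orP; left; apply/eqP; ring.
suff [M2 HM2] : exists M : R, forall z, cm (f z) <= A -> cm (T z) <= M.
  exists (Num.max M1 M2) => z; rewrite le_max.
  by have [/HM2 ->|/HM1 ->] := leP (cm (f z)) A; rewrite ?orbT.
apply: contrapT => H.
have /choice[u hu] : forall n : nat, exists z, cm (f z) <= A /\ n%:R <= cm (T z).
  move=> n; apply: contrapT => Hn; apply: H; exists n%:R => z zA.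
  by rewrite leNgt; apply/negP => /ltW nz; apply: Hn; exists z.
have [g cg] : exists g, clim (trans f u) g.
  apply: (trans_clim hf nf a0 b0 ab Ha Hb (B := A)); apply: filterE => n /=.
  by have [] := hu n.
have Tn : UU [set n | n%:R <= cm (T (u n))] by apply: filterE => n /=; have [] := hu n.
have hg := clim_ent cg; have hg' := ent_der hg.
have nga : ~ forall z, der g z - a = 0.
  by move=> E; apply: (limit_not_linear hf a0 ab Hb cg) => z; apply/eqP; rewrite -subr_eq0 E.
have [gb|ngb] := pselect (forall z, g z - b = 0); last first.
  apply: (trans_quotient_bounded hT TE (clim_X hf cg) (clim_Y a b hf cg) _ Tn) => E.
  exact: ngb (ent_mul0 (ent_subc a hg') (ent_subc b hg) E nga).
(* the limit is the constant [b]: estimate the quotient by logarithmic derivatives *)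
have gE z : g z = b by apply/eqP; rewrite -subr_eq0 gb.
have dg z : der g z = 0.
  by apply: der_eq; apply: dif_ext (dif_cst b z) => w; rewrite gE.
have cg' := trans_clim_der hf cg.
have [hn lb tg] := cg; have [hn' lb' tg'] := cg'.
(* Uniform convergence on the unit disc when the limit is constant: points where the estimate fails
   converge along the ultrafilter, and [clim_moving] contradicts the failure. *)
have unif (phi : nat -> C -> C) (l : C) (e : R) : 0 < e -> clim phi (fun=> l) ->
    UU [set n | forall z, cm z <= 1 -> cm (phi n z - l) < e].
  move=> e0 [hphi lphi tphi]; apply: contrapT => /UU_not nU.
  have /choice[x hx] : forall n, exists z, cm z <= 1 /\
     ((exists w, cm w <= 1 /\ e <= cm (phi n w - l)) -> e <= cm (phi n z - l)).
    move=> n; have [[w [w1 we]]|nw] := pselect (exists w, cm w <= 1 /\ e <= cm (phi n w - l)).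
      by exists w; split.
    by exists 0; rewrite cm0; split.
  have [|x0 hx0] := @ulim_exists R x 1; first by apply: filterE => n; have [] := hx n.
  have t := clim_moving (And3 hphi lphi tphi) (fun n => (hx n).1) hx0.
  have e2 : 0 < e / 2 by rewrite divr_gt0.
  have [n /= [h1 h2]] := filter_ex (filterI (t _ e2) nU).
  have := (hx n).2; have : exists w, cm w <= 1 /\ e <= cm (phi n w - l).
    apply: contrapT => nw; apply: h2 => z z1; rewrite ltNge; apply/negP => ze.
    by apply: nw; exists z.
  by move=> h3 /(_ h3); lra.
have cgb : clim (trans f u) (fun=> b).
  by have -> : (fun=> b) = g by apply/funext => z; rewrite gE.
have cg0 : clim (trans (der f) u) (fun=> 0).
  by have -> : (fun=> 0) = der g by apply/funext => z; rewrite dg.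
pose d1 := Num.min d 1.
have d10 : 0 < d1 by rewrite lt_min d0 ltr01.
have d1d : d1 <= d by rewrite ge_min lexx.
have d11 : d1 <= 1 by rewrite ge_min lexx orbT.
(* The three bounds on [|f'|] serve [log_derivative_near_b], the lower bound [|f' - a| >= |a| / 2],
   and the bound on [|f - f'|]. *)
pose e1 := Num.min (cm b / 2) (Num.min (cm a / 2) 1).
have e10 : 0 < e1 by rewrite !lt_min !divr_gt0//= ltr01.
pose M := 4 * (2 * Kb * expR (8 * Kb)) * (cm b + 2) / (cm a / 2).
have [n [[U1 U2] U3]] := filter_ex (filterI (filterI (unif _ _ _ d10 cgb)
  (unif _ _ _ e10 cg0)) (UU_gt_real (Num.max M 0))).
have [_ Tun] := hu n.
pose v z := f (z + u n) - b.
have hv : ent v by apply: ent_subc; exact: ent_shift.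
have dv z : der v z = der f (z + u n).
  by rewrite /v der_subc ?der_shift//; exact: ent_shift.
have V2 z : cm z <= 1 -> cm (der f (z + u n)) < e1.
  by move=> /U2; rewrite /trans subr0.
have e1b : e1 <= cm b / 2 by rewrite ge_min lexx.
have e1a : e1 <= cm a / 2 by rewrite !ge_min lexx orbT.
have e11 : e1 <= 1 by rewrite !ge_min lexx !orbT.
have vK z : cm z <= 1 -> cm (der v z) <= Kb * cm (v z).
  move=> z1; have := V2 z z1; have := U1 z z1; rewrite /trans dv => h1 h2.
  have b2 : cm (der f (z + u n)) < cm b / 2 by lra.
  by have [] := HKb _ (lt_le_trans h1 d1d) b2.
have z01 : cm (0 : C) <= 1 by rewrite cm0.
have fu : f (u n) - b != 0.
  rewrite subr_eq0; apply/eqP => /Hb E.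
  have := V2 0 z01; rewrite add0r E; lra.
have v0 : v 0 != 0 by rewrite /v add0r.
(* Normalised to 1 at 0 and with bounded logarithmic derivative, [e] is bounded on the unit disc
   however small [v 0] is. Its second derivative at 0 is [f'' / (f - b)] at [u n], which is the
   factor of Theta that compactness cannot control. *)
pose e z := (v 0)^-1 * v z.
have he : ent e by exact: ent_scale.
have de z : der e z = (v 0)^-1 * der v z.
  by apply: der_eq; apply: dif_scale; exact: ent_dif.
have eK z : cm (z - 0) <= 1 -> cm (der e z) <= Kb * cm (e z).
  rewrite subr0 => z1; rewrite de !cmM mulrCA ler_wpM2l ?cm_ge0//.
  by have := vK z z1.
have e0E : e 0 = 1 by rewrite /e mulVf.
have e2 z : cm (z - 0) <= 1 -> cm (e z) <= 2 * expR (8 * Kb).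
  move=> z1; have h := @gronwall R e 0 1 Kb he Kb0 _ z z1.
  apply: le_trans (h _) _.
    by move=> w w1; apply: le_trans (eK w w1) _; rewrite ler_wpM2l// lerDr.
  rewrite e0E cm1 expr1n; have -> : 1 + 1 = 2 :> R by ring.
  by rewrite ler_pM2l// ler_expR -[leRHS]mulr1 ler_wpM2l// mulr_ge0.
have dde : cm (der (der e) 0) <= 4 * (2 * Kb * expR (8 * Kb)).
  have -> : 4 * (2 * Kb * expR (8 * Kb)) = 2 * (2 * Kb * expR (8 * Kb)) / 2^-1 by field.
  have he' := ent_der he.
  apply: (cauchy_estimate (r0 := 1) (ent_holo he') (ent_dif 0 he')).
    move=> z z1; apply: le_trans (eK z (ltW z1)) _.
    have : Kb * cm (e z) <= Kb * (2 * expR (8 * Kb)) by rewrite ler_wpM2l// e2// ltW.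
    lra.
  by apply/andP; split; lra.
have ddE : der (der e) 0 = (v 0)^-1 * der (der f) (u n).
  rewrite (der_ext 0 de); apply: der_eq.
  have -> : der (der f) (u n) = der (fun z => der f (z + u n)) 0 by rewrite der_shift// add0r.
  apply: dif_scale; have -> : der v = fun z => der f (z + u n) by apply/funext.
  by apply: ent_dif; exact: ent_shift.
have TE0 : T (u n) * (der f (u n) - a) = der (der e) 0 * (f (u n) - der f (u n)).
  apply: (mulIf fu); rewrite -mulrA TE ddE /v add0r; field; exact: fu.
have fda : cm a / 2 <= cm (der f (u n) - a).
  have := V2 0 z01; rewrite add0r.
  have := cm_le_dist a (der f (u n)); rewrite (cm_sym a); lra.
have fdb : cm (f (u n) - der f (u n)) <= cm b + 2.
  have h1 := U1 0 z01; have h2 := V2 0 z01; rewrite /trans add0r in h1 h2.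
  have h3 := cm_le_dist (f (u n)) b.
  by apply: le_trans (cmB _ _) _; lra.
have a2 : 0 < cm a / 2 by rewrite divr_gt0.
have Tle : cm (T (u n)) <= M.
  rewrite /M ler_pdivlMr//; apply: (@le_trans _ _ (cm (T (u n)) * cm (der f (u n) - a))).
    by rewrite ler_wpM2l// cm_ge0.
  by rewrite -cmM TE0 cmM ler_pM ?cm_ge0.
have MN : M < n%:R by move: U3; rewrite /= gt_max => /andP[].
lra.
Qed.

(** For [|f - b| >= d] the growth of [f'] suffices. For smaller [|f - b|] with [|f'| >= |b| / 2], a
    limit of translates cannot be the constant [b], so [Q] is bounded by compactness. In the
    remaining region [log_derivative_near_b] bounds [1 / |f - b|] exponentially. *)
Lemma quotient_growth Q : ent Q -> (forall z, Q z * (f z - b) = der f z - b) ->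
  exists A B : R, [/\ 0 < A, 0 <= B & forall z, cm (Q z) <= A * expR (B * cm z)].
Proof.
move=> hQ QE.
have [K [K1 HK]] := sharing_growth hf nf a0 b0 ab Ha Hb.
have [d [Kb [d0 Kb0 HKb]]] := log_derivative_near_b hf nf a0 b0 ab Ha Hb.
have cb : 0 < cm b by rewrite cm_gt0.
have K0 : 0 <= K by lra.
have [M HM] : exists M : R, forall z, cm (f z - b) < d -> cm b / 2 <= cm (der f z) ->
    cm (Q z) <= M.
  apply: contrapT => H.
  have /choice[u hu] : forall n : nat, exists z, [/\ cm (f z - b) < d,
      cm b / 2 <= cm (der f z) & n%:R <= cm (Q z)].
    move=> n; apply: contrapT => Hn; apply: H; exists n%:R => z z1 z2.
    by rewrite leNgt; apply/negP => /ltW nz; apply: Hn; exists z.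
  have [g cg] : exists g, clim (trans f u) g.
    apply: (trans_clim hf nf a0 b0 ab Ha Hb (B := cm b + d)); apply: filterE => n /=.
    by have [h1 _ _] := hu n; rewrite (le_trans (cm_le_dist _ b))// lerD2l ltW.
  have Qn : UU [set n | n%:R <= cm (Q (u n))] by apply: filterE => n /=; have [] := hu n.
  have cg' := trans_clim_der hf cg.
  apply: (trans_quotient_bounded hQ QE (climBc b cg') (climBc b cg) _ Qn) => E.
  have dg0 : der g 0 = 0.
    apply: der_eq; apply: dif_ext (dif_cst b 0) => w.
    by have /eqP := E w; rewrite subr_eq0 => /eqP ->.
  have [_ _ tg] := cg'.
  have := @tends_cm_ge R nat UU _ _ (cm b / 2) (tg 0).
  rewrite dg0 cm0 => H1; have : cm b / 2 <= 0; last lra.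
  by apply: H1; apply: filterE => n; rewrite /= /trans add0r; have [] := hu n.
pose A1 := K + (K * (1 + cm b) + cm b) / d.
pose A2 := 2 * cm b * (d^-1 * expR Kb).
have A10 : 0 <= A1.
  rewrite addr_ge0//; apply: divr_ge0; last exact: ltW.
  by rewrite addr_ge0 ?(ltW cb)// mulr_ge0//; lra.
have A20 : 0 <= A2.
  by rewrite !mulr_ge0 ?expR_ge0 ?(ltW cb)// invr_ge0 ltW.
pose A := A1 + `|M| + A2 + 1.
have M0 := normr_ge0 M.
exists A, Kb; split => // [|z]; first by rewrite /A; lra.
have ex1 : 1 <= expR (Kb * cm z) by rewrite -expR0 ler_expR mulr_ge0 ?cm_ge0.
have AE : A <= A * expR (Kb * cm z) by rewrite ler_peMr// /A; lra.
have := congr1 cm (QE z); rewrite cmM => E.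
have [Fd|Fd] := leP d (cm (f z - b)).
  apply: le_trans AE; have F0 : 0 < cm (f z - b) by lra.
  have : cm (Q z) <= A1; last by rewrite /A; lra.
  rewrite -(ler_pM2r F0) E; apply: le_trans (cmB _ _) _.
  have h1 := HK z; have h2 := cm_le_dist (f z) b.
  have h3 : K * (1 + cm (f z)) <= K * (1 + cm b + cm (f z - b)) by rewrite ler_wpM2l//; lra.
  have h4 : (K * (1 + cm b) + cm b) <= (K * (1 + cm b) + cm b) / d * cm (f z - b).
    rewrite mulrAC ler_pdivlMr// ler_wpM2l// addr_ge0 ?(ltW cb)// mulr_ge0//; lra.
  rewrite /A1 mulrDl; lra.
have [fb|fb] := leP (cm b / 2) (cm (der f z)).
  by apply: le_trans AE; have := HM z Fd fb; have := ler_norm M; rewrite /A; lra.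
have [_ Finv] := HKb z Fd fb.
have F0 : 0 < cm (f z - b).
  rewrite cm_gt0 subr_eq0; apply/eqP => /Hb fz; move: fb; rewrite fz; lra.
have Q1 : cm (Q z) = cm (der f z - b) / cm (f z - b) by rewrite -E mulfK// gt_eqF.
have Q2 : cm (der f z - b) <= 2 * cm b by apply: le_trans (cmB _ _) _; lra.
have Q3 : cm (Q z) <= A2 * expR (Kb * cm z).
  rewrite Q1 /A2.
  have -> : 2 * cm b * (d^-1 * expR Kb) * expR (Kb * cm z) =
      2 * cm b * (d^-1 * expR (Kb * (1 + cm z))) by rewrite mulrDr mulr1 expRD; ring.
  by rewrite ler_pM ?cm_ge0 ?invr_ge0 ?cm_ge0.
apply: le_trans Q3 _; rewrite ler_wpM2r ?expR_ge0// /A; lra.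
Qed.

Lemma sharing_derivative_eq : forall z, der f z = f z.
Proof.
have [c cE] := theta_constant.
have hu : ent (fun z => f z - der f z) by exact: entB.
have lin k : (forall z, der f z = k) -> False.
  move=> dk; have E := ent_linear hf dk.
  have [k0|k0] := eqVneq k 0.
    by apply: nf => z; rewrite E k0 mul0r addr0.
  have fp : f ((b - f 0) / k) = b by rewrite E mulrC divfK// addrC subrK.
  have kb : k = b by rewrite -(dk ((b - f 0) / k)) Hb.
  by apply: nf => z; rewrite !(@Hb' _)// dk.
have [c0|c0] := eqVneq c 0.
  have H z : der (der f) z * (f z - der f z) = 0 by rewrite cE c0 mul0r.
  have nd : ~ forall z, der (der f) z = 0.
    move=> E; apply: (lin (der f 0)) => z; apply: ent_dif0_const => w.
    by rewrite -(E w); exact: ent_dif.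
  by move=> z; have /eqP := ent_mul0 hf'' hu H nd z; rewrite subr_eq0 => /eqP.
have [Q [hQ QE]] := Q_exists hf nf b0 Hb.
have hF : ent (fun z => f z - b) by exact: ent_subc.
have dFz z : dif (fun w => f w - b) z (der f z).
  by have := ent_dif z hF; rewrite der_subc.
(* At a zero of [Q] one has [f = f' = b] and [f'' = 0]. Then [f'' (f - f')] has derivative 0 there,
   while [c (f' - a)(f - b)] has derivative [c (b - a) b]. *)
have Q0 z : Q z != 0.
  apply/eqP => Qz.
  have dfz : der f z = b by apply/eqP; rewrite -subr_eq0 -QE Qz mul0r.
  have fz : f z = b by exact: Hb'.
  have ddf : der (der f) z = 0.
    rewrite -(der_subc b z hf'); apply: der_eq.
    apply: dif_ext QE (dif_eq (difM (ent_dif z hQ) (dFz z)) _).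
    by rewrite fz subrr mulr0 Qz mul0r addr0.
  have dX : dif (fun w => der (der f) w * (f w - der f w)) z 0.
    apply: dif_eq (difM (ent_dif z hf'') (ent_dif z hu)) _.
    by rewrite fz dfz subrr ddf mulr0 mul0r addr0.
  have dY : dif (fun w => c * ((der f w - a) * (f w - b))) z (c * ((b - a) * b)).
    apply: dif_eq (dif_scale c (difM (difB (ent_dif z hf') (dif_cst a z)) (dFz z))) _.
    by rewrite fz subrr mulr0 add0r dfz.
  have := dif_unique dX (dif_ext (fun w => esym (cE w)) dY).
  by move/esym/eqP; rewrite !mulf_eq0 (negbTE c0) (negbTE b0) subr_eq0 eq_sym (negbTE ab).
have [A [B [A0 B0 QB]]] := quotient_growth hQ QE.
have [al [be QC]] := ent_cexp_linear hQ Q0 A0 B0 QB.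
have dQ z : dif Q z (al * Q z).
  have := ent_dif z hQ; suff -> : der Q z = al * Q z by [].
  rewrite (der_ext z QC) QC; apply: der_eq.
  by apply: dif_eq (dif_comp (dif_affine al be z) (cexp_dif _)) _; rewrite mulrC.
have dfE z : der f z = b + Q z * (f z - b) by rewrite QE addrC subrK.
have ddfE z : der (der f) z = Q z * (al * (f z - b) + der f z).
  rewrite -(der_subc b z hf'); apply: der_eq.
  by apply: dif_ext QE (dif_eq (difM (dQ z) (dFz z)) _); ring.
have [al0|al0] := eqVneq al 0.
  have Qk z : Q z = Q 0 by rewrite !QC al0 !mul0r.
  pose k := Q 0; have k0 : k != 0 by exact: Q0.
  have ddk z : der (der f) z = k * der f z by rewrite ddfE al0 mul0r add0r Qk.
  pose h z := der f z * cexp ((- k) * z + 0).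
  have h0 z : h z = h 0.
    apply: ent_dif0_const => w.
    apply: dif_eq (difM (ent_dif w hf') (dif_comp (dif_affine (- k) 0 w) (cexp_dif _))) _.
    by rewrite ddk; ring.
  have dfh z : der f z = h 0 * cexp (k * z).
    by rewrite -(h0 z) /h addr0 mulNr cexpN mulfVK// cexp_neq0.
  have hn0 : h 0 != 0.
    by apply/eqP => H; apply: (lin 0) => z; rewrite dfh H mul0r.
  have [w wE] : exists w : C, cexp w = a / h 0 by apply: cexp_surj; rewrite mulf_neq0 ?invr_eq0.
  have dfp : der f (w / k) = a.
    have kw : k * (w / k) = w by rewrite mulrC divfK.
    by rewrite dfh kw wE mulrC divfK.
  have := QE (w / k); rewrite dfp (Ha dfp) Qk -/k => E.
  have k1 : k = 1 by apply: (mulIf (_ : a - b != 0)); rewrite ?subr_eq0// E mul1r.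
  by move=> z; rewrite dfE Qk -/k k1 mul1r addrC subrK.
exfalso.
(* Substituting [f' = b + Q (f - b)] and [f'' = Q (al (f - b) + f')] into the relation for Theta
   leaves a common factor [f - b], which is cancelled. *)
have rel z : (f z - b) * (Q z * ((1 - Q z) * (al + Q z) - c)) =
    c * (b - a) - b * Q z * (1 - Q z).
  pose Z z := Q z * (al * (f z - b) + b + Q z * (f z - b)) * (1 - Q z) -
    c * (b - a + Q z * (f z - b)).
  have hZ : ent Z.
    by rewrite /Z; repeat (apply: ent_cst || apply: hQ || apply: hF || apply: entB || apply: entD || apply: entM).
  have FZ w : (f w - b) * Z w = 0.
    have E := cE w; rewrite ddfE !dfE in E.
    by move/eqP: E; rewrite -subr_eq0 => /eqP <-; rewrite /Z; ring.
  have Z0 := ent_mul0 hF hZ FZ (f_not_b nf) z.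
  by apply/eqP; rewrite -subr_eq0; apply/eqP; rewrite -Z0 /Z; ring.
have k0 : c * (b - a) != 0 by rewrite mulf_neq0// subr_eq0 eq_sym.
(* [Q] takes every non-zero value [x]. Differentiating [rel] at such a point and using [rel] once
   more eliminates [f - b], leaving the polynomial relation in [x]. *)
apply: (@no_polynomial_relation al b c (c * (b - a)) al0 k0) => x x0 N D D' N'.
have [w wE] := cexp_surj x0.
pose z := (w - be) / al.
have Qz : Q z = x by rewrite QC /z mulrC divfK// subrK.
have dL : dif (fun z => (f z - b) * (Q z * ((1 - Q z) * (al + Q z) - c))) z
   (der f z * D + (f z - b) * (al * x * D')).
  have d1 := dQ z.
  have d2 := difB (difM (difB (dif_cst 1 z) d1) (difD (dif_cst al z) d1)) (dif_cst c z).
  apply: dif_eq (difM (dFz z) (difM d1 d2)) _.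
  by rewrite Qz /D /D'; ring.
have dR : dif (fun z => c * (b - a) - b * Q z * (1 - Q z)) z (al * x * N').
  have d1 := dQ z.
  apply: dif_eq (difB (dif_cst (c * (b - a)) z)
    (difM (dif_scale b d1) (difB (dif_cst 1 z) d1))) _.
  by rewrite Qz /N'; ring.
have E := dif_unique (dif_ext rel dL) dR.
have E2 := rel z; rewrite Qz -/D -/N in E2.
have E3 := dfE z; rewrite Qz in E3; rewrite E3 in E.
have -> : b * D ^+ 2 + x * N * D + al * x * N * D' - al * x * N' * D =
  D * (b * D + x * N) + al * x * N * D' - D * (al * x * N') by ring.
by rewrite -E -E2; ring.
Qed.

End Rigidity.

(** * Several variables *)

Section Lines.
Context {R : realType} {n : nat}.
Local Notation C := R[i].
Local Notation V := 'rV[R[i]^o]_n.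
Implicit Types (f : V -> R[i]^o) (z v u : V) (t s : C).

Lemma line_dif f z v t : differentiable f (z + (t : R[i]^o) *: v) ->
  dif (fun x : C => f (z + (x : R[i]^o) *: v)) t ('D_v f (z + (t : R[i]^o) *: v)).
Proof.
move=> df; have := diff_derivable (v := v) df.
set w := z + _ *: v => dw; set l := 'D_v f w.
have /cvgrPdist_le H : (fun h : R[i]^o => h^-1 *: (f (h *: v + w) - f w)) @ 0^' --> l by exact: dw.
apply/difP => e e0.
have e0C : (0 : R[i]) < e%:C by rewrite ltcR.
have := H _ e0C; rewrite /dnbhs /= => /nbhs_ballP[d /= d0 hd].
(* The radius lives in [R[i]]; being positive there, it is real. *)
have dE : d = (complex.Re d)%:C by rewrite RRe_real// gtr0_real.
have d0' : 0 < complex.Re d by move: d0; rewrite dE ltcR.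
exists (complex.Re d) => // x xd.
have [->|xt] := eqVneq x t; first by rewrite !subrr mulr0 subr0 cm0 mulr0.
have xt0 : x - t != 0 by rewrite subr_eq0.
have := hd (x - t); rewrite /ball /= sub0r normrN normcm dE ltcR => /(_ xd xt0).
have -> : (x - t : R[i]^o) *: v + w = z + (x : R[i]^o) *: v.
  by rewrite /w scalerBl addrCA subrK.
rewrite /GRing.scale /= normcm lecR => h.
have -> : f (z + (x : R[i]^o) *: v) - f w - l * (x - t) =
  - ((x - t) * (l - (x - t)^-1 * (f (z + (x : R[i]^o) *: v) - f w))) by field.
by rewrite cmN cmM mulrC ler_wpM2r// cm_ge0.
Qed.

Definition coord (j : 'I_n) : V := delta_mx ord0 j.

Lemma row_coords z : z = \sum_j z ord0 j *: coord j.
Proof. exact: row_sum_delta. Qed.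

Lemma polynomial_cst f : (forall z, f z = f 0) -> is_polynomial f.
Proof.
move=> fc; exists (mpoly.mpolyC n (f 0)) => z.
by rewrite mpoly.mevalC fc.
Qed.

Section Reduction.
Context (f : V -> R[i]^o) (a b : R[i]).
Context (hf : entire f) (a0 : a != 0) (b0 : b != 0) (ab : a != b).
Context (h1 : forall j : 'I_n, value_imp (partial j f) f a)
  (h2 : forall j : 'I_n, value_iff f (partial j f) b).

Let line z j (t : C) : C := f (z + (t : R[i]^o) *: coord j).

Lemma dif_line z j t : dif (line z j) t (partial j f (z + (t : R[i]^o) *: coord j)).
Proof. exact: line_dif (hf _). Qed.

Lemma line0 z j : line z j 0 = f z.
Proof. by rewrite /line scale0r addr0. Qed.

Lemma line_dichotomy z j : (forall t, line z j t = f z) \/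
  (f z != 0 /\ forall t, line z j t = f z * cexp t).
Proof.
have [c|nc] := pselect (forall t, line z j t = f z); [by left|right].
have hg : ent (line z j) by move=> t; eexists; exact: dif_line.
have dg t : der (line z j) t = partial j f (z + (t : R[i]^o) *: coord j).
  exact/der_eq/dif_line.
have ng : nonconst (line z j).
  by move=> H; apply: nc => t; rewrite H line0.
have E := sharing_derivative_eq hg ng a0 b0 ab
  (fun t => _ : der (line z j) t = a -> line z j t = a)
  (fun t => _ : line z j t = b -> der (line z j) t = b)
  (fun t => _ : der (line z j) t = b -> line z j t = b).
have {}E t : der (line z j) t = line z j t.
  apply: E => s; rewrite dg; [exact: h1|exact: (h2 j).1|exact: (h2 j).2].
have eq t : line z j t = f z * cexp t.
  pose h s := line z j s * cexp ((- 1) * s + 0).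
  have h0 : h t = h 0.
    apply: ent_dif0_const => s.
    apply: dif_eq (difM (ent_dif s hg) (dif_comp (dif_affine (- 1) 0 s) (cexp_dif _))) _.
    by rewrite E; ring.
  move: h0; rewrite /h !addr0 mulr0 cexp0 mulr1 line0 mulN1r cexpN => <-.
  by rewrite mulfVK// cexp_neq0.
split => //; apply/eqP => fz; apply: nc => t.
by rewrite eq fz mul0r.
Qed.

Definition exponential_at u := f u != 0 /\ forall j t, line u j t = f u * cexp t.

(* Were the line in direction [i] through the translate constant, the fourth side of
   a parallelogram with two exponential sides would contradict the dichotomy. *)
Lemma exponential_translate u j t : exponential_at u ->
  exponential_at (u + (t : R[i]^o) *: coord j).
Proof.
move=> [fu Hu]; set u' := u + _.
have fu' : f u' = f u * cexp t by exact: Hu.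
have fu'0 : f u' != 0 by rewrite fu' mulf_neq0// cexp_neq0.
split => // i x.
case: (line_dichotomy u' i) => [c|[_ ->//]].
(* The parallelogram has corner [u] and sides [s] and [t] in directions [i] and [j]. Its far corner
   has value [f u * cexp t]; along direction [j] from the corner at [s], a constant line would
   require [cexp s = cexp t] and an exponential one [cexp s = 1]. *)
have [s [s1 st]] : exists s : C, cexp s != 1 /\ cexp s != cexp t.
  have c2 : (2 : C) != 0 by rewrite pnatr_eq0.
  have c3 : (3 : C) != 0 by rewrite pnatr_eq0.
  have [s2 E2] := cexp_surj c2; have [s3 E3] := cexp_surj c3.
  have n1 k : (k.+2%:R : C) != 1 by rewrite -[1]/(1%:R) eqr_nat.
  have [e|ne] := eqVneq (cexp t) 2; last by exists s2; rewrite E2 n1 eq_sym.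
  by exists s3; rewrite E3 n1 e; split => //; rewrite eqr_nat.
exfalso.
have fs : f (u + (s : R[i]^o) *: coord i) = f u * cexp s by exact: Hu.
have corner : line (u + (s : R[i]^o) *: coord i) j t = f u * cexp t.
  have -> : f u * cexp t = line u' i s by rewrite c fu'.
  by rewrite /line /u' addrAC.
case: (line_dichotomy (u + (s : R[i]^o) *: coord i) j) => [c'|[_ c']].
  by move: corner; rewrite c' fs => /(mulfI fu) /eqP; rewrite (negbTE st).
move: corner; rewrite c' fs mulrAC => /eqP; rewrite -subr_eq0.
have -> : f u * cexp t * cexp s - f u * cexp t = f u * cexp t * (cexp s - 1) by ring.
by rewrite mulf_eq0 subr_eq0 (negbTE s1) orbF mulf_eq0 (negbTE fu) (negbTE (cexp_neq0 t)).
Qed.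

Lemma exponential_sum u (x : 'I_n -> C) (r : seq 'I_n) : exponential_at u ->
  exponential_at (u + \sum_(j <- r) (x j : R[i]^o) *: coord j) /\
  f (u + \sum_(j <- r) (x j : R[i]^o) *: coord j) = f u * cexp (\sum_(j <- r) x j).
Proof.
elim: r u => [|j r IH] u hu.
  by rewrite !big_nil addr0 cexp0 mulr1.
have [h e] := IH _ (exponential_translate j (x j) hu).
rewrite !big_cons addrA; split => //.
have Hj : f (u + (x j : R[i]^o) *: coord j) = f u * cexp (x j) by case: hu => _; exact.
rewrite e Hj cexpD; symmetry; exact: (mulrA (f u : R[i])).
Qed.

(** A non-constant [f] is exponential along some coordinate line and takes the value [b] on it. At
    that point every partial derivative equals [b], which is not 0, so every coordinate line through
    it is exponential. *)
Lemma exponential_exists : ~ is_polynomial f -> exists u, exponential_at u.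
Proof.
move=> np.
have [z [j hz]] : exists z j, ~ forall t, line z j t = f z.
  apply: contrapT => H; apply: np; apply: polynomial_cst => z.
  have K (r : seq 'I_n) : f (\sum_(j <- r) z ord0 j *: coord j) = f 0.
    elim: r => [|j r IH]; first by rewrite big_nil.
    rewrite big_cons -IH addrC.
    apply: contrapT => ne; apply: H; exists (\sum_(j <- r) z ord0 j *: coord j), j => L.
    by apply: ne; exact: L.
  by rewrite [in LHS](row_coords z) K.
have [//|[fz E]] := line_dichotomy z j.
have [t tE] : exists t : C, cexp t = b / f z by apply: cexp_surj; rewrite mulf_neq0 ?invr_eq0.
pose w := z + (t : R[i]^o) *: coord j.
have fw : f w = b by rewrite -[f w]/(line z j t) E tE mulrC divfK.
exists w; split => [|i]; first by rewrite fw.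
case: (line_dichotomy w i) => [c|[_ //]].
have := dif_line w i 0; rewrite scale0r addr0 ((h2 i).1 _ fw) => d.
have d0 : dif (line w i) 0 0 by apply: dif_ext (dif_cst (f w) 0) => s; rewrite c.
by have /eqP := dif_unique d d0; rewrite (negbTE b0).
Qed.

End Reduction.
End Lines.

Unset Implicit Arguments.

Theorem theorem1p2 (R : realType) (n : nat) (hn : (1 <= n)%N)
    (f : 'rV[R[i]^o]_n -> R[i]^o) (hf : transcendental_entire f)
    (a b : R[i]) (ha : a != 0) (hb : b != 0) (hab : a != b)
    (h1 : forall j : 'I_n, value_imp (partial j f) f a)
    (h2 : forall j : 'I_n, value_iff f (partial j f) b) :
  exists c : R[i], c != 0 /\
    forall z : 'rV[R[i]^o]_n, f z = c * cexp (\sum_(j < n) z ord0 j).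
Proof.
have [u hu] := exponential_exists hf.1 ha hb hab h1 h2 hf.2.
exists (f u * cexp (- \sum_(j < n) u ord0 j)); split.
  by apply: mulf_neq0; [case: hu|exact: cexp_neq0].
move=> z.
have [_] := exponential_sum hf.1 ha hb hab h1 h2 (fun j => (z - u) ord0 j) (index_enum _) hu.
rewrite -(row_coords (z - u)) addrC subrK => ->.
rewrite -mulrA -cexpD; congr (_ * cexp _).
rewrite [RHS]addrC; transitivity (\sum_(j < n) ((z ord0 j : R[i]) - (u ord0 j : R[i]))).
  by apply: eq_bigr => j _; rewrite !mxE.
exact: (@sumrB R[i] _ _ _ (fun j => z ord0 j) (fun j => u ord0 j)).
Qed.
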